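(* Let $T$ be a bounded operator on a Hilbert space $\mathcal{H}$ with $w(T)\le1$. If $n\ge1$ and $F:\mathbb{D}\to M_n$ is a matrix polynomial (or, more generally, has coefficients in $A(\mathbb{D})$), then \[ w(F(T))\le\frac54\|F\|_\infty. \]
   Context: The numerical radius of an operator $X$ is $w(X)=\sup\{|\langle Xx,x\rangle| : \|x\|=1\}$. $\mathbb{D}$ is the open unit disc in $\mathbb{C}$, $M_n=M_n(\mathbb{C})$ with the operator norm, and $A(\mathbb{D})$ is the disc algebra (functions continuous on $\overline{\mathbb{D}}$ and holomorphic on $\mathbb{D}$). A matrix polynomial is an $n\times n$ matrix $F=(f_{ij})$ whose entries are polynomials; ''coefficients in $A(\mathbb{D})$'' means that the entries $f_{ij}$ belong to $A(\mathbb{D})$. Set $F(T)=(f_{ij}(T))\in\mathcal{M}_n(\mathcal{B}(\mathcal{H}))\simeq\mathcal{B}(\mathcal{H}^{(n)})$ and $\|F\|_\infty=\sup\{\|F(z)\| : z\in\mathbb{D}\}$. For $f\in A(\mathbb{D})$, $f(T)$ is defined as the norm limit of $p_k(T)$ for polynomials $p_k\to f$ uniformly on $\overline{\mathbb{D}}$ (for $w(T)\le1$ there is a constant $c$ with $\|p(T)\|\le c\sup_{\mathbb{D}}|p|$ for all polynomials $p$, so this is well defined). *)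

(* Defs.v *)
From HB Require Import structures.
From mathcomp Require Import all_boot all_order all_algebra.
From mathcomp Require Import sesquilinear complex.
From mathcomp Require Import all_classical all_reals all_analysis.

Set Implicit Arguments.
Unset Strict Implicit.
Unset Printing Implicit Defensive.

Import Order.TTheory GRing.Theory Num.Theory Num.Def.
Import numFieldNormedType.Exports.

Local Open Scope classical_set_scope.
Local Open Scope ring_scope.

(* The complex numbers are R[i]; they get the topology and norm that the
   library puts on every numFieldType, under the alias ^o. *)
Set Warnings "-redundant-canonical-projection".
HB.instance Definition _ (R : rcfType) := NormedModule.copy R[i] R[i]^o.
Set Warnings "redundant-canonical-projection".

(* Inner products are linear in the first variable. *)
HB.mixin Record isHilbert (R : realType) H & CompleteNormedModule R[i] H := {
  inner : {dot H for @conjC R[i]} ;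
  innerE : forall x : H, inner x x = `|x| ^+ 2
}.

#[short(type="hilbertType")]
HB.structure Definition Hilbert (R : realType) :=
  {H of CompleteNormedModule R[i] H & isHilbert R H}.

Section InnerProductSpaces.
Variables (R : realType) (V : lmodType R[i]) (ip : {dot V for @conjC R[i]}).

(* On a Hilbert space, with ip = inner, this is the norm `|x| (see innerE), as
   an element of R instead of R[i]. *)
Definition ipnorm (x : V) : R := Num.sqrt (complex.Re (ip x x)).

Definition opnorm (X : V -> V) : \bar R :=
  ereal_sup [set (ipnorm (X x))%:E | x in [set x | ipnorm x <= 1]].

(* Extended-real valued, so that there is no junk value when the supremum is
   infinite; it is -oo when V is the zero space. *)
Definition numerical_radius (X : V -> V) : \bar R :=
  ereal_sup [set (Normc.normc (ip (X x) x))%:E | x in [set x | ipnorm x = 1]].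

End InnerProductSpaces.

Section EuclideanInnerProduct.
Variables (R : realType) (n : nat).
Local Notation C := R[i].

Definition cdot (u v : 'cV[C]_n) : C := \sum_i u i 0 * conjC (v i 0).

Let cdot_bilinear :
  bilinear_for ( *%R : C -> C -> C) (@conjC C \; *%R : C -> C -> C) cdot.
Proof.
split=> u a x y; rewrite /= /cdot mulr_sumr -big_split /=;
  apply: eq_bigr => i _; rewrite !mxE; first by rewrite mulrDl mulrA.
by rewrite rmorphD rmorphM mulrDr mulrCA.
Qed.

HB.instance Definition _ := bilinear_isBilinear.Build C 'cV[C]_n 'cV[C]_n C
  *%R (@conjC C \; *%R) cdot cdot_bilinear.

Let cdot_hermitian (u v : 'cV[C]_n) :
  cdot u v = (-1) ^+ false * conjC (cdot v u).
Proof.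
rewrite expr0 mul1r /cdot rmorph_sum; apply: eq_bigr => i _.
by rewrite rmorphM /= conjCK mulrC.
Qed.

HB.instance Definition _ := isHermitianSesquilinear.Build C 'cV[C]_n
  false (@conjC C) cdot cdot_hermitian.

Let cdot_gt0 (u : 'cV[C]_n) : u != 0 -> 0 < cdot u u.
Proof.
have ge0 i : 0 <= u i 0 * conjC (u i 0) by exact: mul_conjC_ge0.
move=> u0; rewrite lt0r sumr_ge0 ?andbT => [|i _ //].
apply: contra u0 => /eqP /(psumr_eq0P (fun i _ => ge0 i)) u0.
apply/eqP/matrixP => i j; rewrite !mxE ord1.
by apply/eqP; rewrite -mul_conjC_eq0 u0.
Qed.

HB.instance Definition _ := isDotProduct.Build C 'cV[C]_n cdot cdot_gt0.

End EuclideanInnerProduct.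

Section DirectSum.
Variables (R : realType) (H : hilbertType R) (n : nat).
Local Notation C := R[i].
Local Notation Hn := {ffun 'I_n -> H}.

(* The inner product of the direct sum H^(n) of n copies of H. *)
Definition dsum_inner (x y : Hn) : C := \sum_i inner (x i) (y i).

Let dsum_inner_bilinear :
  bilinear_for ( *%R : C -> C -> C) (@conjC C \; *%R : C -> C -> C) dsum_inner.
Proof.
split=> u a x y; rewrite /= /dsum_inner mulr_sumr -big_split /=;
  apply: eq_bigr => i _; rewrite !ffunE.
  by rewrite linearPl.
by rewrite linearPr.
Qed.

HB.instance Definition _ := bilinear_isBilinear.Build C Hn Hn C
  *%R (@conjC C \; *%R) dsum_inner dsum_inner_bilinear.

Let dsum_inner_hermitian (x y : Hn) :
  dsum_inner x y = (-1) ^+ false * conjC (dsum_inner y x).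
Proof.
rewrite expr0 mul1r /dsum_inner rmorph_sum; apply: eq_bigr => i _.
by rewrite (hermitian_subproof (x i)) expr0 mul1r.
Qed.

HB.instance Definition _ := isHermitianSesquilinear.Build C Hn
  false (@conjC C) dsum_inner dsum_inner_hermitian.

Let dsum_inner_gt0 (x : Hn) : x != 0 -> 0 < dsum_inner x x.
Proof.
have ge0 i : 0 <= inner (x i) (x i) by rewrite innerE exprn_ge0.
move=> x0; rewrite lt0r sumr_ge0 ?andbT => [|i _ //].
apply: contra x0 => /eqP /(psumr_eq0P (fun i _ => ge0 i)) x0.
apply/eqP/ffunP => i; rewrite !ffunE.
by apply/eqP; rewrite -normr_eq0 -sqrf_eq0 -innerE x0.
Qed.

HB.instance Definition _ := isDotProduct.Build C Hn dsum_inner dsum_inner_gt0.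

(* The operator on H^(n) given by an n x n matrix of operators on H. *)
Definition mxop (A : 'I_n -> 'I_n -> H -> H) (x : Hn) : Hn :=
  [ffun i => \sum_j A i j (x j)].

End DirectSum.

Section DiscAlgebra.
Variable R : realType.
Local Notation C := R[i].

Definition open_disc : set C := [set z | `|z| < 1].
Definition closed_disc : set C := [set z | `|z| <= 1].

(* Elements of A(D) are total functions on C whose values outside the closed
   disc are irrelevant; derivability is over the field C, i.e. complex. *)
Definition disc_algebra (f : C -> C) : Prop :=
  {within closed_disc, continuous f} /\
  (forall z, open_disc z -> derivable f z 1).

Definition mx_supnorm (n : nat) (F : C -> 'M[C]_n) : \bar R :=
  ereal_sup [set opnorm (@cdot R n) (mulmx (F z)) | z in open_disc].

Definition horner_mx_fun (n : nat) (F : 'M[{poly C}]_n) (z : C) : 'M[C]_n :=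
  \matrix_(i, j) (F i j).[z].

End DiscAlgebra.

Section FunctionalCalculus.
Variables (R : realType) (H : hilbertType R).
Local Notation C := R[i].

Definition bounded_op (X : {linear H -> H}) : Prop :=
  (opnorm (@inner R H) X < +oo)%E.

Definition poly_op (T : H -> H) (p : {poly C}) (x : H) : H :=
  \sum_(k < size p) p`_k *: iter k T x.

(* S is the operator norm limit of p_k(T), for some polynomials p_k that
   converge to f uniformly on the closed disc. *)
Definition is_disc_op (T : H -> H) (f : C -> C) (S : {linear H -> H}) : Prop :=
  bounded_op S /\
  exists p : nat -> {poly C},
    {uniform @closed_disc R, (fun k z => (p k).[z]) @ \oo --> f} /\
    opnorm (@inner R H) (fun x => poly_op T (p k) x - S x) @[k --> \oo] --> 0%E.

(* f(T); for f in A(D) and T of numerical radius at most 1, there is exactly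
   one S such that is_disc_op T f S. *)
Definition disc_op (T : H -> H) (f : C -> C) : {linear H -> H} :=
  get (is_disc_op T f).

End FunctionalCalculus.

(* Main.v *)
Require Import Defs.
From HB Require Import structures.
From mathcomp Require Import all_boot all_order all_algebra.
From mathcomp Require Import sesquilinear spectral cyclic separable cyclotomic complex.
From mathcomp Require Import all_classical all_reals all_analysis.
From mathcomp Require Import ring lra zify.

(** The constant [5/4] is [(K + 1/K)/2] for [K = 2].  An operator [T] with
    [w(T) <= 1] is similar to a contraction, [T = S Q S^-1], where the
    similarity can be chosen with [|S| |S^-1| <= 2].  For a matrix-valued [F]
    one gets [F(T) = S F(Q) S^-1], the von Neumann inequality bounds [F(Q)] by
    [|F|_oo], and then

      [|<F(T)x, x>| = |<F(Q) S^-1 x, S^* x>| <= |F|_oo |S^-1 x| |S^* x|],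

    where, with the normalisation [1/2 <= S S^* <= 2], the last product is at
    most [5/4 |x|^2]: each [a] in [[1/2, 2]] satisfies [a + 1/a <= 5/2].

    A polynomial of [T], tested against given vectors, only involves finitely
    many vectors [T^k x_j].  In an orthonormal basis of their span
    ([orthonormal_coordinates]) the operator becomes a matrix with the same
    bound on its numerical radius, so that the argument above is needed for
    matrices only.

    - Similarity ([okubo_ando]).  If [w(t) < 1], the block Toeplitz forms with
      diagonal [2] and off-diagonal [t] are positive definite.  Their successive
      Schur complements [Y_0 = 2], [Y_(k+1) = 2 - t Y_k^-1 t^*] form a
      decreasing sequence of positive definite matrices; as the traces are
      bounded below, some step is arbitrarily small, which gives
      [t Y^-1 t^* <= 2 - Y + e] with [0 < Y <= 2] ([ando_approx]).  Any
      function [a] on [(0, 2]] with [2 - y <= a(y) <= 1/y] then satisfies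
      [t a(Y) t^* <= t Y^-1 t^* <= a(Y) + e], and [max (2 - y) (1/2)] is such
      a function with values in [[1/2, 2]].
    - Von Neumann inequality ([von_neumann]).  A strict contraction is
      unitarily equivalent to the restriction of a backward shift to an
      invariant subspace, and a polynomial of a shift is a Toeplitz operator,
      bounded by the supremum of its symbol through Parseval's identity over the
      roots of unity.
    - Passage to the disc algebra.  A function that is continuous on the closed
      disc and differentiable inside is a uniform limit of polynomials
      ([disc_algebra_approx]): by Goursat's theorem in logarithmic polar
      coordinates, the means of [f(z) z^j / z^l] over circles do not depend on
      the radius, hence the Fejer means of [f] on every circle [|z| = r] are
      values of one and the same polynomial.  The bound for polynomials turns
      uniform convergence into convergence of operators, which provides [f(T)]
      ([disc_op_exists]) and the inequality in the limit. *)

Set Implicit Arguments.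
Unset Strict Implicit.
Unset Printing Implicit Defensive.
Import Order.TTheory GRing.Theory Num.Theory Num.Def.
Import numFieldNormedType.Exports.
Local Open Scope classical_set_scope.
Local Open Scope ring_scope.
Local Open Scope sesquilinear_scope.

(** * Inner products, norms and coordinates *)

Notation cnorm := Normc.normc.

Section ComplexNorm.
Variable R : realType.
Local Notation C := R[i].
Local Notation "x %:C" := (real_complex R x) : ring_scope.
Implicit Types z w : C.

Lemma normc_normE z : (Normc.normc z)%:C = `|z|.
Proof. by case: z => a b; rewrite normc_def. Qed.

Lemma cnorm_ge0 z : 0 <= cnorm z.
Proof. by case: z => a b; exact: sqrtr_ge0. Qed.

Lemma cnormD z w : cnorm (z + w) <= cnorm z + cnorm w.
Proof. by rewrite -lecR rmorphD !normc_normE ler_normD. Qed.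

Lemma cnormM z w : cnorm (z * w) = cnorm z * cnorm w.
Proof. exact: Normc.normcM. Qed.

Lemma cnormX z n : cnorm (z ^+ n) = cnorm z ^+ n.
Proof. by apply: complexI; rewrite rmorphXn !normc_normE normrX. Qed.

Lemma cnormN z : cnorm (- z) = cnorm z.
Proof. by apply: complexI; rewrite !normc_normE normrN. Qed.

Lemma cnormB z w : cnorm (z - w) <= cnorm z + cnorm w.
Proof. by rewrite -(cnormN w) cnormD. Qed.

Lemma cnorm_distC z w : cnorm (z - w) = cnorm (w - z).
Proof. by rewrite -cnormN opprB. Qed.

Lemma cnorm_sum I (r : seq I) (F : I -> C) :
  cnorm (\sum_(i <- r) F i) <= \sum_(i <- r) cnorm (F i).
Proof.
elim/big_rec2 : _ => [|i x y _ xy]; first by rewrite Normc.normc0.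
exact: le_trans (cnormD _ _) (lerD _ _).
Qed.

Lemma cnormR (x : R) : cnorm x%:C = `|x|.
Proof. by rewrite /= expr0n addr0 sqrtr_sqr. Qed.

Lemma cnorm_ReIm z : cnorm z <= `|complex.Re z| + `|complex.Im z|.
Proof.
case: z => a b /=; rewrite -(ler_pXn2r (n := 2)) ?nnegrE ?addr_ge0 //.
rewrite sqr_sqrtr ?addr_ge0 ?sqr_ge0 // sqrrD !real_normK ?num_real //.
by rewrite addrAC lerDl mulrn_wge0 // mulr_ge0.
Qed.

Lemma Re_le_cnorm z : `|complex.Re z| <= cnorm z.
Proof. by rewrite -lecR normc_normE; exact: normc_ge_Re. Qed.

Lemma Im_le_cnorm z : `|complex.Im z| <= cnorm z.
Proof.
case: z => a b /=; rewrite -(sqrtr_sqr b) ler_wsqrtr // lerDr sqr_ge0 //.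
Qed.

Lemma cnorm_eq0P z : (forall e : R, 0 < e -> cnorm z <= e) -> z = 0.
Proof.
move=> H; apply: Normc.eq0_normc; apply/eqP; rewrite eq_le cnorm_ge0 andbT.
by apply/ler_addgt0Pr => e e0; rewrite add0r; exact: H.
Qed.

End ComplexNorm.

Section DotCauchySchwarz.
Variables (C : numClosedFieldType) (V : lmodType C) (ip : {dot V for @conjC C}).

(** Obtained by removing from [u] its component along [v].  The form may be that of a
    Hilbert space or the Frobenius form on matrices. *)
Lemma dot_cauchy_schwarz (u v : V) : `|ip u v| ^+ 2 <= ip u u * ip v v.
Proof.
have [->|v0] := eqVneq v 0.
  rewrite linear0r /= normr0 expr0n /=. by rewrite linear0r /= mulr0.
have vv : 0 < ip v v by rewrite dnorm_gt0.
pose a := ip u v / ip v v.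
have uv : ip (u - a *: v) v = 0.
  by rewrite linearBl linearZl_LR /= divfK ?subrr // gt_eqF.
have := dnorm_ge0 ip (u - a *: v).
rewrite [X in _ <= X]linearBr /= linearZr_LR /= uv mulr0 subr0.
rewrite linearBl linearZl_LR /= subr_ge0 /a mulrAC ler_pdivrMr //.
rewrite (hermC ip v u) /= expr0 mul1r -normCK //.
Qed.

End DotCauchySchwarz.

Section NormsOfInnerProducts.
Variables (R : realType) (V : lmodType R[i]) (ip : {dot V for @conjC R[i]}).
Local Notation C := R[i].
Local Notation "x %:C" := (real_complex R x) : ring_scope.

Lemma ipnorm_sqr (x : V) : (ipnorm ip x ^+ 2)%:C = ip x x.
Proof.
have := dnorm_ge0 ip x; rewrite /ipnorm => /[dup]/ger0_real/complex_realP[k ->].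
by rewrite ler0c => k0; rewrite sqr_sqrtr.
Qed.

Lemma ipnorm_ge0 (x : V) : 0 <= ipnorm ip x.
Proof. exact: sqrtr_ge0. Qed.

Lemma ipnorm_eq1 (x : V) : ip x x = 1 -> ipnorm ip x = 1.
Proof. by move=> xx; rewrite /ipnorm xx sqrtr1. Qed.

Lemma ipnormZ (a : C) (x : V) : ipnorm ip (a *: x) = cnorm a * ipnorm ip x.
Proof.
apply/eqP; rewrite -(eqrXn2 (n := 2)) ?mulr_ge0 ?cnorm_ge0 ?ipnorm_ge0 //; apply/eqP.
apply: complexI; rewrite ipnorm_sqr dnormZ exprMn -normc_normE.
by rewrite -ipnorm_sqr -rmorphXn -rmorphM.
Qed.

Lemma ipnormZ_ge0 (a : R) (x : V) : 0 <= a -> ipnorm ip (a%:C *: x) = a * ipnorm ip x.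
Proof. by move=> a0; rewrite ipnormZ cnormR ger0_norm. Qed.

Lemma ipnorm_eq0 (x : V) : ipnorm ip x = 0 -> x = 0.
Proof.
by move=> x0; apply/eqP; rewrite -(dnorm_eq0 ip) -ipnorm_sqr x0 expr0n.
Qed.

Lemma ipnorm0 : ipnorm ip 0 = 0.
Proof. by rewrite /ipnorm linear0r /= sqrtr0. Qed.

(** By homogeneity, the supremum over the unit ball controls all vectors. *)
Lemma opnorm_le (X : V -> V) (m : R) : (forall a x, X (a *: x) = a *: X x) ->
  (opnorm ip X <= m%:E)%E -> forall x, ipnorm ip (X x) <= m * ipnorm ip x.
Proof.
move=> XZ Xm x; have [x0|x0] := eqVneq (ipnorm ip x) 0.
  rewrite x0 mulr0 (ipnorm_eq0 x0).
  by have := XZ 0 0; rewrite !scale0r => ->; rewrite ipnorm0.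
have xp : 0 < ipnorm ip x by rewrite lt0r x0 ipnorm_ge0.
have xi : 0 <= (ipnorm ip x)^-1 by rewrite invr_ge0 ltW.
rewrite -ler_pdivrMr // mulrC -ipnormZ_ge0 // -XZ -lee_fin.
apply: le_trans Xm; apply: ereal_sup_ubound; exists ((ipnorm ip x)^-1%:C *: x) => //=.
by rewrite ipnormZ_ge0 // mulVf.
Qed.

Lemma opnorm_ge0 (X : V -> V) : (0 <= opnorm ip X)%E.
Proof.
apply: le_trans (_ : (ipnorm ip (X 0))%:E <= _)%E; first by rewrite lee_fin ipnorm_ge0.
by apply: ereal_sup_ubound; exists 0 => //=; rewrite ipnorm0.
Qed.

Lemma opnorm_leP (X : V -> V) (m : R) : 0 <= m ->
  (forall x, ipnorm ip (X x) <= m * ipnorm ip x) -> (opnorm ip X <= m%:E)%E.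
Proof.
move=> m0 Xm; apply: ge_ereal_sup => _ [x /= x1 <-]; rewrite lee_fin.
by apply: le_trans (Xm x) _; rewrite -[leRHS]mulr1 ler_wpM2l.
Qed.

Lemma numerical_radius_le (X : V -> V) (m : R) :
  (forall a x, X (a *: x) = a *: X x) ->
  (numerical_radius ip X <= m%:E)%E -> forall x, `|ip (X x) x| <= m%:C * ip x x.
Proof.
move=> XZ Xm x; have [x0|x0] := eqVneq (ipnorm ip x) 0.
  by rewrite (ipnorm_eq0 x0) linear0r normr0 linear0r /= mulr0.
have xp : 0 < ipnorm ip x by rewrite lt0r x0 ipnorm_ge0.
have xi : 0 <= (ipnorm ip x)^-1 by rewrite invr_ge0 ltW.
set a := (ipnorm ip x)^-1; have a2 : 0 < a ^+ 2 by rewrite exprn_gt0 // invr_gt0.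
have : ((Normc.normc (ip (X (a%:C *: x)) (a%:C *: x)))%:E <= m%:E)%E.
  apply: le_trans Xm; apply: ereal_sup_ubound; exists (a%:C *: x) => //=.
  by rewrite ipnormZ_ge0 // mulVf.
rewrite lee_fin -lecR normc_normE XZ linearZl_LR linearZr_LR /= !normrM norm_conjC.
rewrite mulrA -expr2 ger0_norm ?ler0c // -rmorphXn => H.
have a2C : 0 < (a ^+ 2)%:C by rewrite -(rmorph0 (real_complex R)) ltcR.
rewrite -(ler_pM2l a2C); apply: le_trans H _.
by rewrite mulrCA -ipnorm_sqr -rmorphM -exprMn mulVf // expr1n rmorph1 mulr1.
Qed.

Lemma numerical_radius_leP (X : V -> V) (m : R) :
  (forall x, ip x x = 1 -> `|ip (X x) x| <= m%:C) -> (numerical_radius ip X <= m%:E)%E.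
Proof.
move=> Xm; apply: ge_ereal_sup => _ [x /= x1 <-]; rewrite lee_fin -lecR normc_normE.
by apply: Xm; rewrite -ipnorm_sqr x1 expr1n rmorph1.
Qed.

Lemma cnorm_ip_le (x y : V) : cnorm (ip x y) <= ipnorm ip x * ipnorm ip y.
Proof.
rewrite -(ler_pXn2r (n := 2)) ?nnegrE ?mulr_ge0 ?cnorm_ge0 ?ipnorm_ge0 //.
rewrite exprMn -lecR; have := dot_cauchy_schwarz ip x y.
by rewrite -!ipnorm_sqr -normc_normE -rmorphXn -rmorphM.
Qed.

Lemma ipnormD (x y : V) : ipnorm ip (x + y) <= ipnorm ip x + ipnorm ip y.
Proof.
rewrite -(ler_pXn2r (n := 2)) ?nnegrE ?addr_ge0 ?ipnorm_ge0 //.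
rewrite -lecR ipnorm_sqr dnormD -!ipnorm_sqr.
have -> : ip x y + (ip x y)^* = (2 * complex.Re (ip x y))%:C.
  by case: (ip x y) => a b; apply/eqP; rewrite eq_complex /= subrr eqxx andbT; apply/eqP; ring.
rewrite -!rmorphD lecR sqrrD.
have := cnorm_ip_le x y; have := le_trans (ler_norm _) (Re_le_cnorm (ip x y)).
lra.
Qed.

Lemma ipnormN (x : V) : ipnorm ip (- x) = ipnorm ip x.
Proof. by rewrite -scaleN1r ipnormZ cnormN Normc.normc1 mul1r. Qed.

Lemma ipnorm_distC (x y : V) : ipnorm ip (x - y) = ipnorm ip (y - x).
Proof. by rewrite -ipnormN opprB. Qed.

Lemma ipnorm_sum I (r : seq I) (F : I -> V) :
  ipnorm ip (\sum_(i <- r) F i) <= \sum_(i <- r) ipnorm ip (F i).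
Proof.
elim/big_rec2 : _ => [|i x y _ xy]; first by rewrite ipnorm0.
exact: le_trans (ipnormD _ _) (lerD _ _).
Qed.

End NormsOfInnerProducts.

Section GramSchmidt.
Variables (R : realType) (V : lmodType R[i]) (ip : {dot V for @conjC R[i]}).
Local Notation C := R[i].

(** Gram-Schmidt, one vector at a time: a new vector contributes a basis element
    only when it does not lie in the span of the previous ones. *)
Lemma orthonormal_coordinates (s : seq V) : exists N (e : 'I_N -> V),
  (forall i j, ip (e i) (e j) = (i == j)%:R) /\
  (forall x, x \in s -> x = \sum_i ip x (e i) *: e i).
Proof.
elim: s => [|v s [N [e [ee es]]]]; first by exists 0%N, (fun _ => 0); split => // -[].
(* the component of v orthogonal to the basis found so far *)
pose w := v - \sum_i ip v (e i) *: e i.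
have we i : ip w (e i) = 0.
  rewrite /w linearBl /= linear_sumlz (bigD1 i) //= linearZl_LR /= ee eqxx mulr1.
  rewrite big1 ?addr0 ?subrr // => j ji.
  by rewrite linearZl_LR /= ee (negPf ji) mulr0.
have vE : v = w + \sum_i ip v (e i) *: e i by rewrite subrK.
have [w0|w0] := eqVneq w 0.
  exists N, e; split => // x; rewrite in_cons => /orP[/eqP ->|/es//].
  by rewrite {1}vE w0 add0r.
have ww : 0 < ip w w by rewrite dnorm_gt0.
pose c := sqrtC (ip w w).
have c0 : 0 < c by rewrite sqrtC_gt0.
have cn : c != 0 by rewrite gt_eqF.
have cc : c ^+ 2 = ip w w by rewrite sqrtCK.
have cJ : (c^-1)^* = c^-1 by apply/CrealP/ger0_real; rewrite invr_ge0 ltW.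
pose f := c^-1 *: w.
have fe i : ip f (e i) = 0 by rewrite linearZl_LR /= we mulr0.
have ef i : ip (e i) f = 0 by rewrite (hermC ip) /= fe conjC0 mulr0.
have ff : ip f f = 1.
  rewrite linearZl_LR linearZr_LR /= cJ -cc expr2.
  by rewrite mulKf // mulVf.
pose e' i := if unlift ord0 i is Some j then e j else f.
exists N.+1, e'; split.
  move=> i j; rewrite /e'; case: (unliftP ord0 i) => [i' ->|->];
    case: (unliftP ord0 j) => [j' ->|->].
  - by rewrite ee (inj_eq lift_inj).
  - by rewrite ef eq_sym (negPf (neq_lift _ _)).
  - by rewrite fe (negPf (neq_lift _ _)).
  - by rewrite ff eqxx.
have e'0 : e' ord0 = f by rewrite /e' unlift_none.
have e'S i : e' (lift ord0 i) = e i by rewrite /e' liftK.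
move=> x; rewrite big_ord_recl e'0 (eq_bigr (fun i => ip x (e i) *: e i)); last first.
  by move=> i _; rewrite e'S.
rewrite in_cons => /orP[/eqP ->|xs]; last first.
  have -> : ip x f = 0.
    rewrite (es x xs) linear_sumlz big1 // => i _.
    by rewrite linearZl_LR /= ef mulr0.
  by rewrite scale0r add0r; exact: es.
rewrite {1}vE; congr (_ + _).
have -> : ip v f = ip w f.
  rewrite {1}vE linearDl /= linear_sumlz big1 ?addr0 // => i _.
  by rewrite linearZl_LR /= ef mulr0.
by rewrite linearZr_LR /= cJ -cc expr2 mulKf // scalerA mulfV ?scale1r.
Qed.

End GramSchmidt.

(** * The Frobenius inner product *)

Section MatrixDot.
Variables (C : numClosedFieldType) (p q : nat).

(** An [n]-tuple of vectors of [C^N] is stored as the [n x N] matrix of its rows: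
    scalar matrices act on the left, operators of [C^N] on the right. *)
Definition mip (X Y : 'M[C]_(p, q)) : C := \tr (X *m Y^t*).

Let mip_bilinear :
  bilinear_for ( *%R : C -> C -> C) (@conjC C \; *%R : C -> C -> C) mip.
Proof.
split=> u a x y; rewrite /mip /=.
  by rewrite mulmxDl -scalemxAl mxtraceD mxtraceZ.
rewrite linearP /= map_mxD map_mxZ mulmxDr -scalemxAr mxtraceD mxtraceZ //.
Qed.

HB.instance Definition _ := bilinear_isBilinear.Build C
  'M[C]_(p, q) 'M[C]_(p, q) C *%R (@conjC C \; *%R) mip mip_bilinear.

Lemma mipE X Y : mip X Y = \sum_i \sum_j X i j * (Y i j)^*.
Proof.
by apply: eq_bigr => i _; rewrite mxE; apply: eq_bigr => j _; rewrite !mxE.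
Qed.

Let mip_hermitian X Y : mip X Y = (-1) ^+ false * conjC (mip Y X).
Proof.
rewrite expr0 mul1r !mipE rmorph_sum; apply: eq_bigr => i _.
rewrite rmorph_sum; apply: eq_bigr => j _.
by rewrite rmorphM /= conjCK mulrC.
Qed.

HB.instance Definition _ := isHermitianSesquilinear.Build C 'M[C]_(p, q)
  false (@conjC C) mip mip_hermitian.

Let mip_gt0 X : X != 0 -> 0 < mip X X.
Proof.
have ge0 i j : 0 <= X i j * (X i j)^* by exact: mul_conjC_ge0.
have ge0' i : 0 <= \sum_j X i j * (X i j)^* by apply: sumr_ge0.
move=> X0; rewrite mipE lt0r sumr_ge0 ?andbT => [|i _ //].
apply: contra X0 => /eqP /(psumr_eq0P (fun i _ => ge0' i)) X0.
apply/eqP/matrixP => i j; rewrite !mxE.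
apply/eqP; rewrite -mul_conjC_eq0.
by have /(psumr_eq0P (fun i _ => ge0 _ i)) -> := X0 i isT.
Qed.

HB.instance Definition _ := isDotProduct.Build C 'M[C]_(p, q) mip mip_gt0.

End MatrixDot.

Notation n2 X := (mip X X).

Section MatrixDotTheory.
Variable C : numClosedFieldType.

Lemma n2E p q (X : 'M[C]_(p, q)) : n2 X = \sum_i \sum_j `|X i j| ^+ 2.
Proof.
by rewrite mipE; apply: eq_bigr => i _; apply: eq_bigr => j _; rewrite normCK.
Qed.

Lemma mipC p q (X Y : 'M[C]_(p, q)) : mip X Y = (mip Y X)^*.
Proof. by rewrite (hermC (@mip C p q)) /= expr0 mul1r. Qed.

Lemma mip_mulr p q s (X : 'M[C]_(p, q)) (A : 'M[C]_(q, s)) Y :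
  mip (X *m A) Y = mip X (Y *m A^t*).
Proof. by rewrite /mip trmx_mul map_mxM trmxCK mulmxA. Qed.

Lemma mip_row p q (X Y : 'M[C]_(p, q)) :
  mip X Y = \sum_i mip (row i X) (row i Y).
Proof.
rewrite mipE; apply: eq_bigr => i _; rewrite mipE big_ord1.
by apply: eq_bigr => j _; rewrite !mxE.
Qed.

Lemma mip_col p q (X Y : 'M[C]_(p, q)) :
  mip X Y = \sum_j mip (col j X) (col j Y).
Proof.
rewrite mipE exchange_big; apply: eq_bigr => j _ /=; rewrite mipE.
by apply: eq_bigr => i _; rewrite big_ord1 !mxE.
Qed.

Lemma n2_ge0 p q (X : 'M[C]_(p, q)) : 0 <= n2 X.
Proof. exact: dnorm_ge0. Qed.

Lemma n2Z p q a (X : 'M[C]_(p, q)) : n2 (a *: X) = `|a| ^+ 2 * n2 X.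
Proof. exact: (dnormZ (@mip C p q)). Qed.

Lemma n2_unitary p q (X : 'M[C]_(p, q)) (P : 'M[C]_q) :
  P \is unitarymx -> n2 (X *m P^t*) = n2 X.
Proof.
move=> PU.
by rewrite mip_mulr trmxCK -mulmxA -invmx_unitary // mulVmx ?mulmx1 // unitarymx_unit.
Qed.

Lemma n2_row_diag q (u : 'rV[C]_q) (d : 'rV[C]_q) :
  mip (u *m diag_mx d) u = \sum_j d 0 j * `|u 0 j| ^+ 2.
Proof.
rewrite mipE big_ord1; apply: eq_bigr => j _.
by rewrite mul_mx_diag mxE normCK mulrCA mulrA.
Qed.

Lemma hermsymmx_adj q (A : 'M[C]_q) : A = A^t* -> A \is hermsymmx.
Proof.
by move=> AA; apply/is_hermitianmxP; rewrite expr0 scale1r.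
Qed.

Lemma spectral_hermitian q (A : 'M[C]_q) : A = A^t* ->
  exists P (d : 'rV[C]_q), [/\ P \is unitarymx, A = P^t* *m diag_mx d *m P &
    forall i, d 0 i \is Num.real].
Proof.
move=> /hermsymmx_adj AA; exists (spectralmx A), (spectral_diag A).
split; first exact: spectral_unitarymx.
  rewrite -invmx_unitary ?spectral_unitarymx //.
  exact/orthomx_spectralP/hermitian_normalmx.
by have /mxOverP dr := hermitian_spectral_diag_real AA.
Qed.

End MatrixDotTheory.

(** * Matrix polynomials on the circle: Parseval and Toeplitz bounds *)

Section RootsOfUnity.
Variable C : numClosedFieldType.

Lemma prim_root_exists n : (n > 0)%N -> exists z : C, n.-primitive_root z.
Proof.
pose p : {poly C} := 'X^n - 1; have [r Dp] := closed_field_poly_normal p.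
move=> n_gt0; rewrite (monicP _) ?monicXnsubC // scale1r in Dp.
have rn1: all n.-unity_root r by apply/allP=> z; rewrite -root_prod_XsubC -Dp.
have sz_r: (n < (size r).+1)%N.
  by rewrite -(size_prod_XsubC r id) -Dp size_XnsubC.
have [|z] := hasP (has_prim_root n_gt0 rn1 _ sz_r); last by exists z.
by rewrite -separable_prod_XsubC -Dp separable_Xn_sub_1 // pnatr_eq0 -lt0n.
Qed.

Lemma prim_root_norm n (z : C) : n.-primitive_root z -> `|z| = 1.
Proof.
move=> zn; apply/eqP; rewrite -(pexpr_eq1 (prim_order_gt0 zn)) //.
by rewrite -normrX prim_expr_order // normr1.
Qed.

(** Two distinct exponents below [n] give a nontrivial [n]-th root of unity, whose
    powers sum to zero. *)
Lemma prim_root_orthogonal n (z : C) (i j : 'I_n) : n.-primitive_root z ->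
  \sum_(k < n) (z ^+ k) ^+ i * ((z ^+ k) ^+ j)^* = n%:R *+ (i == j).
Proof.
move=> zn; have z1 := prim_root_norm zn.
have zz m : (z ^+ m) * (z ^+ m)^* = 1 by rewrite -normCK normrX z1 !expr1n.
have E k : (z ^+ k) ^+ i * ((z ^+ k) ^+ j)^* = (z ^+ i * (z ^+ j)^*) ^+ k.
  by rewrite exprMn -rmorphXn /= -!exprM mulnC (mulnC k).
rewrite (eq_bigr _ (fun (k : 'I_n) _ => E k)).
set c := z ^+ i * _.
have cn : c ^+ n = 1.
  rewrite /c exprMn -rmorphXn /= -!exprM !(mulnC _ n) !exprM.
  by rewrite !(prim_expr_order zn) !expr1n rmorph1 mulr1.
have [ij|ij] := eqVneq i j.
  rewrite (eq_bigr (fun _ => 1)) ?sumr_const ?card_ord // => k _.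
  by rewrite /c ij zz expr1n.
have c1 : c - 1 != 0.
  rewrite subr_eq0; apply: contra ij => /eqP c1.
  have : z ^+ i == z ^+ j.
    by rewrite -[z ^+ j]mul1r -c1 /c -mulrA (mulrC _ (z ^+ j)) zz mulr1.
  by rewrite (eq_prim_root_expr zn) !modn_small.
by apply: (mulfI c1); rewrite -subrX1 cn subrr mulr0.
Qed.

Lemma parseval n (z : C) (p q : {poly C}) : n.-primitive_root z ->
  (size p <= n)%N -> (size q <= n)%N ->
  \sum_(k < n) p.[z ^+ k] * (q.[z ^+ k])^* = n%:R * \sum_(j < n) p`_j * (q`_j)^*.
Proof.
move=> zn sp sq; pose e (k : nat) i := (z ^+ k) ^+ i.
have E (k : 'I_n) : p.[z ^+ k] * (q.[z ^+ k])^* =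
    \sum_(i < n) \sum_(j < n) p`_i * (q`_j)^* * (e k i * (e k j)^*).
  rewrite (horner_coef_wide _ sp) (horner_coef_wide _ sq) rmorph_sum mulr_suml.
  apply: eq_bigr => i _; rewrite mulr_sumr; apply: eq_bigr => j _.
  by rewrite rmorphM /=; rewrite mulrACA.
rewrite (eq_bigr _ (fun k _ => E k)) exchange_big /= mulr_sumr.
apply: eq_bigr => i _; rewrite exchange_big /= (bigD1 i) //=.
rewrite -mulr_sumr (prim_root_orthogonal _ _ zn) eqxx mulrC big1 ?addr0 // => j ji.
by rewrite -mulr_sumr (prim_root_orthogonal _ _ zn) eq_sym (negPf ji) mulr0.
Qed.

End RootsOfUnity.

Section MatrixPolynomials.
Variable C : numClosedFieldType.

Definition evmx (z : C) p q (P : 'M[{poly C}]_(p, q)) := map_mx (horner_eval z) P.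
Definition coefmx (j : nat) p q (P : 'M[{poly C}]_(p, q)) := map_mx (coefp j) P.

(** The roots of unity replace the integral over the circle, exactly so for
    polynomials of degree less than [n]. *)
Lemma parseval_mx n (z : C) p q (P Q : 'M[{poly C}]_(p, q)) : n.-primitive_root z ->
  (forall i j, (size (P i j) <= n)%N) -> (forall i j, (size (Q i j) <= n)%N) ->
  \sum_(k < n) mip (evmx (z ^+ k) P) (evmx (z ^+ k) Q) =
  n%:R * \sum_(j < n) mip (coefmx j P) (coefmx j Q).
Proof.
move=> zn sP sQ; under eq_bigr do rewrite mipE.
rewrite [in RHS](eq_bigr _ (fun k _ => mipE _ _)).
rewrite exchange_big [in RHS]exchange_big mulr_sumr /=; apply: eq_bigr => a _.
rewrite exchange_big [in RHS]exchange_big mulr_sumr /=; apply: eq_bigr => b _.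
have := parseval zn (sP a b) (sQ a b) => E.
rewrite (eq_bigr (fun k : 'I_n => (P a b).[z ^+ k] * ((Q a b).[z ^+ k])^*)); last first.
  by move=> k _; rewrite !mxE.
by rewrite E; congr (_ * _); apply: eq_bigr => k _; rewrite !mxE.
Qed.

End MatrixPolynomials.

Section ToeplitzBounds.
Variable C : numClosedFieldType.

Definition polymx n p q (h : nat -> 'M[C]_(p, q)) : 'M[{poly C}]_(p, q) :=
  \matrix_(a, b) \poly_(j < n) h j a b.

Lemma size_polymx n p q (h : nat -> 'M[C]_(p, q)) a b :
  (size (polymx n h a b) <= n)%N.
Proof. by rewrite mxE size_poly. Qed.

Lemma coefmx_polymx n p q (h : nat -> 'M[C]_(p, q)) j :
  coefmx j (polymx n h) = if (j < n)%N then h j else 0.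
Proof.
by apply/matrixP => a b; rewrite !mxE /= coef_poly; case: ifP; rewrite ?mxE.
Qed.

Lemma evmx_polymx n p q (h : nat -> 'M[C]_(p, q)) z :
  evmx z (polymx n h) = \sum_(j < n) z ^+ j *: h j.
Proof.
apply/matrixP => a b; rewrite !mxE /horner_eval horner_poly summxE.
by apply: eq_bigr => j _; rewrite !mxE mulrC.
Qed.

Lemma evmxM z p q s (P : 'M[{poly C}]_(p, q)) (Q : 'M[{poly C}]_(q, s)) :
  evmx z (P *m Q) = evmx z P *m evmx z Q.
Proof. by rewrite /evmx map_mxM. Qed.

Lemma coefmxM j p q s (P : 'M[{poly C}]_(p, q)) (Q : 'M[{poly C}]_(q, s)) :
  coefmx j (P *m Q) = \sum_(k < j.+1) coefmx k P *m coefmx (j - k)%N Q.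
Proof.
apply/matrixP => a b; rewrite summxE !mxE raddf_sum /=.
under [RHS]eq_bigr do rewrite mxE.
rewrite [RHS]exchange_big /=; apply: eq_bigr => i _.
by rewrite coefM; apply: eq_bigr => k _; rewrite !mxE.
Qed.

Lemma size_mx_bound p q (P : 'M[{poly C}]_(p, q)) :
  exists M, forall i j, (size (P i j) <= M)%N.
Proof.
exists (\max_i \max_j size (P i j))%N => i j.
by apply: leq_trans (leq_bigmax i) => //; apply: leq_trans (leq_bigmax j).
Qed.

Lemma coefmx_big p q (P : 'M[{poly C}]_(p, q)) L j :
  (forall a b, (size (P a b) <= L)%N) -> (L <= j)%N -> coefmx j P = 0.
Proof.
move=> sP Lj; apply/matrixP => a b; rewrite !mxE /= nth_default //.
exact: leq_trans (sP a b) Lj.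
Qed.

Lemma sum_coefmx_wide p q (P : 'M[{poly C}]_(p, q)) L M :
  (forall a b, (size (P a b) <= L)%N) -> (L <= M)%N ->
  \sum_(j < M) n2 (coefmx j P) = \sum_(j < L) n2 (coefmx j P).
Proof.
move=> sP LM; rewrite (big_ord_widen _ (fun j => n2 (coefmx j P)) LM).
rewrite [LHS](bigID (fun i : 'I_M => i < L)%N) /= [X in _ + X]big1 ?addr0 // => i.
by rewrite -leqNgt => Li; rewrite (coefmx_big sP) // linear0r.
Qed.

(** The coefficients of [G P] are the image of those of [P] under a block Toeplitz
    operator.  On the circle this operator is pointwise multiplication by [G], so
    Parseval's identity carries the pointwise bound to the coefficients. *)
Lemma analytic_toeplitz_bound n q (G : 'M[{poly C}]_n) (m : C)
    (P : 'M[{poly C}]_(n, q)) L K :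
  (forall z (V : 'M[C]_(n, q)), `|z| = 1 -> n2 (evmx z G *m V) <= m * n2 V) ->
  (forall a b, (size (P a b) <= L)%N) ->
  \sum_(j < K) n2 (coefmx j (G *m P)) <= m * \sum_(j < L) n2 (coefmx j P).
Proof.
move=> Gm sP; have [M0 sGP] := size_mx_bound (G *m P).
pose M := (M0 + L + K).+1.
have [z zM] := @prim_root_exists C M isT.
have KM : (K <= M)%N by apply: leqW; apply: leq_addl.
have LM : (L <= M)%N by apply: leqW; rewrite addnAC leq_addl.
have sPM a b : (size (P a b) <= M)%N by exact: leq_trans (sP a b) LM.
have sGPM a b : (size ((G *m P) a b) <= M)%N.
  by apply: leq_trans (sGP a b) _; apply: leqW; rewrite -addnA leq_addr.
apply: (@le_trans _ _ (\sum_(j < M) n2 (coefmx j (G *m P)))).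
  rewrite (big_ord_widen _ (fun j => n2 (coefmx j (G *m P))) KM).
  rewrite big_mkcond; apply: ler_sum => i _; case: ifP => // _; exact: n2_ge0.
have M0' : 0 < M%:R :> C by rewrite ltr0n.
rewrite -(ler_pM2l M0') -(parseval_mx zM sGPM sGPM) mulrCA.
rewrite -(sum_coefmx_wide sP LM) -(parseval_mx zM sPM sPM) mulr_sumr.
apply: ler_sum => k _; rewrite evmxM; apply: Gm.
by rewrite normrX (prim_root_norm zM) expr1n.
Qed.

(** For the polynomial [p] with coefficients [h j], the sum is the mean over the
    circle of [<z p(z) t, p(z)>], and each of these values is controlled by the
    numerical radius of [t]. *)
Lemma tridiagonal_toeplitz_bound N (t : 'M[C]_N) (r : C) (h : nat -> 'rV[C]_N) k :
  (forall u : 'rV[C]_N, `|mip (u *m t) u| <= r * n2 u) ->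
  `|\sum_(j < k) mip (h j *m t) (h j.+1)| <= r * \sum_(j < k.+1) n2 (h j).
Proof.
move=> tr; pose M := k.+2; have [z zM] := @prim_root_exists C M isT.
pose h' j := if j is j'.+1 then h j' *m t else 0.
pose P := polymx M h'; pose Q := polymx k.+1 h.
have sQ a b : (size (Q a b) <= k.+1)%N by exact: size_polymx.
have sQM a b : (size (Q a b) <= M)%N by exact: leq_trans (sQ a b) _.
have M0' : 0 < M%:R :> C by rewrite ltr0n.
have evP x : evmx x P = x *: (evmx x Q *m t).
  rewrite !evmx_polymx big_ord_recl scaler0 add0r mulmx_suml scaler_sumr.
  by apply: eq_bigr => j _; rewrite exprS -scalemxAl scalerA.
have E1 : \sum_(j < k) mip (h j *m t) (h j.+1) =
          \sum_(j < M) mip (coefmx j P) (coefmx j Q).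
  rewrite big_ord_recl coefmx_polymx /= linear0l add0r big_ord_recr /=.
  rewrite [X in _ = _ + X](_ : _ = 0) ?addr0.
    apply: eq_bigr => j _; rewrite !coefmx_polymx /bump /= add1n.
    by rewrite /M !ltnS ltn_ord (ltnW (ltn_ord j)).
  by rewrite !coefmx_polymx /bump /= add1n ltnn linear0r.
have E2 : \sum_(j < k.+1) n2 (h j) = \sum_(j < M) n2 (coefmx j Q).
  rewrite (sum_coefmx_wide sQ) //; apply: eq_bigr => j _.
  by rewrite coefmx_polymx ltn_ord.
rewrite E1 E2 -(ler_pM2l M0') -{1}(ger0_norm (ltW M0')) -normrM.
rewrite -(parseval_mx zM (size_polymx _ _) sQM) mulrCA -(parseval_mx zM sQM sQM).
rewrite mulr_sumr (le_trans (ler_norm_sum _ _ _)) //; apply: ler_sum => j _.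
rewrite evP linearZl_LR /= normrM !normrX (prim_root_norm zM) expr1n mul1r.
exact: tr.
Qed.

End ToeplitzBounds.

(** * Similarity of a matrix of numerical radius less than one to a contraction *)

Section AndoIteration.
Variable C : numClosedFieldType.

Lemma posdef_unitmx N (Y : 'M[C]_N) (c : C) : 0 < c ->
  (forall h : 'rV[C]_N, c * n2 h <= mip (h *m Y) h) -> Y \in unitmx.
Proof.
move=> c0 cY; rewrite -row_free_unit -kermx_eq0; apply/rowV0P => v /sub_kermxP vY.
apply/eqP; rewrite -(dnorm_eq0 (@mip C 1 N)) eq_le n2_ge0 andbT.
by have := cY v; rewrite vY linear0l pmulr_rle0.
Qed.

Lemma hermitian_invmx N (Y : 'M[C]_N) : Y^t* = Y -> (invmx Y)^t* = invmx Y.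
Proof. by move=> YY; rewrite -{2}YY trmx_inv map_invmx. Qed.

(** Each eigenvalue of a positive semidefinite matrix is at most their sum. *)
Lemma psd_le_trace N (D : 'M[C]_N) : D^t* = D ->
  (forall h : 'rV[C]_N, 0 <= mip (h *m D) h) ->
  forall h : 'rV[C]_N, mip (h *m D) h <= \tr D * n2 h.
Proof.
move=> DD D0 h; have [P [d [PU DE dr]]] := spectral_hermitian (esym DD).
have PP : P *m P^t* = 1%:M by apply/unitarymxP.
have hD (x : 'rV[C]_N) : mip (x *m D) x = \sum_i d 0 i * `|(x *m P^t*) 0 i| ^+ 2.
  by rewrite DE !mulmxA mip_mulr n2_row_diag.
have d0 i : 0 <= d 0 i.
  have := D0 (delta_mx 0 i *m P).
  rewrite hD -mulmxA PP mulmx1 (bigD1 i) //= big1 => [|j ji].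
    by rewrite mxE !eqxx normr1 expr1n mulr1 addr0.
  by rewrite mxE (negPf ji) andbF normr0 expr0n mulr0.
have -> : \tr D = \sum_i d 0 i.
  rewrite DE mxtrace_mulC mulmxA PP mul1mx.
  by apply: eq_bigr => i _; rewrite mxE eqxx.
rewrite -(n2_unitary h PU) n2E big_ord1 hD mulr_suml.
apply: ler_sum => i _; apply: ler_wpM2l => //.
by rewrite (bigD1 i) //= lerDl sumr_ge0.
Qed.

Variables (N : nat) (t : 'M[C]_N) (r : C).
Hypothesis r1 : r < 1.
Hypothesis tr : forall u : 'rV[C]_N, `|mip (u *m t) u| <= r * n2 u.

(** The Schur complement of the lower right block in the block matrix with rows
    [2, t] and [t^*, Y]. *)
Definition schur_step (Y : 'M[C]_N) : 'M[C]_N := 2%:M - t *m invmx Y *m t^t*.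

Fixpoint ando_seq k := if k is k'.+1 then schur_step (ando_seq k') else 2%:M.

(** Completing the square: the left side is a quadratic function of [g] whose
    minimum, reached at [g0], is the form of the Schur complement. *)
Lemma schur_step_complement (Y : 'M[C]_N) (h g : 'rV[C]_N) :
  Y^t* = Y -> Y \in unitmx -> let g0 := - (h *m t *m invmx Y) in
  2 * n2 h + (mip (h *m t) g + mip g (h *m t)) + mip (g *m Y) g =
  mip (h *m schur_step Y) h + mip ((g - g0) *m Y) (g - g0).
Proof.
move=> YY Yu g0; have g0Y : g0 *m Y = - (h *m t) by rewrite /g0 mulNmx mulmxKV.
have gYg0 : mip (g *m Y) g0 = - mip g (h *m t).
  by rewrite mip_mulr YY g0Y linearNr.
have E : mip (h *m schur_step Y) h = 2 * n2 h - mip (h *m t *m invmx Y) (h *m t).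
  rewrite /schur_step mulmxBr linearBl /= mul_mx_scalar linearZl_LR /=; congr (_ - _).
  by rewrite !mulmxA [in LHS]mip_mulr trmxCK.
have g0g0 : mip (g0 *m Y) g0 = mip (h *m t) (h *m t *m invmx Y).
  by rewrite g0Y /g0 linearNl linearNr opprK.
rewrite E mulmxBl linearBl /= !linearBr /= gYg0 g0g0 g0Y !linearNl /=.
rewrite (mip_mulr (h *m t) (invmx Y)) hermitian_invmx //.
by ring.
Qed.

Lemma schur_step_hermitian (Y : 'M[C]_N) : Y^t* = Y -> (schur_step Y)^t* = schur_step Y.
Proof.
move=> YY; rewrite /schur_step linearB /= map_mxB tr_scalar_mx map_scalar_mx /=.
rewrite conjC_nat; congr (_ - _).
by rewrite !trmx_mul !map_mxM trmxCK hermitian_invmx // mulmxA.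
Qed.

(** The block tridiagonal Toeplitz form with [2] on the diagonal and [t] next to it. *)
Definition toeplitz_form k (h : nat -> 'rV[C]_N) : C :=
  \sum_(j < k.+1) 2 * n2 (h j) +
  \sum_(j < k) (mip (h j *m t) (h j.+1) + mip (h j.+1) (h j *m t)).

(** The numerical radius of [t] being less than [1], the off-diagonal part cannot
    compensate the diagonal. *)
Lemma toeplitz_form_ge k h :
  2 * (1 - r) * n2 (h 0%N) <= toeplitz_form k h.
Proof.
set s := \sum_(j < k) mip (h j *m t) (h j.+1).
have E : toeplitz_form k h = 2 * \sum_(j < k.+1) n2 (h j) + (s + s^*).
  rewrite /toeplitz_form -mulr_sumr big_split; congr (_ + (_ + _)).
  by rewrite rmorph_sum; apply: eq_bigr => j _; rewrite mipC.
have sr : `|s| <= r * \sum_(j < k.+1) n2 (h j) := tridiagonal_toeplitz_bound h k tr.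
have ss : - (2 * `|s|) <= s + s^*.
  have -> : s + s^* = 2 * 'Re s by rewrite ReE mulrCA mulfV ?mulr1 // pnatr_eq0.
  rewrite -mulrN ler_pM2l ?ltr0n //.
  have [+ _] := leif_normC_Re_Creal s.
  by rewrite real_ler_norml ?Creal_Re // => /andP[].
rewrite E.
have n0 : n2 (h 0%N) <= \sum_(j < k.+1) n2 (h j).
  by rewrite big_ord_recl lerDl sumr_ge0 // => i _; exact: n2_ge0.
apply: (@le_trans _ _ (2 * \sum_(j < k.+1) n2 (h j) - 2 * (r * \sum_(j < k.+1) n2 (h j)))).
  set S := \sum_(j < _) _; have -> : 2 * S - 2 * (r * S) = 2 * (1 - r) * S by ring.
  by rewrite ler_pM2l // mulr_gt0 ?ltr0n // subr_gt0.
by rewrite lerD2l; apply: le_trans ss; rewrite lerN2 ler_pM2l ?ltr0n.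
Qed.

(** The form of [ando_seq t k] is what remains of [toeplitz_form k] when all
    vectors but the first are chosen optimally.  It thus inherits the lower bound
    of the Toeplitz form, which makes the matrix invertible and lets the recursion
    go on: the two facts have to be proved together. *)
Lemma ando_seqP k : [/\ (ando_seq k)^t* = ando_seq k,
  (forall h : 'rV[C]_N, 2 * (1 - r) * n2 h <= mip (h *m ando_seq k) h) &
  forall x : 'rV[C]_N, exists2 h, h 0%N = x &
    toeplitz_form k h = mip (x *m ando_seq k) x].
Proof.
have c0 : 0 < 2 * (1 - r) by rewrite mulr_gt0 ?ltr0n // subr_gt0.
elim: k => [|k [hk pk tk]].
  have E x : toeplitz_form 0 (fun _ => x) = mip (x *m ando_seq 0) x.
    rewrite /toeplitz_form big_ord1 big_ord0 addr0 /=.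
    by rewrite mul_mx_scalar linearZl_LR.
  split; first by rewrite /= tr_scalar_mx map_scalar_mx /= conjC_nat.
    by move=> h; rewrite -E; exact: (toeplitz_form_ge 0 (fun _ => h)).
  by move=> x; exists (fun _ => x).
have uk := posdef_unitmx c0 pk.
have tk' x : exists2 h, h 0%N = x &
    toeplitz_form k.+1 h = mip (x *m ando_seq k.+1) x.
  pose g := - (x *m t *m invmx (ando_seq k)).
  have [h h0 hE] := tk g.
  exists (fun j => if j is j'.+1 then h j' else x) => //.
  have := schur_step_complement x g hk uk; rewrite /= -/g subrr mul0mx linear0l addr0 => <-.
  rewrite -hE /toeplitz_form big_ord_recl [X in _ + X = _]big_ord_recl /= h0.
  by ring.
split => //; first exact: schur_step_hermitian.
by move=> x; have [h <- <-] := tk' x; exact: toeplitz_form_ge.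
Qed.

Lemma ando_seq_unit k : ando_seq k \in unitmx.
Proof.
have [_ pk _] := ando_seqP k; apply: (posdef_unitmx _ pk).
by rewrite mulr_gt0 ?ltr0n // subr_gt0.
Qed.

Lemma ando_seq_psd k (h : 'rV[C]_N) : 0 <= mip (h *m ando_seq k) h.
Proof.
have [_ pk _] := ando_seqP k; apply: le_trans (pk h).
by rewrite mulr_ge0 ?n2_ge0 // mulr_ge0 // ltW // subr_gt0.
Qed.

Lemma ando_seq_le2 k (h : 'rV[C]_N) : mip (h *m ando_seq k) h <= 2 * n2 h.
Proof.
case: k => [|k]; first by rewrite /= mul_mx_scalar linearZl_LR.
have [hk _ _] := ando_seqP k.
have := schur_step_complement h 0 hk (ando_seq_unit k).
rewrite /= mul0mx linear0l linear0r linear0l !addr0 => ->.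
rewrite lerDl; exact: ando_seq_psd.
Qed.

(** The Schur complement is a minimum of forms that increase with [Y]. *)
Lemma ando_seq_decreasing k (h : 'rV[C]_N) :
  mip (h *m ando_seq k.+1) h <= mip (h *m ando_seq k) h.
Proof.
elim: k h => [|k IH] h.
  by apply: le_trans (ando_seq_le2 1 h) _; rewrite /= mul_mx_scalar linearZl_LR.
have [hk _ _] := ando_seqP k; have [hk1 _ _] := ando_seqP k.+1.
pose g := - (h *m t *m invmx (ando_seq k)).
have E := schur_step_complement h g hk (ando_seq_unit k).
have E1 := schur_step_complement h g hk1 (ando_seq_unit k.+1).
move: E E1; rewrite /= -/g subrr mul0mx linear0l addr0 => <- E1.
have : mip (h *m schur_step (ando_seq k.+1)) h <=
   2 * n2 h + (mip (h *m t) g + mip g (h *m t)) + mip (g *m ando_seq k.+1) g.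
  by rewrite [X in _ <= X]E1 lerDl; exact: (ando_seq_psd k.+1).
by move/le_trans; apply; rewrite lerD2l IH.
Qed.

End AndoIteration.

Section OkuboAndo.
Variable R : realType.
Local Notation C := R[i].
Local Notation "x %:C" := (real_complex R x) : ring_scope.

Lemma adjmxB p q (A B : 'M[C]_(p, q)) : (A - B)^t* = A^t* - B^t*.
Proof. by rewrite linearB /= map_mxB. Qed.

Lemma trace_rows N (Y : 'M[C]_N) :
  \tr Y = \sum_i mip (delta_mx 0 i *m Y) (delta_mx 0 i : 'rV[C]_N).
Proof.
apply: eq_bigr => i _; rewrite -rowE mipE big_ord1 (bigD1 i) //= big1 => [|j ji].
  by rewrite !mxE !eqxx conjC1 mulr1 addr0.
by rewrite !mxE (negPf ji) andbF conjC0 mulr0.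
Qed.

(** Steps that are all larger than [e] would bring the sequence below zero. *)
Lemma decreasing_small_step (u : nat -> R) (e : R) : 0 < e ->
  (forall k, 0 <= u k) -> exists k, u k - u k.+1 <= e.
Proof.
move=> e0 u0; apply: contrapT => /forallNP H.
have {}H k : u k.+1 <= u k - e by have /negP := H k; rewrite -ltNge; lra.
have {}H k : u k <= u 0%N - k%:R * e.
  elim: k => [|k IH]; first by rewrite mul0r subr0.
  by apply: le_trans (H k) _; rewrite -natr1; lra.
have := archi_boundP (divr_ge0 (u0 0%N) (ltW e0)).
rewrite ltr_pdivrMr //; have := H (Num.bound (u 0%N / e)).
have := u0 (Num.bound (u 0%N / e)); lra.
Qed.

(** An approximate fixed point of [Y = 2 - t Y^-1 t^*].  It is a term of the
    decreasing sequence [ando_seq] at which the trace drops by at most [e]: the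
    trace of the difference bounds the difference itself. *)
Lemma ando_approx N (t : 'M[C]_N) (r : C) (e : R) : r < 1 -> 0 < e ->
  (forall u : 'rV[C]_N, `|mip (u *m t) u| <= r * n2 u) ->
  exists Y : 'M[C]_N, exists c, [/\ Y^t* = Y, 0 < c,
    (forall h : 'rV[C]_N, c * n2 h <= mip (h *m Y) h),
    (forall h : 'rV[C]_N, mip (h *m Y) h <= 2 * n2 h) &
    (forall h : 'rV[C]_N, mip (h *m t *m invmx Y) (h *m t) <=
       2 * n2 h - mip (h *m Y) h + e%:C * n2 h)].
Proof.
move=> r1 e0 tr; pose Y := ando_seq t.
have YY k : (Y k)^t* = Y k by have [] := ando_seqP r1 tr k.
have tr_psd (D : 'M[C]_N) : (forall h : 'rV[C]_N, 0 <= mip (h *m D) h) -> 0 <= \tr D.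
  by move=> D0; rewrite trace_rows; apply: sumr_ge0.
have tY k : 0 <= \tr (Y k) by apply: tr_psd => h; exact: (ando_seq_psd r1 tr).
have [k Hk] : exists k, complex.Re (\tr (Y k)) - complex.Re (\tr (Y k.+1)) <= e.
  apply: (@decreasing_small_step (fun k => complex.Re (\tr (Y k)))) => // k.
  by have := tY k; rewrite lecE => /andP[_].
pose D := Y k - Y k.+1.
have D0 (h : 'rV[C]_N) : 0 <= mip (h *m D) h.
  by rewrite mulmxBr linearBl subr_ge0; exact: (ando_seq_decreasing r1 tr).
have DD : D^t* = D by rewrite /D adjmxB !YY.
have De : \tr D <= e%:C.
  have := tr_psd _ D0; rewrite !lecE /= => /andP[/eqP ->]; rewrite eqxx /= => _.
  by rewrite raddfB raddfB.
have [hk pk _] := ando_seqP r1 tr k.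
exists (Y k), (2 * (1 - r)); split => //.
- by rewrite mulr_gt0 ?ltr0n // subr_gt0.
- by move=> h; exact: (ando_seq_le2 r1 tr).
move=> h; have := psd_le_trace DD D0 h; rewrite mulmxBr linearBl /=.
have -> : mip (h *m Y k.+1) h = 2 * n2 h - mip (h *m t *m invmx (Y k)) (h *m t).
  rewrite /Y /= /schur_step mulmxBr linearBl /= mul_mx_scalar linearZl_LR /=.
  by congr (_ - _); rewrite !mulmxA [in LHS]mip_mulr trmxCK.
move=> H; have : \tr D * n2 h <= e%:C * n2 h by apply: ler_wpM2r => //; exact: n2_ge0.
move=> /(le_trans H); rewrite -subr_ge0 => H'; rewrite -subr_ge0.
by apply: le_trans H' _; rewrite le_eqVlt; apply/orP; left; apply/eqP; ring.
Qed.

(** In a basis of eigenvectors of the matrix [Y] of [ando_approx], with eigenvalues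
    [y i], put [a i = max (2 - y i) (1/2)].  As [2 - y <= a <= 1/y] on [(0, 2]], the
    inequality for [Y] shows that [t] is almost a contraction for the norm with
    weights [a i].  These weights lie between [1/2] and [2], hence the last bound,
    and [S] is the change to this weighted basis. *)
Lemma okubo_ando N (t : 'M[C]_N) (r : C) (e : R) : r < 1 -> 0 < e ->
  (forall u : 'rV[C]_N, `|mip (u *m t) u| <= r * n2 u) ->
  exists S : 'M[C]_N, [/\ S \in unitmx,
    (forall h : 'rV[C]_N, n2 (h *m (invmx S *m t *m S)) <= (1 + e)%:C * n2 h) &
    (forall x : 'rV[C]_N, n2 (x *m S) + n2 (x *m (invmx S)^t*) <= (5 / 2)%:C * n2 x)].
Proof.
move=> r1 e0 tr; have e20 : 0 < e / 2 by lra.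
have [Y [c [YY c0 cY Y2 Yt]]] := ando_approx r1 e20 tr.
have [P [d [PU YE dr]]] := spectral_hermitian (esym YY).
have PP : P *m P^t* = 1%:M by apply/unitarymxP.
have Pu := unitarymx_unit PU.
have hY (x : 'rV[C]_N) : mip (x *m Y) x = \sum_i d 0 i * `|(x *m P^t*) 0 i| ^+ 2.
  by rewrite YE !mulmxA mip_mulr n2_row_diag.
have hP (x : 'rV[C]_N) : n2 x = \sum_i `|(x *m P^t*) 0 i| ^+ 2.
  by rewrite -(n2_unitary x PU) n2E big_ord1.
pose f i : 'rV[C]_N := delta_mx 0 i *m P.
have fP i : n2 (f i) = 1 /\ mip (f i *m Y) (f i) = d 0 i.
  rewrite hY hP /f -mulmxA PP mulmx1; split; rewrite (bigD1 i) //= big1.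
  - by rewrite mxE !eqxx normr1 expr1n addr0.
  - by move=> j ji; rewrite mxE (negPf ji) andbF normr0 expr0n.
  - by rewrite mxE !eqxx normr1 expr1n mulr1 addr0.
  - by move=> j ji; rewrite mxE (negPf ji) andbF normr0 expr0n mulr0.
pose y i := complex.Re (d 0 i).
have dy i : d 0 i = (y i)%:C by rewrite /y RRe_real.
have y0 i : 0 < y i.
  have [E1 E2] := fP i; have := cY (f i).
  rewrite E1 E2 mulr1 dy => /(lt_le_trans c0).
  by rewrite ltcR.
have y2 i : y i <= 2.
  have [E1 E2] := fP i; have := Y2 (f i).
  by rewrite E1 E2 mulr1 dy -[2]/(2%:R) -(rmorph_nat (real_complex R)) lecR.
(* a is squeezed between the tangent 2 - y at y = 1 and the hyperbola 1/y *)
pose a i := Num.max (2 - y i) (1 / 2).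
have a_lb i : 2 - y i <= a i by rewrite le_max lexx.
have a_half i : 1 / 2 <= a i by rewrite le_max lexx orbT.
have a2 i : a i <= 2 by rewrite ge_max; apply/andP; split; have := y0 i; lra.
have ay i : a i <= (y i)^-1.
  rewrite -[X in _ <= X]mul1r ler_pdivlMr // /a maxr_pMl; last exact: ltW.
  by rewrite ge_max; apply/andP; split; have := y2 i; have := sqr_ge0 (y i - 1); nra.
pose b i := Num.sqrt (a i).
have a0 i : 0 < a i by have := a_half i; lra.
have b0 i : 0 < b i by rewrite sqrtr_gt0.
have bn i : b i != 0 by rewrite gt_eqF.
have yn i : y i != 0 by rewrite gt_eqF.
have bb i : b i ^+ 2 = a i by rewrite sqr_sqrtr // ltW.
pose B : 'rV[C]_N := \row_i (b i)%:C; pose B' : 'rV[C]_N := \row_i (b i)^-1%:C.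
have BB' : diag_mx B *m diag_mx B' = 1%:M.
  rewrite mulmx_diag; apply/matrixP => i j; rewrite !mxE.
  by rewrite -rmorphM /= mulfV.
pose S := P^t* *m diag_mx B.
have SS : S *m (diag_mx B' *m P) = 1%:M.
  by rewrite /S mulmxA -(mulmxA _ (diag_mx B)) BB' mulmx1 -invmx_unitary // mulVmx.
have [Su SE] := mulmx1_unit SS.
have {}SE : invmx S = diag_mx B' *m P.
  by rewrite -[RHS](mulKmx Su) SS mulmx1.
have nS (x : 'rV[C]_N) : n2 (x *m S) = \sum_i (a i)%:C * `|(x *m P^t*) 0 i| ^+ 2.
  rewrite n2E big_ord1; apply: eq_bigr => i _.
  rewrite /S mulmxA mul_mx_diag mxE normrM exprMn mulrC [in X in X * _]mxE.
  by rewrite normc_def /= expr0n addr0 sqrtr_sqr (ger0_norm (ltW (b0 i))) -rmorphXn /= bb.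
exists S; split => //.
- move=> h; set g := h *m invmx S.
  have -> : h *m (invmx S *m t *m S) = g *m t *m S by rewrite /g !mulmxA.
  have -> : n2 h = n2 (g *m S) by rewrite /g mulmxKV.
  rewrite !nS; apply: (@le_trans _ _ (mip (g *m t *m invmx Y) (g *m t))).
    have -> : invmx Y = P^t* *m diag_mx (\row_i (y i)^-1%:C) *m P.
      have Yu := posdef_unitmx c0 cY.
      suff E : Y *m (P^t* *m diag_mx (\row_i (y i)^-1%:C) *m P) = 1%:M.
        by rewrite -[RHS](mulKmx Yu) E mulmx1.
      rewrite {1}YE !mulmxA -(mulmxA _ P) PP mulmx1 -(mulmxA _ (diag_mx d)) mulmx_diag.
      have -> : diag_mx (\row_j (d 0 j * (\row_i (y i)^-1%:C) 0 j)) = 1%:M :> 'M[C]_N.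
        apply/matrixP => i j; rewrite !mxE dy.
        by rewrite -rmorphM /= mulfV.
      by rewrite mulmx1 -invmx_unitary // mulVmx.
    rewrite !mulmxA mip_mulr n2_row_diag; apply: ler_sum => i _.
    by apply: ler_wpM2r; rewrite ?exprn_ge0 // mxE lecR.
  apply: le_trans (Yt g) _.
  rewrite hP hY !mulr_sumr -sumrB -big_split /=.
  apply: ler_sum => i _; rewrite dy -mulrBl -mulrDl mulrA.
  apply: ler_wpM2r; rewrite ?exprn_ge0 //.
  rewrite -[2](rmorph_nat (real_complex R)) -rmorphB -rmorphD -rmorphM lecR.
  by have := a_lb i; have := a_half i; nra.
move=> x; have -> : n2 (x *m (invmx S)^t*) = \sum_i (a i)^-1%:C * `|(x *m P^t*) 0 i| ^+ 2.
  rewrite SE trmx_mul map_mxM tr_diag_mx map_diag_mx mulmxA.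
  rewrite n2E big_ord1; apply: eq_bigr => i _.
  rewrite mul_mx_diag mxE normrM exprMn mulrC; congr (_ * _).
  rewrite !mxE norm_conjC normc_def /= expr0n addr0 sqrtr_sqr ger0_norm ?invr_ge0 ?ltW //.
  by rewrite -rmorphXn /= exprVn bb.
rewrite nS hP -big_split mulr_sumr; apply: ler_sum => i _ /=.
rewrite -mulrDl; apply: ler_wpM2r; rewrite ?exprn_ge0 // -rmorphD lecR.
have := a_half i; have := a2 i; have := a0 i; move: (a i) => z z0 z2 z12.
have -> : z + z^-1 = (z ^+ 2 + 1) / z by field; rewrite gt_eqF.
by rewrite ler_pdivrMr //; nra.
Qed.

End OkuboAndo.

(** * The von Neumann inequality for matrix polynomials *)

Section VonNeumann.
Variable R : realType.
Local Notation C := R[i].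
Local Notation "x %:C" := (real_complex R x) : ring_scope.

(** The order on complex numbers is partial, hence the hypothesis that [b] is real. *)
Lemma le_geometric_slack (a b : C) (rho : R) : 0 <= rho -> rho < 1 -> 0 <= a ->
  b \is Num.real -> (forall K, a <= b + (rho ^+ K)%:C * a) -> a <= b.
Proof.
move=> rho0 rho1 a0 br H; have aE := RRe_real (ger0_real a0); have bE := RRe_real br.
rewrite -aE -bE lecR; set x := complex.Re a; set y := complex.Re b.
have {}H K : x <= y + rho ^+ K * x.
  by have := H K; rewrite -{1 2}aE -bE -rmorphM -rmorphD lecR.
rewrite leNgt; apply/negP => yx.
have x0 : 0 <= x by have := a0; rewrite -aE ler0c.
have e0 : 0 < (x - y) / (x + 1) by apply: divr_gt0; lra.
have : (fun n => rho ^+ n) @ \oo --> (0 : R).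
  by apply: cvg_expr; rewrite ger0_norm.
move=> /cvgr0Pnorm_lt /(_ _ e0) [K _ /(_ K (leqnn K))].
have t0 : 0 <= rho ^+ K by exact: exprn_ge0.
rewrite /= ger0_norm // ltr_pdivlMr; last by lra.
by have := H K; rewrite mulrDr mulr1; lra.
Qed.

(** Square roots of the eigenvalues. *)
Lemma psd_factor N (M : 'M[C]_N) : M^t* = M ->
  (forall h : 'rV[C]_N, 0 <= mip (h *m M) h) ->
  exists D : 'M[C]_N, M = D *m D^t*.
Proof.
move=> MM M0; have [P [d [PU ME dr]]] := spectral_hermitian (esym MM).
have PP : P *m P^t* = 1%:M by apply/unitarymxP.
have d0 i : 0 <= d 0 i.
  have := M0 (delta_mx 0 i *m P).
  rewrite {1}ME !mulmxA mip_mulr n2_row_diag -mulmxA PP mulmx1 (bigD1 i) //= big1 => [|j ji].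
    by rewrite mxE !eqxx normr1 expr1n mulr1 addr0.
  by rewrite mxE (negPf ji) andbF normr0 expr0n mulr0.
exists (P^t* *m diag_mx (\row_i sqrtC (d 0 i))).
rewrite trmx_mul map_mxM trmxCK tr_diag_mx map_diag_mx mulmxA -(mulmxA (P^t*)).
rewrite [X in _ = _ *m X *m _](_ : _ = diag_mx d); first exact: ME.
rewrite mulmx_diag; congr diag_mx; apply/rowP => i; rewrite !mxE.
have /CrealP E : sqrtC (d 0 i) \is Num.real by rewrite ger0_real // sqrtC_ge0.
by rewrite [X in _ * X]E -expr2 sqrtCK.
Qed.

(** The action of [G(s)], for a matrix polynomial [G] with coefficients of index
    below [d], on a tuple of row vectors. *)
Definition mxact N (s : 'M[C]_N) n (G : 'M[{poly C}]_n) d (X : 'M[C]_(n, N)) :=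
  \sum_(k < d) coefmx k G *m iter k (mulmxr s) X.

Lemma iter_mulmxr_mull N (s : 'M[C]_N) p n (A : 'M[C]_(p, n)) X k :
  iter k (mulmxr s) (A *m X) = A *m iter k (mulmxr s) X.
Proof. by elim: k => //= k ->; rewrite mulmxA. Qed.

Lemma iter_mulmxr_sum N (s : 'M[C]_N) n k I r (F : I -> 'M[C]_(n, N)) :
  iter k (mulmxr s) (\sum_(i <- r) F i) = \sum_(i <- r) iter k (mulmxr s) (F i).
Proof. by elim: k => //= k ->; rewrite mulmx_suml. Qed.

(** Let [D D^* = 1 - s s^*].  The sequences [X s^i D] embed the tuples of vectors in
    a space of square summable sequences: their squared norms sum to
    [n2 X - lim n2 (X s^i)].  Under this embedding [s] becomes a shift and [G(s)] a
    Toeplitz operator. *)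
Lemma von_neumann N (s : 'M[C]_N) (rho : R) n (G : 'M[{poly C}]_n) d (m : C)
    (X : 'M[C]_(n, N)) :
  0 <= rho -> rho < 1 -> 0 <= m ->
  (forall h : 'rV[C]_N, n2 (h *m s) <= rho%:C * n2 h) ->
  (forall i j, (size (G i j) <= d)%N) ->
  (forall z (V : 'M[C]_(n, N)), `|z| = 1 -> n2 (evmx z G *m V) <= m * n2 V) ->
  n2 (mxact s G d X) <= m * n2 X.
Proof.
move=> rho0 rho1 m0 srho sG Gm.
have srho' p (Y : 'M[C]_(p, N)) : n2 (Y *m s) <= rho%:C * n2 Y.
  rewrite mip_row (mip_row Y) mulr_sumr; apply: ler_sum => i _.
  by rewrite row_mul srho.
have [D DE] : exists D : 'M[C]_N, 1%:M - s *m s^t* = D *m D^t*.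
  apply: psd_factor => [|h].
    by rewrite linearB /= map_mxB trmx_mul map_mxM trmxCK tr_scalar_mx map_scalar_mx /= conjC1.
  rewrite mulmxBr mulmx1 linearBl /= mulmxA (mip_mulr _ (s^t*)) trmxCK subr_ge0.
  apply: le_trans (srho' _ h) _; rewrite -[leRHS]mul1r; apply: ler_wpM2r => //.
    exact: n2_ge0.
  by rewrite -(rmorph1 (real_complex R)) lecR ltW.
have nD p (Y : 'M[C]_(p, N)) : n2 (Y *m D) = n2 Y - n2 (Y *m s).
  rewrite mip_mulr -mulmxA -DE mulmxBr mulmx1 linearBr /=; congr (_ - _).
  by rewrite [RHS]mip_mulr mulmxA.
pose it p (Y : 'M[C]_(p, N)) i := iter i (mulmxr s) Y.
have tele p (Y : 'M[C]_(p, N)) K : \sum_(i < K) n2 (it p Y i *m D) = n2 Y - n2 (it p Y K).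
  elim: K => [|K IH]; first by rewrite big_ord0 subrr.
  by rewrite big_ord_recr /= IH nD addrA subrK.
set F := mxact s G d X.
have key K : n2 F - n2 (it n F K) <= m * n2 X.
  (* the coefficients are reversed: the backward shift becomes multiplication by z *)
  pose L := (d + K)%N; pose P := polymx L (fun j => it n X (L.-1 - j)%N *m D).
  have sP a b : (size (P a b) <= L)%N by exact: size_polymx.
  have H := @analytic_toeplitz_bound _ _ _ G m P L L (fun z V => Gm z V) sP.
  rewrite -tele; apply: le_trans (_ : m * (n2 X - n2 (it n X L)) <= _); last first.
    by apply: ler_wpM2l => //; rewrite gerBl n2_ge0.
  rewrite -tele (_ : \sum_(i < L) n2 (it n X i *m D) = \sum_(j < L) n2 (coefmx j P)); last first.
    rewrite (reindex_inj rev_ord_inj) /=; apply: eq_bigr => j _.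
    by rewrite coefmx_polymx ltn_ord subnS predn_sub.
  apply: le_trans H; rewrite big_split_ord /= -[leLHS]add0r; apply: lerD.
    by apply: sumr_ge0 => i _; exact: n2_ge0.
  rewrite (reindex_inj rev_ord_inj) /= le_eqVlt; apply/orP; left; apply/eqP.
  apply: eq_bigr => j _.
  suff -> : it n F (K - j.+1)%N *m D = coefmx (d + j) (G *m P) by [].
  rewrite coefmxM /F /mxact /it iter_mulmxr_sum mulmx_suml.
  rewrite (big_ord_widen (d + j).+1 (fun k => iter (K - j.+1) (mulmxr s)
     (coefmx k G *m iter k (mulmxr s) X) *m D)) ?leqW ?leq_addr // big_mkcond /=.
  apply: eq_bigr => k _; case: ifP => [kd|/negbT]; last first.
    by rewrite -leqNgt => dk; rewrite (coefmx_big sG dk) mul0mx.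
  rewrite iter_mulmxr_mull -mulmxA; congr (_ *m _).
  rewrite coefmx_polymx ifT; last by rewrite /L (leq_ltn_trans (leq_subr _ _)) // ltn_add2l.
  rewrite -iterD; congr (iter _ _ _ *m _).
  have := ltn_ord j; rewrite /L; move: kd; lia.
have itK K : n2 (it n F K) <= (rho ^+ K)%:C * n2 F.
  elim: K => [|K IH]; first by rewrite expr0 rmorph1 mul1r.
  apply: le_trans (srho' _ _) _; rewrite exprS rmorphM -mulrA.
  by apply: ler_wpM2l => //; rewrite ler0c.
apply: (@le_geometric_slack _ _ rho) => //.
- exact: n2_ge0.
- by rewrite realM ?ger0_real ?n2_ge0.
- by move=> K; rewrite -lerBlDr; apply: le_trans (key K); rewrite lerD2l lerN2.
Qed.

End VonNeumann.

(** * The bound 5/4 for matrices, and for polynomials of a Hilbert space operator *)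

Section MatrixTheorem.
Variable R : realType.
Local Notation C := R[i].
Local Notation "x %:C" := (real_complex R x) : ring_scope.

(** Letting [e] tend to zero, for real numbers inside a partially ordered field. *)
Lemma le_linear_slack (a b c : C) : a \is Num.real -> b \is Num.real -> 0 <= c ->
  (forall e : R, 0 < e < 1 -> a <= b + e%:C * c) -> a <= b.
Proof.
move=> /complex_realP[x ->] /complex_realP[y ->] c0 H.
have /complex_realP[z zE] := ger0_real c0; move: c0 H.
rewrite {}zE lecR ler0c => z0 H.
have {}H e : 0 < e < 1 -> x <= y + e * z.
  by move=> /H; rewrite -rmorphM -rmorphD lecR.
rewrite leNgt; apply/negP => yx.
pose e := (x - y) / (2 * (x - y + z + 1)).
have den : 0 < 2 * (x - y + z + 1) by lra.
have e0 : 0 < e by apply: divr_gt0; lra.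
have e1 : e < 1 by rewrite ltr_pdivrMr //; lra.
have /H : 0 < e < 1 by rewrite e0.
have : e * (2 * (x - y + z + 1)) = x - y by rewrite divfK // gt_eqF.
have w0 : 0 < x - y by rewrite subr_gt0.
rewrite !mulrDr !mulr1; have := mulr_ge0 (ltW e0) z0; have := mulr_gt0 e0 w0.
by rewrite !mulrDr; lra.
Qed.

(** Continuity of a polynomial at [1], through the factor [X - 1] of [p - p(1)]. *)
Lemma horner1_le (p : {poly C}) (M : C) : 0 <= M ->
  (forall r : R, 0 < r < 1 -> `|p.[r%:C]| <= M) -> `|p.[1]| <= M.
Proof.
move=> M0 H.
have /factor_theorem [q qE] : root (p - p.[1]%:P) 1 by rewrite rootE !hornerE subrr.
apply: (@le_linear_slack _ _ (\sum_(k < size q) `|q`_k|)).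
- exact: normr_real.
- exact: ger0_real.
- by apply: sumr_ge0.
move=> e /andP[e0 e1]; pose r := 1 - e.
have r01 : 0 < r < 1 by rewrite /r; apply/andP; split; lra.
have pr : p.[1] = p.[r%:C] + e%:C * q.[r%:C].
  have := congr1 (horner^~ r%:C) qE; rewrite !hornerE /r rmorphB rmorph1 => E.
  have {}E : p.[1] - p.[1 - e%:C] = e%:C * q.[1 - e%:C].
    by rewrite -opprB E; ring.
  by rewrite -E addrC subrK.
rewrite pr; apply: le_trans (ler_normD _ _) _; apply: lerD; first exact: H.
have e0' : 0 <= e%:C by rewrite ler0c ltW.
rewrite normrM ger0_norm //; apply: ler_wpM2l => //.
rewrite horner_coef; apply: le_trans (ler_norm_sum _ _ _) _; apply: ler_sum => k _.
case/andP: r01 => r0 r1; have r0' : 0 <= r%:C by rewrite ler0c ltW.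
rewrite normrM ler_piMr // normrX exprn_ile1 //.
by rewrite ger0_norm // -(rmorph1 (real_complex R)) lecR ltW.
Qed.

Lemma evmxE z p q (P : 'M[{poly C}]_(p, q)) d :
  (forall i j, (size (P i j) <= d)%N) ->
  evmx z P = \sum_(k < d) z ^+ k *: coefmx k P.
Proof.
move=> sP; apply/matrixP => i j; rewrite summxE !mxE /horner_eval.
rewrite (horner_coef_wide _ (sP i j)); apply: eq_bigr => k _.
by rewrite !mxE mulrC.
Qed.

(** With [sigma = S^-1 (r t) S] the contraction given by [okubo_ando], the value
    [<G(t)X, X>] is [<G(sigma)(X S), X S^-*>], to which the von Neumann inequality
    and Cauchy-Schwarz apply; the product of the norms of [X S] and [X S^-*] is at
    most half the sum of their squares.  Dilating by [r < 1] is needed three times: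
    for [okubo_ando], for a strict contraction, and to evaluate the symbol inside the
    disc.  This gives the bound with [r ^+ 3 t] in place of [t], and [r] tends to [1]. *)
Lemma polynomial_calculus_numerical_radius N (t : 'M[C]_N) n (G : 'M[{poly C}]_n)
    (m : R) d (X : 'M[C]_(n, N)) :
  (forall u : 'rV[C]_N, `|mip (u *m t) u| <= n2 u) -> 0 <= m ->
  (forall z (v : 'cV[C]_n), `|z| < 1 -> n2 (evmx z G *m v) <= (m ^+ 2)%:C * n2 v) ->
  (forall i j, (size (G i j) <= d)%N) ->
  `|mip (mxact t G d X) X| <= (5 / 4 * m)%:C * n2 X.
Proof.
move=> wt m0 Gm sG.
pose c k := mip (coefmx k G *m iter k (mulmxr t) X) X.
pose g : {poly C} := \poly_(k < d) c k.
have gE z : g.[z] = \sum_(k < d) z ^+ k * c k.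
  by rewrite horner_poly; apply: eq_bigr => k _; rewrite mulrC.
have nX : 0 <= (5 / 4 * m)%:C * n2 X.
  by rewrite mulr_ge0 ?n2_ge0 // ler0c mulr_ge0 //; lra.
have -> : mip (mxact t G d X) X = (g \Po 'X^3).[1].
  rewrite horner_comp hornerXn expr1n gE linear_sumlz; apply: eq_bigr => k _.
  by rewrite expr1n mul1r.
apply: horner1_le => // r /andP[r0 r1]; rewrite horner_comp hornerXn.
have rC0 : 0 <= r%:C by rewrite ler0c ltW.
have rt (u : 'rV[C]_N) : `|mip (u *m (r%:C *: t)) u| <= r%:C * n2 u.
  by rewrite -scalemxAr linearZl_LR /= normrM ger0_norm // ler_wpM2l.
have rC1 : r%:C < 1 by rewrite -(rmorph1 (real_complex R)) ltcR.
have e0 : 0 < 1 - r by lra.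
have [S [Su Sc SK]] := okubo_ando rC1 e0 rt.
pose rho : R := r ^+ 2 * (1 + (1 - r)).
pose s := r%:C *: (invmx S *m (r%:C *: t) *m S).
have srho (h : 'rV[C]_N) : n2 (h *m s) <= rho%:C * n2 h.
  rewrite -scalemxAr n2Z ger0_norm // /rho rmorphM rmorphXn -[leRHS]mulrA.
  by apply: ler_wpM2l => //; rewrite exprn_ge0.
have rho0 : 0 <= rho by rewrite /rho; nra.
have rho1 : rho < 1.
  by have := mulr_ge0 (ltW r0) (sqr_ge0 (1 - r)); rewrite /rho; nra.
pose Gr : 'M[{poly C}]_n := polymx d (fun k => r%:C ^+ k *: coefmx k G).
have sGr i j : (size (Gr i j) <= d)%N by exact: size_polymx.
have Grm z (V : 'M[C]_(n, N)) : `|z| = 1 -> n2 (evmx z Gr *m V) <= (m ^+ 2)%:C * n2 V.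
  move=> z1; rewrite mip_col [in leRHS]mip_col mulr_sumr; apply: ler_sum => j _.
  have -> : evmx z Gr = evmx (z * r%:C) G.
    rewrite evmx_polymx (evmxE _ sG); apply: eq_bigr => k _.
    by rewrite scalerA exprMn.
  rewrite -[col j (_ *m V)]trmxK tr_col trmx_mul row_mul -tr_col trmx_mul !trmxK; apply: Gm.
  by rewrite normrM z1 mul1r ger0_norm.
have Ss p (Z : 'M[C]_(p, N)) : Z *m S *m s = (r%:C ^+ 2 *: (Z *m t)) *m S.
  have -> : s = r%:C ^+ 2 *: (invmx S *m t *m S).
    by rewrite /s -scalemxAr -scalemxAl scalerA expr2.
  by rewrite -scalemxAr !mulmxA mulmxK // scalemxAl.
have itE k p (Y : 'M[C]_(p, N)) :
    iter k (mulmxr s) (Y *m S) = (r%:C ^+ (2 * k) *: iter k (mulmxr t) Y) *m S.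
  elim: k => [|k IH]; first by rewrite muln0 expr0 scale1r.
  rewrite iterS IH [LHS]Ss -(scalemxAl _ (iter _ _ _)) scalerA; congr (_ *: _ *m _).
  by rewrite -exprD mulnS.
have := von_neumann (X *m S) rho0 rho1 _ srho sGr Grm.
rewrite ler0c sqr_ge0 => /(_ isT).
pose W := \sum_(k < d) (r%:C ^+ 3) ^+ k *: (coefmx k G *m iter k (mulmxr t) X).
have -> : mxact s Gr d (X *m S) = W *m S.
  rewrite /mxact /W mulmx_suml; apply: eq_bigr => k _.
  rewrite itE coefmx_polymx ltn_ord -!scalemxAl -scalemxAr scalerA mulmxA; congr (_ *: _).
  by rewrite -exprD -exprM; congr (_ ^+ _); lia.
move=> VN.
have -> : g.[r%:C ^+ 3] = mip (W *m S) (X *m (invmx S)^t*).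
  rewrite mip_mulr -mulmxA -map_mxM -trmx_mul mulmxV // trmx1 map_mx1 mulmx1.
  rewrite gE linear_sumlz; apply: eq_bigr => k _.
  by rewrite linearZl_LR.
have SK' : n2 (X *m S) + n2 (X *m (invmx S)^t*) <= (5 / 2)%:C * n2 X.
  rewrite mip_row [X in _ + X]mip_row -big_split (mip_row X) mulr_sumr.
  by apply: ler_sum => i _; rewrite !row_mul; apply: SK.
have CS := dot_cauchy_schwarz (@mip C n N) (W *m S) (X *m (invmx S)^t*).
rewrite -(ler_pXn2r (n := 2)) // ?nnegrE //; apply: le_trans CS _.
apply: le_trans (ler_wpM2r (n2_ge0 _) VN) _.
have := n2_ge0 (X *m (invmx S)^t*); have := n2_ge0 (X *m S).
move: SK'; have := n2_ge0 X.
move: (n2 (X *m (invmx S)^t*)) (n2 (X *m S)) (n2 X) => b a w w0 abw a0 b0.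
have /complex_realP[w' wE] := ger0_real w0; have /complex_realP[a' aE] := ger0_real a0.
have /complex_realP[b' bE] := ger0_real b0; move: w0 abw a0 b0.
rewrite wE aE bE -rmorphD -!rmorphM -rmorphXn !ler0c !lecR => w0 abw a0 b0.
have ab : a' * b' <= (5 / 4 * w') ^+ 2.
  have h0 : 0 <= (a' + b') / 2 by lra.
  have h1 : (a' + b') / 2 <= 5 / 4 * w' by lra.
  have h2 : ((a' + b') / 2) ^+ 2 <= (5 / 4 * w') ^+ 2.
    by rewrite ler_pXn2r // nnegrE (le_trans h0).
  apply: le_trans h2; rewrite -subr_ge0.
  have -> : ((a' + b') / 2) ^+ 2 - a' * b' = ((a' - b') / 2) ^+ 2 by field.
  exact: sqr_ge0.
have -> : (5 / 4 * m * w') ^+ 2 = m ^+ 2 * (5 / 4 * w') ^+ 2 by field.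
by rewrite -mulrA; apply: ler_wpM2l => //; exact: sqr_ge0.
Qed.

End MatrixTheorem.

Section HilbertReduction.
Variables (R : realType) (H : hilbertType R).
Local Notation C := R[i].
Local Notation "x %:C" := (real_complex R x) : ring_scope.
Local Notation ip := (@inner R H).

Lemma poly_op_wide (T : H -> H) (p : {poly C}) d x : (size p <= d)%N ->
  poly_op T p x = \sum_(k < d) p`_k *: iter k T x.
Proof.
move=> pd; rewrite /poly_op (big_ord_widen _ (fun k => p`_k *: iter k T x) pd).
rewrite big_mkcond /=; apply: eq_bigr => k _; case: ifP => // /negbT.
by rewrite -leqNgt => kp; rewrite nth_default // scale0r.
Qed.

Variables (T : {linear H -> H}) (n : nat).
Hypothesis hw : (numerical_radius ip T <= 1)%E.

(** With [d] a bound on the degrees, only the vectors [T^k x_j] for [k <= d] matter.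
    On an orthonormal basis [e] of their span, [T] is replaced by its compression [t]:
    the numerical radius does not increase, and the powers of [t] and of [T] agree on
    the [x_j] up to the exponent [d]. *)
Lemma polynomial_calculus_bound (G : 'M[{poly C}]_n) (m : R) (x : {ffun 'I_n -> H}) :
  0 <= m ->
  (forall z (v : 'cV[C]_n), `|z| < 1 -> n2 (evmx z G *m v) <= (m ^+ 2)%:C * n2 v) ->
  `|dsum_inner (mxop (fun i j => poly_op T (G i j)) x) x|
    <= (5 / 4 * m)%:C * dsum_inner x x.
Proof.
move=> m0 Gm; have [d sG] := size_mx_bound G.
have [N [e [ee es]]] := orthonormal_coordinates ip
  [seq iter k T (x j) | k <- iota 0 d.+1, j <- enum 'I_n].
have {}es k j : (k <= d)%N -> iter k T (x j) = \sum_a ip (iter k T (x j)) (e a) *: e a.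
  move=> kd; apply: es; apply/allpairsP; exists (k, j); split => //.
    by rewrite mem_iota add0n.
  by rewrite mem_enum.
pose t : 'M[C]_N := \matrix_(a, b) ip (T (e a)) (e b).
pose X : 'M[C]_(n, N) := \matrix_(i, a) ip (x i) (e a).
pose vec (u : 'rV[C]_N) : H := \sum_a u 0 a *: e a.
have ip_vec (u v : 'rV[C]_N) : ip (vec u) (vec v) = mip u v.
  rewrite mipE big_ord1 linear_sumlz; apply: eq_bigr => a _.
  rewrite linearZl_LR /= linear_sumr (bigD1 a) //= linearZr_LR /= ee eqxx mulr1.
  by rewrite big1 ?addr0 // => b ba; rewrite linearZr_LR /= ee eq_sym (negPf ba) mulr0.
have ip_vecr y (v : 'rV[C]_N) : ip y (vec v) = \sum_a ip y (e a) * (v 0 a)^*.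
  by rewrite linear_sumr; apply: eq_bigr => a _; rewrite linearZr_LR /= mulrC.
have wt (u : 'rV[C]_N) : `|mip (u *m t) u| <= n2 u.
  have TZ a y : T (a *: y) = a *: T y by rewrite linearZ.
  have := numerical_radius_le TZ hw (vec u); rewrite rmorph1 mul1r ip_vec.
  suff -> : ip (T (vec u)) (vec u) = mip (u *m t) u by [].
  rewrite ip_vecr mipE big_ord1; apply: eq_bigr => b _; congr (_ * _).
  rewrite mxE linear_sum linear_sumlz; apply: eq_bigr => a _.
  by rewrite linearZ linearZl_LR /= mxE.
have itX k : (k <= d)%N -> forall i a,
    iter k (mulmxr t) X i a = ip (iter k T (x i)) (e a).
  elim: k => [_ i a|k IH kd i a]; first by rewrite mxE.
  rewrite iterS mxE [in RHS]iterS [in RHS](es k i (ltnW kd)) linear_sum linear_sumlz.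
  apply: eq_bigr => b _; rewrite (IH (ltnW kd)) linearZ linearZl_LR /=.
  by rewrite mxE.
have nX : n2 X = dsum_inner x x.
  rewrite mipE; apply: eq_bigr => i _.
  rewrite [X in _ = inner _ X](es 0%N i isT : x i = _) linear_sumr.
  by apply: eq_bigr => a _; rewrite linearZr_LR /= !mxE mulrC.
have -> : dsum_inner (mxop (fun i j => poly_op T (G i j)) x) x = mip (mxact t G d X) X.
  rewrite mipE; apply: eq_bigr => i _.
  rewrite [X in inner _ X](es 0%N i isT : x i = _) linear_sumr; apply: eq_bigr => a _.
  rewrite linearZr_LR /= mulrC; congr (_ * _); last by rewrite [in RHS]mxE.
  rewrite ffunE linear_sumlz /mxact summxE.
  under [RHS]eq_bigr do rewrite mxE.
  rewrite [RHS]exchange_big; apply: eq_bigr => j _ /=.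
  rewrite (poly_op_wide _ _ (sG i j)) linear_sumlz; apply: eq_bigr => k _.
  by rewrite linearZl_LR /= itX ?mxE // ltnW.
by rewrite -nX; exact: polynomial_calculus_numerical_radius.
Qed.

End HilbertReduction.

Section SupNorm.
Variable R : realType.
Local Notation C := R[i].
Local Notation "x %:C" := (real_complex R x) : ring_scope.

Lemma cdotE n (u v : 'cV[C]_n) : cdot u v = mip u v.
Proof. by rewrite mipE; apply: eq_bigr => i _; rewrite big_ord1. Qed.

Lemma mx_supnorm_ge0 n (F : C -> 'M[C]_n) : (0 <= mx_supnorm F)%E.
Proof.
apply: le_trans (opnorm_ge0 (@cdot R n) (mulmx (F 0))) _.
by apply: ereal_sup_ubound; exists 0 => //=; rewrite /open_disc /= normr0.
Qed.

Lemma mx_supnorm_le n (F : C -> 'M[C]_n) (m : R) : 0 <= m ->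
  (mx_supnorm F <= m%:E)%E -> forall z (v : 'cV[C]_n), `|z| < 1 ->
  n2 (F z *m v) <= (m ^+ 2)%:C * n2 v.
Proof.
move=> m0 Fm z v z1.
have : (opnorm (@cdot R n) (mulmx (F z)) <= m%:E)%E.
  by apply: le_trans Fm; apply: ereal_sup_ubound; exists z.
move=> /opnorm_le => /(_ (fun a x => esym (scalemxAr a (F z) x)) v) H.
rewrite -!cdotE -!ipnorm_sqr -rmorphM lecR -exprMn ler_pXn2r // nnegrE ?ipnorm_ge0 //.
by rewrite mulr_ge0 ?ipnorm_ge0.
Qed.

End SupNorm.

Theorem polynomial_case (R : realType) (H : hilbertType R) (T : {linear H -> H})
    (n : nat) (hw : (numerical_radius (@inner R H) T <= 1)%E) (F : 'M[{poly R[i]}]_n) :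
    (numerical_radius (@dsum_inner R H n) (mxop (fun i j => poly_op T (F i j)))
     <= (5 / 4)%:E * mx_supnorm (horner_mx_fun F))%E.
Proof.
have := mx_supnorm_ge0 (horner_mx_fun F).
case E : (mx_supnorm (horner_mx_fun F)) => [m| |] //.
  rewrite lee_fin => m0; rewrite -EFinM; apply: numerical_radius_leP => x x1.
  have := @polynomial_calculus_bound _ _ T n hw F m x m0; rewrite x1 mulr1; apply.
  have Em : (mx_supnorm (horner_mx_fun F) <= m%:E)%E by rewrite E.
  move=> z v z1; have := mx_supnorm_le m0 Em v z1.
  suff -> : horner_mx_fun F z = evmx z F by [].
  by apply/matrixP => i j; rewrite !mxE.
by move=> _; rewrite gt0_muley ?leey // lte_fin; lra.
Qed.

(** * Goursat's theorem on rectangles *)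

Section CousinCells.
Variables (R : realType) (A B : R).
Hypotheses (A0 : 0 <= A) (B0 : 0 <= B).

Lemma half_powers_small (h d : R) : 0 < d -> exists n, h / 2 ^+ n < d.
Proof.
move=> d0; have /archi_boundP := divr_ge0 (normr_ge0 h) (ltW d0).
set n := Num.bound _ => H; exists n.
have p0 : 0 < 2 ^+ n :> R by rewrite exprn_gt0.
rewrite ltr_pdivrMr // (le_lt_trans (ler_norm h)) // mulrC -ltr_pdivrMr //.
apply: lt_trans H _; rewrite -natrX ltr_nat; exact: ltn_expl.
Qed.

Lemma nested_sup (a b : nat -> R) : (forall n, a n <= a n.+1) -> (forall n, b n.+1 <= b n) ->
  (forall n, a n <= b n) -> exists x, forall n, a n <= x <= b n.
Proof.
move=> a1 b1 ab.
have am : {homo a : m n / (m <= n)%N >-> m <= n} by apply: homo_leq => //; exact: le_trans.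
have bm n k : b (n + k)%N <= b n.
  by elim: k => [|k IH]; rewrite ?addn0 // addnS (le_trans (b1 _)).
have amb m n : a m <= b n.
  apply: (@le_trans _ _ (a (n + m)%N)); first by apply: am; rewrite leq_addl.
  exact: le_trans (ab _) (bm _ _).
exists (sup (range a)) => n; apply/andP; split.
  by apply: ub_le_sup; [exists (b 0%N) => _ [m _ <-] | exists n].
by apply: ge_sup; [exists (a 0%N); exists 0%N | move=> _ [m _ <-]].
Qed.

(** A property of cells that passes from the four quarters of a cell to the cell, and
    holds for the small cells around each point, holds for the whole cell: otherwise
    one obtains nested cells without the property, which shrink to a point.  It serves
    both Goursat's theorem and uniform continuity.  The sides of a cell keep the
    ratio [A : B]. *)
Lemma cousin_cells (P : R -> R -> R -> Prop) (a0 c0 h0 : R) : 0 < h0 ->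
  (forall a c h, 0 < h -> P a c (h / 2) -> P (a + A * (h / 2)) c (h / 2) ->
     P a (c + B * (h / 2)) (h / 2) -> P (a + A * (h / 2)) (c + B * (h / 2)) (h / 2) ->
     P a c h) ->
  (forall x y, a0 <= x <= a0 + A * h0 -> c0 <= y <= c0 + B * h0 ->
     exists2 d, 0 < d & forall a c h, 0 < h < d ->
       a <= x <= a + A * h -> c <= y <= c + B * h ->
       a0 <= a -> a + A * h <= a0 + A * h0 -> c0 <= c -> c + B * h <= c0 + B * h0 ->
       P a c h) ->
  P a0 c0 h0.
Proof.
move=> h00 quarter local; apply: contrapT => nP0.
pose good (p q : R * R * R) := [/\ 0 < p.2 -> ~ P p.1.1 p.1.2 p.2 -> ~ P q.1.1 q.1.2 q.2,
  q.2 = p.2 / 2, (0 < p.2 -> p.1.1 <= q.1.1 /\ q.1.1 + A * q.2 <= p.1.1 + A * p.2) &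
  (0 < p.2 -> p.1.2 <= q.1.2 /\ q.1.2 + B * q.2 <= p.1.2 + B * p.2)].
have step p : {q | good p q}.
  apply: cid; case: p => [[a c] h]; rewrite /good /=.
  have [h1|h1] := ltP 0 h; last first.
    by exists (a, c, h / 2); split => //=; move=> h2; exfalso; move: h2; rewrite ltNge h1.
  have mA : 0 <= A * (h / 2) by rewrite mulr_ge0 // divr_ge0 // ltW.
  have mB : 0 <= B * (h / 2) by rewrite mulr_ge0 // divr_ge0 // ltW.
  have hA : A * h = A * (h / 2) + A * (h / 2) by field.
  have hB : B * h = B * (h / 2) + B * (h / 2) by field.
  have [PP|nP] := pselect (P a c h).
    by exists (a, c, h / 2); split => //=; rewrite ?hA ?hB; split; lra.
  have [P1|n1] := pselect (P a c (h / 2)); last first.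
    by exists (a, c, h / 2); split => //=; rewrite ?hA ?hB; split; lra.
  have [P2|n2] := pselect (P (a + A * (h / 2)) c (h / 2)); last first.
    by exists (a + A * (h / 2), c, h / 2); split => //=; rewrite ?hA ?hB; split; lra.
  have [P3|n3] := pselect (P a (c + B * (h / 2)) (h / 2)); last first.
    by exists (a, c + B * (h / 2), h / 2); split => //=; rewrite ?hA ?hB; split; lra.
  exists (a + A * (h / 2), c + B * (h / 2), h / 2).
  split => //=; try (by rewrite ?hA ?hB; split; lra).
  by move=> _ _ P4; apply: nP; exact: quarter.
pose q n := iter n (fun p => sval (step p)) (a0, c0, h0).
have gq n : good (q n) (q n.+1) by rewrite /q iterS; case: (step _).
have qh n : (q n).2 = h0 / 2 ^+ n.
  elim: n => [|n IH]; first by rewrite expr0 divr1.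
  by have [_ -> _ _] := gq n; rewrite IH exprS invfM mulrA mulrAC.
have qh0 n : 0 < (q n).2 by rewrite qh divr_gt0 // exprn_gt0.
have nP n : ~ P (q n).1.1 (q n).1.2 (q n).2.
  by elim: n => [//|n IH]; have [H _ _ _] := gq n; exact: H.
have mA n : 0 <= A * (q n).2 by rewrite mulr_ge0 // ltW.
have mB n : 0 <= B * (q n).2 by rewrite mulr_ge0 // ltW.
have [x xq] : exists x, forall n, (q n).1.1 <= x <= (q n).1.1 + A * (q n).2.
  apply: nested_sup => n; last by rewrite lerDl.
    by have [_ _ H _] := gq n; have [] := H (qh0 n).
  by have [_ _ H _] := gq n; have [] := H (qh0 n).
have [y yq] : exists y, forall n, (q n).1.2 <= y <= (q n).1.2 + B * (q n).2.
  apply: nested_sup => n; last by rewrite lerDl.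
    by have [_ _ _ H] := gq n; have [] := H (qh0 n).
  by have [_ _ _ H] := gq n; have [] := H (qh0 n).
have inA n : a0 <= (q n).1.1 /\ (q n).1.1 + A * (q n).2 <= a0 + A * h0.
  elim: n => [//|n [I1 I2]]; have [_ _ H _] := gq n; have [J1 J2] := H (qh0 n).
  by split; [exact: le_trans J1 | exact: le_trans I2].
have inB n : c0 <= (q n).1.2 /\ (q n).1.2 + B * (q n).2 <= c0 + B * h0.
  elim: n => [//|n [I1 I2]]; have [_ _ _ H] := gq n; have [J1 J2] := H (qh0 n).
  by split; [exact: le_trans J1 | exact: le_trans I2].
have [d d0 Hd] := local x y (xq 0%N) (yq 0%N).
have [n nd] := half_powers_small h0 d0.
have [a1 a2] := inA n; have [b1 b2] := inB n.
by apply: (nP n); apply: Hd => //; rewrite qh0 qh.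
Qed.

End CousinCells.

Section RealVariable.
Variable R : realType.
Local Notation C := R[i].
Local Notation "x %:C" := (real_complex R x) : ring_scope.

(** The mean value theorem for [u] minus a primitive of the affine function. *)
Lemma affine_mean_value (u u' : R -> R) (a b x0 k0 k1 e : R) : a <= b ->
  (forall x, a <= x <= b -> is_derive x 1 u (u' x)) ->
  (forall x, a <= x <= b -> `|u' x - (k0 + k1 * (x - x0))| <= e) ->
  `|u b - u a - (k0 * (b - a) + k1 * ((b - x0) ^+ 2 - (a - x0) ^+ 2) / 2)| <= e * (b - a).
Proof.
move=> ab du u'e; pose q := k0%:P * 'X + (k1 / 2)%:P * ('X - x0%:P) ^+ 2.
have qE x : q.[x] = k0 * x + k1 / 2 * (x - x0) ^+ 2 by rewrite !hornerE.
pose w := u - horner q.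
have dw x : a <= x <= b -> is_derive x 1 w (u' x - (k0 + k1 * (x - x0))).
  move=> xab; have dux := du x xab.
  apply: (is_derive_eq (is_deriveB dux (is_derive_poly q x))); congr (_ - _).
  by rewrite /q !poly.derivE !hornerE /=; field.
have wE x : w x = u x - q.[x] by [].
have [||c cab wba] := @MVT_segment R w (fun x => u' x - (k0 + k1 * (x - x0))) a b ab.
- by move=> x /[!in_itv]/= /andP[/ltW ax /ltW xb]; apply: dw; rewrite ax.
- apply: derivable_within_continuous => x /[!in_itv]/= xab.
  by case: (dw x xab).
have -> : u b - u a - (k0 * (b - a) + k1 * ((b - x0) ^+ 2 - (a - x0) ^+ 2) / 2) = w b - w a.
  by rewrite !wE !qE; field.
rewrite wba normrM (ger0_norm (_ : 0 <= b - a)) ?subr_ge0 //.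
apply: ler_wpM2r; rewrite ?subr_ge0 //; apply: u'e.
by move: cab; rewrite in_itv.
Qed.

(** Differentiability of a complex function of a real variable, by components. *)
Definition cder (U : R -> C) (x : R) (v : C) :=
  is_derive x 1 (fun y => complex.Re (U y)) (complex.Re v) /\
  is_derive x 1 (fun y => complex.Im (U y)) (complex.Im v).

(** The factor [2] is the price of treating the two components separately. *)
Lemma complex_affine_mean_value (U U' : R -> C) (a b x0 : R) (k0 k1 : C) (e : R) : a <= b ->
  (forall x, a <= x <= b -> cder U x (U' x)) ->
  (forall x, a <= x <= b -> cnorm (U' x - (k0 + k1 * (x - x0)%:C)) <= e) ->
  cnorm (U b - U a - (k0 * (b - a)%:C + k1 * (((b - x0) ^+ 2 - (a - x0) ^+ 2) / 2)%:C))
    <= 2 * e * (b - a).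
Proof.
move=> ab dU U'e; case: k0 k1 U'e => [p0 q0] [p1 q1] U'e.
have /= H1 := @affine_mean_value (fun y => complex.Re (U y)) (fun y => complex.Re (U' y))
    a b x0 p0 p1 e ab (fun x xab => proj1 (dU x xab)).
have /= H2 := @affine_mean_value (fun y => complex.Im (U y)) (fun y => complex.Im (U' y))
    a b x0 q0 q1 e ab (fun x xab => proj2 (dU x xab)).
have {}H1 : `|complex.Re (U b) - complex.Re (U a) -
    (p0 * (b - a) + p1 * ((b - x0) ^+ 2 - (a - x0) ^+ 2) / 2)| <= e * (b - a).
  apply: H1 => x xab; apply: le_trans (U'e x xab).
  have := Re_le_cnorm (U' x - ((p0 +i* q0)%C + (p1 +i* q1)%C * (x - x0)%:C)).
  by apply: le_trans; case: (U' x) => ? ? /=; rewrite mulr0 subr0.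
have {}H2 : `|complex.Im (U b) - complex.Im (U a) -
    (q0 * (b - a) + q1 * ((b - x0) ^+ 2 - (a - x0) ^+ 2) / 2)| <= e * (b - a).
  apply: H2 => x xab; apply: le_trans (U'e x xab).
  have := Im_le_cnorm (U' x - ((p0 +i* q0)%C + (p1 +i* q1)%C * (x - x0)%:C)).
  by apply: le_trans; case: (U' x) => ? ? /=; rewrite mulr0 add0r.
have -> : 2 * e * (b - a) = e * (b - a) + e * (b - a) by ring.
rewrite (le_trans (cnorm_ReIm _)) //; apply: lerD.
  move: H1; case: (U b) (U a) => [? ?] [? ?] /=.
  by rewrite !mulr0 !subr0 mulrA.
move: H2; case: (U b) (U a) => [? ?] [? ?] /=.
by rewrite !mulr0 !add0r mulrA.
Qed.

End RealVariable.

Section Primitives.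
Variable R : realType.
Local Notation C := R[i].

(** The integral is only used through this lemma; the means below are differences of
    primitives. *)
Lemma continuous_primitive (u : R -> R) (A B : R) :
  (forall x, A <= x <= B -> {for x, continuous u}) ->
  exists P : R -> R, forall x, A < x < B -> is_derive x 1 P (u x).
Proof.
move=> cu.
pose P x : R := (\int[lebesgue_measure]_(t in [set` `[A, x]]) (u t))%R.
exists P => x /andP[Ax xB].
have iu : lebesgue_measure.-integrable `[A, B] (EFin \o u).
  apply: continuous_compact_integrable; first exact: segment_compact.
  apply: continuous_in_subspaceT => y; rewrite inE /= in_itv /= => yAB.
  exact: cu.
have ux : {for x, continuous u} by apply: cu; rewrite !ltW.
have [dP PE] := continuous_FTC1_closed xB iu Ax ux.
by rewrite -PE derive1E; exact: derivableP.
Qed.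

Definition econt (U : R -> C) (x : R) :=
  forall e, 0 < e -> exists2 d, 0 < d & forall y, `|y - x| < d -> cnorm (U y - U x) < e.

Lemma econt_Re U x : econt U x -> {for x, continuous (fun y => complex.Re (U y))}.
Proof.
move=> cU; apply/cvgrPdist_lt => e e0; have [d d0 Hd] := cU e e0.
have := @nbhsx_ballx _ _ x d d0; apply: filterS => y /=.
rewrite -ball_normE /ball_ /= distrC => /Hd; apply: le_lt_trans.
by have := Re_le_cnorm (U x - U y); rewrite cnorm_distC; case: (U x) (U y) => [? ?] [? ?].
Qed.

Lemma econt_Im U x : econt U x -> {for x, continuous (fun y => complex.Im (U y))}.
Proof.
move=> cU; apply/cvgrPdist_lt => e e0; have [d d0 Hd] := cU e e0.
have := @nbhsx_ballx _ _ x d d0; apply: filterS => y /=.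
rewrite -ball_normE /ball_ /= distrC => /Hd; apply: le_lt_trans.
by have := Im_le_cnorm (U x - U y); rewrite cnorm_distC; case: (U x) (U y) => [? ?] [? ?].
Qed.

Lemma complex_primitive (U : R -> C) (A B : R) :
  (forall x, A <= x <= B -> econt U x) ->
  exists P : R -> C, forall x, A < x < B -> cder P x (U x).
Proof.
move=> cU.
have [P HP] := @continuous_primitive (fun y => complex.Re (U y)) A B
  (fun x xAB => econt_Re (cU x xAB)).
have [Q HQ] := @continuous_primitive (fun y => complex.Im (U y)) A B
  (fun x xAB => econt_Im (cU x xAB)).
by exists (fun x => (P x +i* Q x)%C) => x xAB; split; [exact: HP | exact: HQ].
Qed.

End Primitives.

Section Goursat.
Variable R : realType.
Local Notation C := R[i].
Local Notation "x %:C" := (real_complex R x) : ring_scope.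
Local Notation i := ('i%C : C).
Variables (G U V : R -> R -> C) (a0 c0 A B : R).
Hypotheses (A0 : 0 <= A) (B0 : 0 <= B).
Hypothesis dU : forall s t, a0 <= s <= a0 + A -> c0 <= t <= c0 + B -> cder (U s) t (G s t).
Hypothesis dV : forall s t, a0 <= s <= a0 + A -> c0 <= t <= c0 + B -> cder (V t) s (G s t).
Hypothesis dG : forall s t, a0 <= s <= a0 + A -> c0 <= t <= c0 + B ->
  exists D : C, forall e, 0 < e -> exists2 d, 0 < d & forall s' t',
    a0 <= s' <= a0 + A -> c0 <= t' <= c0 + B -> `|s' - s| < d -> `|t' - t| < d ->
    cnorm (G s' t' - (G s t + D * ((s' - s)%:C + i * (t' - t)%:C))) <=
      e * (`|s' - s| + `|t' - t|).

Let mu a c h : C := (V c (a + A * h) - V c a) - (V (c + B * h) (a + A * h) - V (c + B * h) a) +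
  i * ((U (a + A * h) (c + B * h) - U (a + A * h) c) - (U a (c + B * h) - U a c)).

Let mu_quarter a c h : mu a c h = mu a c (h / 2) + mu (a + A * (h / 2)) c (h / 2) +
  (mu a (c + B * (h / 2)) (h / 2) + mu (a + A * (h / 2)) (c + B * (h / 2)) (h / 2)).
Proof.
have hA : a + A * (h / 2) + A * (h / 2) = a + A * h by field.
have hB : c + B * (h / 2) + B * (h / 2) = c + B * h by field.
by rewrite /mu hA hB; ring.
Qed.

Let cnorm_i : cnorm i = 1.
Proof. by rewrite /= expr0n expr1n add0r sqrtr1. Qed.

Let mu_small e : 0 < e -> cnorm (mu a0 c0 1) <= 4 * e * (A + B) ^+ 2 * 1 ^+ 2.
Proof.
move=> e0; pose P a c h := cnorm (mu a c h) <= 4 * e * (A + B) ^+ 2 * h ^+ 2.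
apply: (@cousin_cells _ A B A0 B0 P) => // [a c h h0 P1 P2 P3 P4|x y xA yB].
  rewrite /P mu_quarter.
  have -> : 4 * e * (A + B) ^+ 2 * h ^+ 2 = 4 * e * (A + B) ^+ 2 * (h / 2) ^+ 2 +
    4 * e * (A + B) ^+ 2 * (h / 2) ^+ 2 + (4 * e * (A + B) ^+ 2 * (h / 2) ^+ 2 +
    4 * e * (A + B) ^+ 2 * (h / 2) ^+ 2) by field.
  by apply: le_trans (cnormD _ _) _; apply: lerD;
    apply: le_trans (cnormD _ _) _; apply: lerD.
rewrite !mulr1 in xA yB.
have [D HD] := dG xA yB; have [d d0 Hd] := HD e e0.
(* a cell of size h has sides A h and B h, both less than d for such h *)
exists (d / (A + B + 1)); first by rewrite divr_gt0 //; lra.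
move=> a c h /andP[h0]; rewrite !mulr1 ltr_pdivlMr; last by lra.
move=> hd ax cy a0a aA c0c cB.
have Ah : 0 <= A * h by rewrite mulr_ge0 // ltW.
have Bh : 0 <= B * h by rewrite mulr_ge0 // ltW.
have hdE : h * (A + B + 1) = A * h + B * h + h by ring.
have near_G s t : a <= s <= a + A * h -> c <= t <= c + B * h ->
    cnorm (G s t - (G x y + D * ((s - x)%:C + i * (t - y)%:C))) <= e * ((A + B) * h).
  move=> sa tc; have sx : `|s - x| <= A * h by rewrite ler_norml; apply/andP; split; lra.
  have ty : `|t - y| <= B * h by rewrite ler_norml; apply/andP; split; lra.
  apply: le_trans (Hd s t _ _ _ _) _.
  - by apply/andP; split; lra.
  - by apply/andP; split; lra.
  - by apply: le_lt_trans sx _; lra.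
  - by apply: le_lt_trans ty _; lra.
  by apply: ler_wpM2l; [exact: ltW | rewrite mulrDl; exact: lerD].
have horiz t : c <= t <= c + B * h ->
    cnorm (V t (a + A * h) - V t a - ((G x y + D * (i * (t - y)%:C)) * (A * h)%:C +
      D * (((a + A * h - x) ^+ 2 - (a - x) ^+ 2) / 2)%:C)) <= 2 * (e * ((A + B) * h)) * (A * h).
  move=> tc; have aAh : a <= a + A * h by rewrite lerDl.
  have := @complex_affine_mean_value R (V t) (G^~ t) a (a + A * h) x
    (G x y + D * (i * (t - y)%:C)) D (e * ((A + B) * h)) aAh.
  have -> : a + A * h - a = A * h by ring.
  apply=> s sa; first by apply: dV; apply/andP; split; lra.
  by have := near_G s t sa tc; rewrite mulrDr addrA addrAC.
have vert s : a <= s <= a + A * h ->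
    cnorm (U s (c + B * h) - U s c - ((G x y + D * (s - x)%:C) * (B * h)%:C +
      (D * i) * (((c + B * h - y) ^+ 2 - (c - y) ^+ 2) / 2)%:C)) <= 2 * (e * ((A + B) * h)) * (B * h).
  move=> sa; have cBh : c <= c + B * h by rewrite lerDl.
  have := @complex_affine_mean_value R (U s) (G s) c (c + B * h) y
    (G x y + D * (s - x)%:C) (D * i) (e * ((A + B) * h)) cBh.
  have -> : c + B * h - c = B * h by ring.
  apply=> t tc; first by apply: dU; apply/andP; split; lra.
  by have := near_G s t sa tc; rewrite mulrDr addrA mulrA.
have cc : c <= c <= c + B * h by rewrite lexx lerDl.
have cB' : c <= c + B * h <= c + B * h by rewrite lexx lerDl Bh.
have aa : a <= a <= a + A * h by rewrite lexx lerDl.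
have aA' : a <= a + A * h <= a + A * h by rewrite lexx lerDl Ah.
have H1 := horiz c cc; have H2 := horiz (c + B * h) cB'.
have V1 := vert a aa; have V2 := vert (a + A * h) aA'.
move: H1 H2 V1 V2; rewrite /P.
set h1 := (X in cnorm X <= _ -> _); set h2 := (X in _ -> cnorm X <= _ -> _).
set v1 := (X in _ -> _ -> cnorm X <= _ -> _).
set v2 := (X in _ -> _ -> _ -> cnorm X <= _ -> _) => H1 H2 V1 V2.
(* the affine parts cancel along the boundary *)
have -> : mu a c h = (h1 - h2) + i * (v2 - v1).
  rewrite /mu /h1 /h2 /v1 /v2 !(rmorphB, rmorphD) /=.
  by ring.
apply: le_trans (cnormD _ _) _.
have -> : 4 * e * (A + B) ^+ 2 * h ^+ 2 =
   (2 * (e * ((A + B) * h)) * (A * h) + 2 * (e * ((A + B) * h)) * (A * h)) +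
   (2 * (e * ((A + B) * h)) * (B * h) + 2 * (e * ((A + B) * h)) * (B * h)) by ring.
rewrite cnormM cnorm_i mul1r; apply: lerD.
  by apply: le_trans (cnormB _ _) _; apply: lerD.
by apply: le_trans (cnormB _ _) _; apply: lerD.
Qed.

(** [U] and [V] are primitives along the sides, so that the left side is the integral
    of [G] over the boundary of a rectangle.  This integral is additive over the
    quarters of a cell.  Near a point, [G] is affine up to [e] times the distance, and
    affine functions have integral zero, so that small cells have an integral of at most
    a multiple of [e] times their area.  By [cousin_cells] the same bound holds for the
    rectangle. *)
Lemma goursat_rectangle : (V c0 (a0 + A) - V c0 a0) - (V (c0 + B) (a0 + A) - V (c0 + B) a0) +
  i * ((U (a0 + A) (c0 + B) - U (a0 + A) c0) - (U a0 (c0 + B) - U a0 c0)) = 0.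
Proof.
have := @mu_small; rewrite /mu !mulr1 => H; apply: cnorm_eq0P => e e0.
have K0 : 0 < 4 * (A + B) ^+ 2 + 1 by have := sqr_ge0 (A + B); lra.
have := H (e / (4 * (A + B) ^+ 2 + 1)); rewrite divr_gt0 // => /(_ isT) /le_trans; apply.
have -> : 4 * (e / (4 * (A + B) ^+ 2 + 1)) * (A + B) ^+ 2 * 1 ^+ 2 =
  e * (4 * (A + B) ^+ 2) / (4 * (A + B) ^+ 2 + 1) by field; rewrite gt_eqF.
by rewrite ler_pdivrMr // ler_pM2l // lerDl.
Qed.

End Goursat.

(** * Means over circles *)

Section Cder.
Variable R : realType.
Local Notation C := R[i].
Local Notation "x %:C" := (real_complex R x) : ring_scope.

Lemma Re_add (z w : C) : complex.Re (z + w) = complex.Re z + complex.Re w.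
Proof. by case: z w => [? ?] [? ?]. Qed.
Lemma Im_add (z w : C) : complex.Im (z + w) = complex.Im z + complex.Im w.
Proof. by case: z w => [? ?] [? ?]. Qed.
Lemma Re_mul (z w : C) : complex.Re (z * w) =
  complex.Re z * complex.Re w - complex.Im z * complex.Im w.
Proof. by case: z w => [? ?] [? ?]. Qed.
Lemma Im_mul (z w : C) : complex.Im (z * w) =
  complex.Re z * complex.Im w + complex.Im z * complex.Re w.
Proof. by case: z w => [? ?] [? ?]. Qed.

Lemma cderD (U V : R -> C) x u v : cder U x u -> cder V x v ->
  cder (fun y => U y + V y) x (u + v).
Proof.
move=> [U1 U2] [V1 V2]; split.
  rewrite Re_add (_ : (fun y => _) = (fun y => complex.Re (U y)) + (fun y => complex.Re (V y))).
    exact: is_deriveD.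
  by apply/funext => y; rewrite Re_add.
rewrite Im_add (_ : (fun y => _) = (fun y => complex.Im (U y)) + (fun y => complex.Im (V y))).
  exact: is_deriveD.
by apply/funext => y; rewrite Im_add.
Qed.

Lemma cderZ (U : R -> C) (k : C) x u : cder U x u -> cder (fun y => k * U y) x (k * u).
Proof.
move=> [U1 U2]; split.
  rewrite Re_mul (_ : (fun y => _) = (complex.Re k \*: (fun y => complex.Re (U y))) -
     (complex.Im k \*: (fun y => complex.Im (U y)))).
    by apply: is_deriveB; apply: is_deriveZ.
  by apply/funext => y; rewrite Re_mul.
rewrite Im_mul (_ : (fun y => _) = (complex.Re k \*: (fun y => complex.Im (U y))) +
     (complex.Im k \*: (fun y => complex.Re (U y)))).
  by apply: is_deriveD; apply: is_deriveZ.
by apply/funext => y; rewrite Im_mul.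
Qed.

Lemma cder_conj (U : R -> C) x u : cder U x u -> cder (fun y => (U y)^*) x u^*.
Proof.
have cRe (z : C) : complex.Re z^* = complex.Re z by case: z.
have cIm (z : C) : complex.Im z^* = - complex.Im z by case: z.
move=> [U1 U2]; split.
  by rewrite cRe (_ : (fun y => _) = (fun y => complex.Re (U y))) //; apply/funext => y.
rewrite cIm (_ : (fun y => _) = - (fun y => complex.Im (U y))); first exact: is_deriveN.
by apply/funext => y; rewrite cIm.
Qed.

Lemma cder_cst (k : C) x : cder (fun y => k * y%:C) x k.
Proof.
have := @cderZ (fun y => y%:C) k x 1; rewrite mulr1; apply; split => /=.
  exact: is_derive_id.
exact: is_derive_cst.
Qed.

Lemma cder_unique (U V U' : R -> C) a b : a <= b ->
  (forall x, a <= x <= b -> cder U x (U' x)) -> (forall x, a <= x <= b -> cder V x (U' x)) ->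
  U b - U a = V b - V a.
Proof.
move=> ab dU dV; apply/eqP; rewrite -subr_eq0; apply/eqP; apply: cnorm_eq0P => e e0.
have := @complex_affine_mean_value R (fun y => U y + (-1) * V y)
  (fun x => U' x + (-1) * U' x) a b 0 0 0 0 ab.
rewrite !mul0r addr0 subr0 mulr0 mul0r !mulN1r => H.
apply: (@le_trans _ _ 0); last exact: ltW.
rewrite (_ : U b - U a - (V b - V a) = U b - V b - (U a - V a)); last by ring.
apply: H => x xab.
  by apply: cderD; [exact: dU | apply: cderZ; exact: dV].
by rewrite mulN1r !mul0r addr0 subr0 subrr Normc.normc0.
Qed.

(** The complex mean value inequality with a variable bound. *)
Lemma cder_le (U U' : R -> C) (p p' : R -> R) a b : a <= b ->
  (forall x, a <= x <= b -> cder U x (U' x)) ->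
  (forall x, a <= x <= b -> is_derive x 1 p (p' x)) ->
  (forall x, a <= x <= b -> cnorm (U' x) <= p' x) ->
  cnorm (U b - U a) <= 2 * (p b - p a).
Proof.
move=> ab dU dp Up.
have real_le (u u' : R -> R) : (forall x, a <= x <= b -> is_derive x 1 u (u' x)) ->
    (forall x, a <= x <= b -> u' x <= p' x) -> u b - u a <= p b - p a.
  move=> du up.
  have dw x : a <= x <= b -> is_derive x 1 (p - u) (p' x - u' x).
    by move=> xab; apply: is_deriveB; [exact: dp | exact: du].
  have [||c cab E] := @MVT_segment R (p - u) (fun x => p' x - u' x) a b ab.
  - by move=> x /[!in_itv]/= /andP[/ltW ax /ltW xb]; apply: dw; rewrite ax.
  - apply: derivable_within_continuous => x /[!in_itv]/= xab.
    by case: (dw x xab).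
  have : 0 <= (p - u) b - (p - u) a.
    rewrite E mulr_ge0 ?subr_ge0 //; apply: up; by move: cab; rewrite in_itv.
  have -> : (p - u) b - (p - u) a = p b - u b - (p a - u a) by [].
  lra.
have neg (u u' : R -> R) : (forall x, a <= x <= b -> is_derive x 1 u (u' x)) ->
    (forall x, a <= x <= b -> `|u' x| <= p' x) -> `|u b - u a| <= p b - p a.
  move=> du up; rewrite ler_norml; apply/andP; split.
    have := @real_le (- u) (fun x => - u' x).
    have E : (- u) b - (- u) a = - (u b - u a) by rewrite opprB addrC [in LHS]opprK.
    rewrite E lerNl; apply=> x xab; first by apply: is_deriveN; exact: du.
    by apply: le_trans (up x xab); rewrite -normrN ler_norm.
  by apply: real_le du _ => x xab; apply: le_trans (up x xab); exact: ler_norm.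
apply: le_trans (cnorm_ReIm _) _; rewrite mulr_natl mulr2n; apply: lerD.
  have := neg (fun y => complex.Re (U y)) (fun y => complex.Re (U' y)).
  case: (U b) (U a) => [? ?] [? ?] /=; apply=> x xab; first by have [] := dU x xab.
  exact: le_trans (Re_le_cnorm _) (Up x xab).
have := neg (fun y => complex.Im (U y)) (fun y => complex.Im (U' y)).
case: (U b) (U a) => [? ?] [? ?] /=; apply=> x xab; first by have [] := dU x xab.
exact: le_trans (Im_le_cnorm _) (Up x xab).
Qed.

End Cder.

Section DerivativeEpsilon.

(** Stated for every [numFieldType], to be used for real and for complex derivatives. *)
Lemma derivative_eps (K : numFieldType) (f : K -> K) (x f' : K) : is_derive x 1 f f' ->
  forall e, 0 < e -> exists2 d, 0 < d & forall h, `|h| < d ->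
    `|f (x + h) - f x - f' * h| <= e * `|h|.
Proof.
move=> df e e0; have : h^-1 *: ((f \o shift x) (h *: 1) - f x) @[h --> 0^'] --> f'.
  have E : 'D_1 f x = f' by exact: derive_val.
  by rewrite -E; exact: (@ex_derive _ _ _ _ _ _ _ df).
move=> /cvgrPdist_lt /(_ e e0); rewrite near_withinE => /nbhs_ballP[d /= d0 Hd].
exists d => // h hd; have [->|h0] := eqVneq h 0.
  by rewrite addr0 subrr mulr0 subr0 normr0 mulr0.
have := Hd h; rewrite -ball_normE /ball_ /= sub0r normrN => /(_ hd h0) /ltW.
rewrite /GRing.scale /= mulr1 [h + x]addrC => H.
have -> : f (x + h) - f x - f' * h = h * (h^-1 * (f (x + h) - f x) - f') by field.
by rewrite normrM mulrC; apply: ler_wpM2r => //; rewrite distrC.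
Qed.

Variable R : realType.
Local Notation C := R[i].
Local Notation "x %:C" := (real_complex R x) : ring_scope.

Lemma complex_derivative_eps (f : C -> C) (z : C) : derivable f z 1 ->
  exists D : C, forall e : R, 0 < e -> exists2 d : R, 0 < d & forall w,
    cnorm (w - z) < d -> cnorm (f w - f z - D * (w - z)) <= e * cnorm (w - z).
Proof.
move=> df; exists ('D_1 f z) => e e0.
have eC0 : 0 < e%:C by rewrite -(rmorph0 (real_complex R)) ltcR.
have [d d0 Hd] := derivative_eps (derivableP df) eC0.
have /complex_realP [d' dE] := gtr0_real d0.
exists d'; first by rewrite -ltcR rmorph0 -dE.
move=> w wd; have := Hd (w - z); rewrite dE -!normc_normE ltcR -rmorphM lecR.
by rewrite [z + _]addrC subrK; apply.
Qed.

End DerivativeEpsilon.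

Section Cis.
Variable R : realType.
Local Notation C := R[i].
Local Notation "x %:C" := (real_complex R x) : ring_scope.
Local Notation i := ('i%C : C).

Definition cis (t : R) : C := (cos t +i* sin t)%C.
(** The exponential of [s + i t]: logarithmic polar coordinates. *)
Definition cexp (s t : R) : C := (expR s)%:C * cis t.

Lemma cisD a b : cis (a + b) = cis a * cis b.
Proof.
apply/eqP; rewrite eq_complex /= cosD sinD eqxx /=; apply/eqP; ring.
Qed.

Lemma cnorm_cis t : cnorm (cis t) = 1.
Proof. by rewrite /= cos2Dsin2 sqrtr1. Qed.

Lemma cis2pi : cis (pi *+ 2) = 1.
Proof. by rewrite /cis cos2pi sin2pi. Qed.

Lemma cis_neq0 t : cis t != 0.
Proof.
by apply/eqP => H; have := cnorm_cis t; rewrite H Normc.normc0 => /esym/eqP; rewrite oner_eq0.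
Qed.

Lemma cis_conj t : (cis t)^* = (cis t)^-1.
Proof.
apply: (mulfI (cis_neq0 t)); rewrite mulfV ?cis_neq0 //.
by rewrite -normCK -normc_normE cnorm_cis rmorph1 expr1n.
Qed.

Lemma cnorm_cexp s t : cnorm (cexp s t) = expR s.
Proof. by rewrite cnormM cnorm_cis mulr1 cnormR ger0_norm // expR_ge0. Qed.

Lemma cexpD s t s' t' : cexp (s + s') (t + t') = cexp s t * cexp s' t'.
Proof. by rewrite /cexp expRD cisD rmorphM mulrACA. Qed.

Lemma cexp_origin_eps e : 0 < e -> exists2 d, 0 < d & forall s t : R, `|s| < d -> `|t| < d ->
  cnorm (cexp s t - 1 - (s%:C + i * t%:C)) <= e * (`|s| + `|t|).
Proof.
move=> e0; pose e1 := Num.min (e / 6) 1.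
have e10 : 0 < e1 by rewrite lt_min ltr01 andbT; lra.
have e11 : e1 <= 1 by rewrite ge_min lexx orbT.
have e16 : e1 <= e / 6 by rewrite ge_min lexx.
have [d1 d10 H1] := derivative_eps (is_derive_expR 0) e10.
have [d2 d20 H2] := derivative_eps (is_derive_cos 0) e10.
have [d3 d30 H3] := derivative_eps (is_derive_sin 0) e10.
exists (Num.min (Num.min d1 d2) (Num.min d3 (e1 / 2))).
  by rewrite !lt_min d10 d20 d30 /=; lra.
move=> s t; rewrite !lt_min => /andP[/andP[s1 _] /andP[_ s4]] /andP[/andP[_ t2] /andP[t3 _]].
have {}H1 := H1 s s1; have {}H2 := H2 t t2; have {}H3 := H3 t t3.
rewrite add0r expR0 mul1r in H1.
rewrite add0r cos0 sin0 oppr0 mul0r subr0 in H2.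
rewrite add0r cos0 sin0 mul1r subr0 in H3.
have s0 := normr_ge0 s; have t0 := normr_ge0 t.
have -> : cexp s t - 1 - (s%:C + i * t%:C) = (expR s)%:C * (cis t - 1 - i * t%:C) +
   ((expR s - 1)%:C * (i * t%:C) + (expR s - 1 - s)%:C).
  by rewrite /cexp !rmorphB /=; ring.
have c1 : cnorm (cis t - 1 - i * t%:C) <= 2 * e1 * `|t|.
  apply: le_trans (cnorm_ReIm _) _; rewrite /=.
  have -> : cos t - 1 - (0 * t - 1 * 0) = cos t - 1 by ring.
  have -> : sin t - 0 - (0 * 0 + 1 * t) = sin t - t by ring.
  lra.
have ci : cnorm (i * t%:C) = `|t|.
  by rewrite cnormM cnormR /= expr0n expr1n add0r sqrtr1 mul1r.
have ex1 : `|expR s - 1| <= e1.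
  have -> : expR s - 1 = (expR s - 1 - s) + s by ring.
  apply: le_trans (ler_normD _ _) _; nra.
have ex2 : `|expR s| <= 2.
  have -> : expR s = (expR s - 1) + 1 by ring.
  by apply: le_trans (ler_normD _ _) _; rewrite normr1; lra.
apply: le_trans (cnormD _ _) _; rewrite cnormM cnormR.
apply: (@le_trans _ _ (2 * (2 * e1 * `|t|) + (e1 * `|t| + e1 * `|s|))); last by nra.
apply: lerD; first by apply: ler_pM => //; exact: cnorm_ge0.
apply: le_trans (cnormD _ _) _; rewrite cnormM !cnormR ci.
by apply: lerD => //; apply: ler_wpM2r.
Qed.

(** The chain rule for [g] composed with the exponential, in the form required by
    [goursat_rectangle]. *)
Lemma cexp_derivative_eps (g : C -> C) s t : derivable g (cexp s t) 1 ->
  exists D : C, forall e, 0 < e -> exists2 d, 0 < d & forall s' t',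
    `|s' - s| < d -> `|t' - t| < d ->
    cnorm (g (cexp s' t') - (g (cexp s t) + D * ((s' - s)%:C + i * (t' - t)%:C))) <=
      e * (`|s' - s| + `|t' - t|).
Proof.
move=> /complex_derivative_eps [D HD]; set z := cexp s t in HD *.
exists (D * z) => e e0; have nz := cnorm_ge0 z; have nD := cnorm_ge0 D.
have k0 : 0 < 2 * (cnorm z * 3 + 1) by lra.
have k1 : 0 < 2 * (cnorm D * cnorm z + 1) by have := mulr_ge0 nD nz; lra.
have [d1 d10 H1] := HD (e / (2 * (cnorm z * 3 + 1))) (divr_gt0 e0 k0).
pose e2 := Num.min 1 (e / (2 * (cnorm D * cnorm z + 1))).
have e20 : 0 < e2 by rewrite lt_min ltr01 divr_gt0.
have [d2 d20 H2] := cexp_origin_eps e20.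
pose d3 := d1 / (6 * (cnorm z + 1)).
have d30 : 0 < d3 by rewrite divr_gt0 //; lra.
exists (Num.min d2 d3); first by rewrite lt_min d20.
move=> s' t'; rewrite !lt_min => /andP[sd2 sd3] /andP[td2 td3].
set x := s' - s in sd2 sd3 *; set y := t' - t in td2 td3 *.
have x0 := normr_ge0 x; have y0 := normr_ge0 y.
have zE : cexp s' t' = z * cexp x y by rewrite /z -cexpD /x /y; congr cexp; ring.
have {}H2 := H2 x y sd2 td2; set r := cexp x y - 1 - (x%:C + i * y%:C) in H2.
have cxy : cnorm (x%:C + i * y%:C) <= `|x| + `|y|.
  apply: le_trans (cnormD _ _) _; rewrite cnormM !cnormR.
  by rewrite /= expr0n expr1n add0r sqrtr1 mul1r.
have e21 : e2 <= 1 by rewrite ge_min lexx.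
have e22 : e2 <= e / (2 * (cnorm D * cnorm z + 1)) by rewrite ge_min lexx orbT.
have wz : cexp s' t' - z = z * (x%:C + i * y%:C + r).
  by rewrite zE /r; ring.
have cw : cnorm (cexp s' t' - z) <= cnorm z * 3 * (`|x| + `|y|).
  rewrite wz cnormM -mulrA; apply: ler_wpM2l => //.
  apply: le_trans (cnormD _ _) _; nra.
have cwd : cnorm (cexp s' t' - z) < d1.
  apply: le_lt_trans cw _.
  have E : d3 * (6 * (cnorm z + 1)) = d1 by rewrite divfK // gt_eqF //; lra.
  nra.
have {}H1 := H1 _ cwd.
have -> : g (cexp s' t') - (g z + D * z * (x%:C + i * y%:C)) =
   (g (cexp s' t') - g z - D * (cexp s' t' - z)) + D * z * r by rewrite wz; ring.
apply: le_trans (cnormD _ _) _; rewrite (cnormM _ r) (cnormM D z).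
have b1 : cnorm (g (cexp s' t') - g z - D * (cexp s' t' - z)) <= e / 2 * (`|x| + `|y|).
  apply: le_trans H1 _.
  apply: (@le_trans _ _ (e / (2 * (cnorm z * 3 + 1)) * (cnorm z * 3 * (`|x| + `|y|)))).
    by apply: ler_wpM2l => //; rewrite ltW // divr_gt0.
  rewrite mulrA; apply: ler_wpM2r; first exact: addr_ge0.
  have -> : e / (2 * (cnorm z * 3 + 1)) * (cnorm z * 3) = e / 2 * ((cnorm z * 3) / (cnorm z * 3 + 1)).
    by field; rewrite gt_eqF //; lra.
  rewrite ler_piMr //; first lra.
  by rewrite ler_pdivrMr; lra.
have b2 : cnorm D * cnorm z * cnorm r <= e / 2 * (`|x| + `|y|).
  have Dz := mulr_ge0 nD nz.
  apply: (@le_trans _ _ (cnorm D * cnorm z * (e / (2 * (cnorm D * cnorm z + 1)) * (`|x| + `|y|)))).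
    apply: ler_wpM2l => //; apply: le_trans H2 _; apply: ler_wpM2r => //; exact: addr_ge0.
  rewrite mulrA; apply: ler_wpM2r; first exact: addr_ge0.
  have -> : cnorm D * cnorm z * (e / (2 * (cnorm D * cnorm z + 1))) =
     e / 2 * ((cnorm D * cnorm z) / (cnorm D * cnorm z + 1)).
    by field; rewrite gt_eqF //; lra.
  rewrite ler_piMr //; first lra.
  by rewrite ler_pdivrMr; lra.
by apply: le_trans (lerD b1 b2) _; rewrite le_eqVlt; apply/orP; left; apply/eqP; field.
Qed.

End Cis.

Section CircleMean.
Variable R : realType.
Local Notation C := R[i].
Local Notation "x %:C" := (real_complex R x) : ring_scope.
Local Notation T := ((pi : R) *+ 2).

Lemma period_gt0 : 0 < T.
Proof. by rewrite mulrn_wgt0 // pi_gt0. Qed.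

(** Chosen as a function of [h] alone, so that equal functions have equal primitives. *)
Definition primitive (A B : R) (h : R -> C) : R -> C :=
  xget (fun=> 0) [set P | forall x, A < x < B -> cder P x (h x)].

Lemma primitiveP A B h : (exists P : R -> C, forall x, A < x < B -> cder P x (h x)) ->
  forall x, A < x < B -> cder (primitive A B h) x (h x).
Proof.
move=> [P HP]; rewrite /primitive; case: xgetP => [y -> //|].
by move=> /(_ P) /(_ HP).
Qed.

(** The interval is a little longer than a period, so that primitives are
    differentiable at both ends of the period. *)
Definition circle_integrable (h : R -> C) :=
  exists P : R -> C, forall x, -1 < x < T + 1 -> cder P x (h x).

Definition mean (h : R -> C) : C :=
  (primitive (-1) (T + 1) h T - primitive (-1) (T + 1) h 0) / T%:C.

Lemma circle_itv x : 0 <= x <= T -> -1 < x < T + 1.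
Proof. by move=> /andP[x0 xT]; apply/andP; split; lra. Qed.

Lemma mean_eq h Q : (forall x, -1 < x < T + 1 -> cder Q x (h x)) ->
  mean h = (Q T - Q 0) / T%:C.
Proof.
move=> HQ; congr (_ / _); have hI : circle_integrable h by exists Q.
apply: (@cder_unique _ _ _ h); first exact/ltW/period_gt0.
  by move=> x /circle_itv; exact: primitiveP.
by move=> x /circle_itv; exact: HQ.
Qed.

Lemma circle_integrableD h k : circle_integrable h -> circle_integrable k ->
  circle_integrable (fun t => h t + k t).
Proof.
by move=> [P HP] [Q HQ]; exists (fun t => P t + Q t) => x xT; apply: cderD; [exact: HP|exact: HQ].
Qed.

Lemma circle_integrableZ a h : circle_integrable h -> circle_integrable (fun t => a * h t).
Proof. by move=> [P HP]; exists (fun t => a * P t) => x xT; apply: cderZ; exact: HP. Qed.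

Lemma circle_integrable_cst a : circle_integrable (fun=> a).
Proof. by exists (fun t => a * t%:C) => x xT; exact: cder_cst. Qed.

Lemma circle_integrable_sum I (r : seq I) (h : I -> R -> C) :
  (forall i, circle_integrable (h i)) -> circle_integrable (fun t => \sum_(i <- r) h i t).
Proof.
move=> hI; elim: r => [|i r IH].
  by rewrite (_ : (fun t => _) = (fun=> 0)); [exact: circle_integrable_cst|apply/funext => t; rewrite big_nil].
rewrite (_ : (fun t => _) = (fun t => h i t + \sum_(i <- r) h i t)).
  exact: circle_integrableD.
by apply/funext => t; rewrite big_cons.
Qed.

Lemma meanD h k : circle_integrable h -> circle_integrable k ->
  mean (fun t => h t + k t) = mean h + mean k.
Proof.
move=> [P HP] [Q HQ]; rewrite (mean_eq HP) (mean_eq HQ) (@mean_eq _ (fun t => P t + Q t)).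
  by rewrite -mulrDl; congr (_ / _); ring.
by move=> x xT; apply: cderD; [exact: HP|exact: HQ].
Qed.

Lemma meanZ a h : circle_integrable h -> mean (fun t => a * h t) = a * mean h.
Proof.
move=> [P HP]; rewrite (mean_eq HP) (@mean_eq _ (fun t => a * P t)).
  by rewrite mulrA mulrBr.
by move=> x xT; apply: cderZ; exact: HP.
Qed.

Lemma mean_cst a : mean (fun=> a) = a.
Proof.
rewrite (@mean_eq _ (fun t => a * t%:C)) => [|x _]; last exact: cder_cst.
rewrite rmorph0 mulr0 subr0 mulfK //.
by rewrite -(rmorph0 (real_complex R)) (inj_eq (@complexI R)) gt_eqF // period_gt0.
Qed.

Lemma mean_conj h : circle_integrable h -> mean (fun t => (h t)^*) = (mean h)^*.
Proof.
move=> [P HP]; rewrite (mean_eq HP) (@mean_eq _ (fun t => (P t)^*)).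
  rewrite rmorphM rmorphB /= fmorphV; congr (_ / _).
  by apply/esym/CrealP/complex_realP; exists T.
by move=> x xT; apply: cder_conj; exact: HP.
Qed.

Lemma mean_sum I (r : seq I) (h : I -> R -> C) : (forall i, circle_integrable (h i)) ->
  mean (fun t => \sum_(i <- r) h i t) = \sum_(i <- r) mean (h i).
Proof.
move=> hI; elim: r => [|i r IH].
  rewrite big_nil -[RHS](mean_cst 0); congr mean.
  by apply/funext => t; rewrite big_nil.
rewrite big_cons -IH -meanD //; last exact: circle_integrable_sum.
by congr mean; apply/funext => t; rewrite big_cons.
Qed.

(** The majorant [k] has real values, but is complex-valued for [mean]. *)
Lemma mean_le h k : circle_integrable h -> circle_integrable k ->
  (forall t, (cnorm (h t))%:C <= k t) -> cnorm (mean h) <= 2 * complex.Re (mean k).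
Proof.
move=> [P HP] [Q HQ] hk; rewrite (mean_eq HP) (mean_eq HQ).
have T0 := period_gt0.
have Tn : T != 0 by rewrite gt_eqF.
have TV : (T%:C)^-1 = (T^-1)%:C by rewrite fmorphV.
rewrite TV cnormM cnormR ger0_norm ?invr_ge0 ?(ltW T0) //.
have -> : complex.Re ((Q T - Q 0) * (T^-1)%:C) = (complex.Re (Q T) - complex.Re (Q 0)) / T.
  by case: (Q T) (Q 0) => [? ?] [? ?] /=; rewrite mulr0 subr0.
rewrite mulrA ler_pM2r ?invr_gt0 //.
apply: (@cder_le _ P h (fun y => complex.Re (Q y)) (fun y => complex.Re (k y))).
- exact: ltW.
- by move=> x /circle_itv; exact: HP.
- by move=> x /circle_itv /HQ [].
- by move=> x _; have := hk x; rewrite lecE /= => /andP[_].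
Qed.

Section PuncturedDisc.
Variable g : C -> C.
Hypothesis dg : forall z, 0 < cnorm z < 1 -> derivable g z 1.

Let dg' s t : s < 0 -> derivable g (cexp s t) 1.
Proof. by move=> s0; apply: dg; rewrite cnorm_cexp expR_gt0 expR_lt1. Qed.

Let econt_t s : s < 0 -> forall t, econt (fun t => g (cexp s t)) t.
Proof.
move=> s0 t e e0; have [D HD] := cexp_derivative_eps (@dg' _ t s0).
have [d d0 Hd] := HD 1 ltr01; have D0 := cnorm_ge0 D.
exists (Num.min d (e / (cnorm D + 2))); first by rewrite lt_min d0 divr_gt0 //; lra.
move=> t'; rewrite lt_min => /andP[td te].
have := Hd s t' _ td; rewrite subrr normr0 rmorph0 !add0r mul1r => /(_ d0) H.
have -> : g (cexp s t') - g (cexp s t) = g (cexp s t') - (g (cexp s t) + D * ('i%C * (t' - t)%:C)) +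
  D * ('i%C * (t' - t)%:C) by ring.
apply: le_lt_trans (cnormD _ _) _; rewrite !cnormM cnormR.
have -> : cnorm ('i%C : C) = 1 by rewrite /= expr0n expr1n add0r sqrtr1.
rewrite mul1r; move: te; rewrite ltr_pdivlMr; last lra.
by move: (normr_ge0 (t' - t)) => n0; nra.
Qed.

Let econt_s t s : s < 0 -> econt (fun s => g (cexp s t)) s.
Proof.
move=> s0 e e0; have [D HD] := cexp_derivative_eps (@dg' _ t s0).
have [d d0 Hd] := HD 1 ltr01; have D0 := cnorm_ge0 D.
exists (Num.min d (e / (cnorm D + 2))); first by rewrite lt_min d0 divr_gt0 //; lra.
move=> s'; rewrite lt_min => /andP[sd se].
have := Hd s' t sd; rewrite subrr normr0 rmorph0 mulr0 !addr0 mul1r => /(_ d0) H.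
have -> : g (cexp s' t) - g (cexp s t) = g (cexp s' t) - (g (cexp s t) + D * (s' - s)%:C) +
  D * (s' - s)%:C by ring.
apply: le_lt_trans (cnormD _ _) _; rewrite cnormM cnormR.
move: se; rewrite ltr_pdivlMr; last lra.
by move: (normr_ge0 (s' - s)) => n0; nra.
Qed.

Lemma circle_integrable_holomorphic s : s < 0 -> circle_integrable (fun t => g (cexp s t)).
Proof. by move=> s0; apply: complex_primitive => x _; exact: econt_t. Qed.

(** Goursat's theorem on the rectangle [[s1, s2] x [0, 2 pi]]: by periodicity the two
    sides in the direction of [s] cancel, and the two others are the two means. *)
Lemma mean_holomorphic_constant s1 s2 : s1 <= s2 -> s2 < 0 ->
  mean (fun t => g (cexp s1 t)) = mean (fun t => g (cexp s2 t)).
Proof.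
move=> s12 s20; have T0 := period_gt0; have s10 : s1 < 0 by exact: le_lt_trans s20.
pose V t := primitive (s1 - 1) (s2 / 2) (fun s => g (cexp s t)).
pose U s := primitive (-1) (T + 1) (fun t => g (cexp s t)).
have HV s t : s1 <= s <= s2 -> cder (V t) s (g (cexp s t)).
  move=> /andP[a b]; apply: primitiveP; last by apply/andP; split; lra.
  apply: complex_primitive => x /andP[_ xs].
  by apply: econt_s; lra.
have HU s t : s1 <= s <= s2 -> 0 <= t <= T -> cder (U s) t (g (cexp s t)).
  move=> /andP[a b] /circle_itv tT; apply: primitiveP => //.
  by apply: circle_integrable_holomorphic; lra.
have V2 : V T = V 0.
  rewrite /V; congr (primitive _ _ _); apply/funext => s.
  by rewrite -[T]add0r -[s in LHS]addr0 cexpD /cexp cis2pi expR0 rmorph1 !mulr1.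
have s12' : 0 <= s2 - s1 by rewrite subr_ge0.
have ss : s1 + (s2 - s1) = s2 by rewrite addrC subrK.
have := @goursat_rectangle R (fun s t => g (cexp s t)) U V s1 0 (s2 - s1) T s12' (ltW T0).
rewrite ss !add0r V2 subrr add0r => H.
have {}H := H (fun s t a b => HU s t a b) (fun s t a _ => HV s t a).
have /eqP : 'i%C * (U s2 T - U s2 0 - (U s1 T - U s1 0)) = 0.
  apply: H => s t /andP[_ st] _; have st0 : s < 0 by lra.
  have [D HD] := cexp_derivative_eps (@dg' _ t st0).
  by exists D => e e0; have [d d0 Hd] := HD e e0; exists d => // s' t' _ _; exact: Hd.
rewrite mulf_eq0 => /orP[/eqP/(congr1 (@complex.Im R))/= /eqP|]; first by rewrite oner_eq0.
by rewrite subr_eq0 => /eqP E; rewrite /mean -/(U s1) -/(U s2) E.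
Qed.

End PuncturedDisc.
End CircleMean.

(** * Fejer means of a function of the disc algebra *)

Section Fejer.
Variable R : realType.
Local Notation C := R[i].
Local Notation "x %:C" := (real_complex R x) : ring_scope.
Implicit Types f : C -> C.

Definition trig_monomial (j l : nat) (t : R) : C := cis t ^+ j * ((cis t)^*) ^+ l.

(** The Taylor coefficients of [f] at [0], computed on the circle of radius [1/e]. *)
Definition taylor_mean f (k : nat) : C :=
  mean (fun t => let z := cexp (-1) t in f z / z ^+ k).

Section Coefficients.
Variables (f : C -> C) (M : R).
Hypothesis df : forall z, cnorm z < 1 -> derivable f z 1.
Hypothesis fM : forall z, cnorm z < 1 -> cnorm (f z) <= M.

Let g j l (z : C) := f z * z ^+ j * (z ^+ l)^-1.

Let dg j l z : 0 < cnorm z < 1 -> derivable (g j l) z 1.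
Proof.
move=> /andP[z0 z1]; have zn : z != 0.
  by apply/eqP => E; move: z0; rewrite E Normc.normc0 ltxx.
have dX k : derivable (fun z : C => z ^+ k) z 1 by exact: exprn_derivable.
apply: derivableM; last by apply: derivableV => //; rewrite expf_neq0.
by apply: derivableM => //; exact: df.
Qed.

Let gE j l s t : trig_monomial j l t * f (cexp s t) =
  ((expR s) ^+ l / (expR s) ^+ j)%:C * g j l (cexp s t).
Proof.
have e0 : (expR s)%:C != 0.
  by rewrite -(rmorph0 (real_complex R)) (inj_eq (@complexI R)) gt_eqF // expR_gt0.
rewrite /g /trig_monomial cis_conj /cexp !exprMn invfM !rmorphM /= fmorphV !rmorphXn exprVn.
by field; rewrite !expf_neq0 // cis_neq0.
Qed.

Lemma trig_monomial_integrable j l s : s < 0 ->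
  circle_integrable (fun t => trig_monomial j l t * f (cexp s t)).
Proof.
move=> s0; rewrite (_ : (fun t => _) = (fun t => ((expR s) ^+ l / (expR s) ^+ j)%:C * g j l (cexp s t))).
  apply: circle_integrableZ; apply: circle_integrable_holomorphic => // z; exact: dg.
by apply/funext => t; rewrite gE.
Qed.

Let mean_g j l s : s < 0 -> (l < j)%N -> mean (fun t => g j l (cexp s t)) = 0.
Proof.
move=> s0 lj; apply: cnorm_eq0P => e e0.
have M0 : 0 <= M.
  by have := @fM 0; rewrite Normc.normc0 ltr01 => /(_ isT); apply: le_trans; exact: cnorm_ge0.
pose e1 := e / (2 * (M + 1)).
have e10 : 0 < e1 by rewrite divr_gt0 //; lra.
(* a circle so small that g is small on it *)
pose s' := Num.min s (ln e1).
have s's : s' <= s by rewrite ge_min lexx.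
have s'0 : s' < 0 by exact: le_lt_trans s0.
have re : expR s' <= e1.
  by rewrite -(lnK (x := e1)) ?posrE // ler_expR ge_min lexx orbT.
rewrite -(mean_holomorphic_constant (dg (j := j) (l := l)) s's s0).
have := @mean_le R (fun t => g j l (cexp s' t)) (fun=> (M * expR s')%:C) _ _ _.
rewrite mean_cst => H; apply: le_trans (H _ _ _) _.
- by apply: circle_integrable_holomorphic => // z; exact: dg.
- exact: circle_integrable_cst.
- move=> t; rewrite lecR /g -mulrA cnormM.
  have zn : cexp s' t != 0.
    by apply/eqP => E; have := expR_gt0 s'; rewrite -(cnorm_cexp s' t) E Normc.normc0 ltxx.
  have -> : cexp s' t ^+ j * (cexp s' t ^+ l)^-1 = cexp s' t * cexp s' t ^+ (j - l).-1.
    rewrite -exprS prednK ?subn_gt0 // -[in LHS](subnK (ltnW lj)) exprD mulfK //.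
    by rewrite expf_neq0.
  rewrite cnormM cnormX cnorm_cexp; apply: ler_pM => //.
  + exact: cnorm_ge0.
  + by apply: fM; rewrite cnorm_cexp expR_lt1.
  by rewrite ler_piMr ?expR_ge0 // exprn_ile1 ?expR_ge0 // ltW // expR_lt1.
rewrite /=; have : M * expR s' <= M * e1 by apply: ler_wpM2l.
have : M * e1 * 2 = e * (M / (M + 1)) by rewrite /e1; field; rewrite gt_eqF //; lra.
have : e * (M / (M + 1)) <= e.
  rewrite ler_piMr //; first exact: ltW.
  by rewrite ler_pdivrMr; lra.
lra.
Qed.

(** Up to a power of the radius, the integrand is [g(z) = f(z) z^j / z^l], whose mean
    does not depend on the radius.  When [l < j], [g] tends to zero at the origin and
    the mean vanishes; when [j <= l], the mean is a Taylor coefficient. *)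
Lemma trig_monomial_mean j l s : s < 0 ->
  mean (fun t => trig_monomial j l t * f (cexp s t)) =
  if (j <= l)%N then ((expR s) ^+ (l - j))%:C * taylor_mean f (l - j) else 0.
Proof.
move=> s0; have gI s' : s' < 0 -> circle_integrable (fun t => g j l (cexp s' t)).
  by move=> s'0; apply: circle_integrable_holomorphic => // z; exact: dg.
rewrite (_ : (fun t => _) = (fun t => ((expR s) ^+ l / (expR s) ^+ j)%:C * g j l (cexp s t))); last first.
  by apply/funext => t; rewrite gE.
rewrite meanZ; last exact: gI.
case: leqP => [jl|lj]; last by rewrite mean_g // mulr0.
congr (_%:C * _); first by rewrite -expfB_cond // gt_eqF // expR_gt0.
transitivity (mean (fun t => g j l (cexp (-1) t))).
  have [s1|s1] := leP s (-1).
    by apply: (mean_holomorphic_constant (dg (j := j) (l := l)) s1); lra.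
  by apply/esym; apply: (mean_holomorphic_constant (dg (j := j) (l := l)) (ltW s1)).
congr mean; apply/funext => t; rewrite /g /=.
have zn : cexp (-1) t != 0.
  by apply/eqP => E; have := expR_gt0 (-1 : R); rewrite -(cnorm_cexp (-1) t) E Normc.normc0 ltxx.
rewrite -mulrA; congr (_ * _).
by rewrite -[in LHS](subnK jl) exprD invfM mulrCA mulfV ?mulr1 // expf_neq0.
Qed.

End Coefficients.

Lemma trig_monomial_integrable1 j l : circle_integrable (trig_monomial j l).
Proof.
have d1 (z : C) : cnorm z < 1 -> derivable (fun=> 1 : C) z (1 : C) by move=> _; exact: derivable_cst.
have := @trig_monomial_integrable (fun=> 1) d1 j l (-1).
rewrite (_ : (fun t => _ * 1) = trig_monomial j l); last by apply/funext => t; rewrite mulr1.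
by apply; lra.
Qed.

(** [trig_monomial_mean] for [f = 1], and complex conjugation when [j < l]. *)
Lemma trig_monomial_orthogonal j l : mean (trig_monomial j l) = (j == l)%:R.
Proof.
have d1 (z : C) : cnorm z < 1 -> derivable (fun=> 1 : C) z (1 : C) by move=> _; exact: derivable_cst.
have b1 (z : C) : cnorm z < 1 -> cnorm (1 : C) <= 1 by rewrite Normc.normc1.
have small a b : (b < a)%N -> mean (trig_monomial a b) = 0.
  move=> ba; have := @trig_monomial_mean (fun=> 1) 1 d1 b1 a b (-1).
  rewrite (_ : (fun t => _ * 1) = trig_monomial a b); last by apply/funext => t; rewrite mulr1.
  by rewrite leqNgt ba /=; apply; lra.
case: (ltngtP j l) => [jl|lj|->]; last 1 first.
- rewrite (_ : trig_monomial l l = fun=> 1) ?mean_cst //; apply/funext => t.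
  by rewrite /trig_monomial -exprMn cis_conj mulfV ?cis_neq0 // expr1n.
- rewrite (_ : trig_monomial j l = fun t => (trig_monomial l j t)^*).
    by rewrite mean_conj ?small ?conjC0 //; exact: trig_monomial_integrable1.
  by apply/funext => t; rewrite /trig_monomial rmorphM !rmorphXn /= conjCK mulrC.
exact: small.
Qed.

(** The Fejer kernel centred at the point [w] of the unit circle, as a double sum of
    trigonometric monomials. *)
Definition fejer (N : nat) (w : C) (t : R) : C :=
  N%:R^-1 * \sum_(j < N) \sum_(l < N) (w^*) ^+ j * w ^+ l * trig_monomial j l t.

Lemma fejer_square N w t : fejer N w t =
  N%:R^-1 * `|\sum_(j < N) (w^*) ^+ j * cis t ^+ j| ^+ 2.
Proof.
rewrite normCK rmorph_sum /fejer; congr (_ * _); rewrite mulr_suml; apply: eq_bigr => j _.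
rewrite mulr_sumr; apply: eq_bigr => l _.
by rewrite rmorphM !rmorphXn /= conjCK /trig_monomial; ring.
Qed.

Lemma fejer_ge0 N w t : 0 <= fejer N w t.
Proof.
rewrite fejer_square; apply: mulr_ge0; first by rewrite invr_ge0 ler0n.
exact/exprn_ge0/normr_ge0.
Qed.

Lemma fejer_integrable N w (h : R -> C) :
  (forall j l, circle_integrable (fun t => trig_monomial j l t * h t)) ->
  circle_integrable (fun t => fejer N w t * h t).
Proof.
move=> hI; rewrite (_ : (fun t => _) = fun t => N%:R^-1 *
    \sum_(j < N) \sum_(l < N) ((w^*) ^+ j * w ^+ l) * (trig_monomial j l t * h t)).
  apply: circle_integrableZ; apply: circle_integrable_sum => j.
  by apply: circle_integrable_sum => l; exact: circle_integrableZ.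
apply/funext => t; rewrite /fejer -mulrA; congr (_ * _); rewrite mulr_suml.
by apply: eq_bigr => j _; rewrite mulr_suml; apply: eq_bigr => l _; ring.
Qed.

Lemma fejer_mean N w (h : R -> C) :
  (forall j l, circle_integrable (fun t => trig_monomial j l t * h t)) ->
  mean (fun t => fejer N w t * h t) = N%:R^-1 *
    \sum_(j < N) \sum_(l < N) (w^*) ^+ j * w ^+ l * mean (fun t => trig_monomial j l t * h t).
Proof.
move=> hI; rewrite (_ : (fun t => _) = fun t => N%:R^-1 *
    \sum_(j < N) \sum_(l < N) ((w^*) ^+ j * w ^+ l) * (trig_monomial j l t * h t)).
  have lI (j l : 'I_N) : circle_integrable (fun t => ((w^*) ^+ j * w ^+ l) * (trig_monomial j l t * h t)).
    exact: circle_integrableZ.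
  rewrite meanZ; last by apply: circle_integrable_sum => j; exact: circle_integrable_sum.
  rewrite mean_sum => [|j]; last exact: circle_integrable_sum.
  congr (_ * _); apply: eq_bigr => j _; rewrite mean_sum //.
  by apply: eq_bigr => l _; rewrite meanZ.
apply/funext => t; rewrite /fejer -mulrA; congr (_ * _); rewrite mulr_suml.
by apply: eq_bigr => j _; rewrite mulr_suml; apply: eq_bigr => l _; ring.
Qed.

End Fejer.

Section FejerEstimate.
Variable R : realType.
Local Notation C := R[i].
Local Notation "x %:C" := (real_complex R x) : ring_scope.
Variables (f : C -> C) (M : R).
Hypothesis df : forall z, cnorm z < 1 -> derivable f z 1.
Hypothesis fM : forall z, cnorm z < 1 -> cnorm (f z) <= M.

(** The factor [1/n] and the double sum give the coefficient of index [k] the weight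
    [1 - k/n] of Fejer means. *)
Definition fejer_poly n : {poly C} := n%:R^-1 *: \sum_(j < n) \sum_(l < n)
  (if (j <= l)%N then taylor_mean f (l - j) *: 'X^(l - j) else 0).

Section Point.
Variables (w : C) (s : R) (n : nat).
Hypotheses (w1 : cnorm w = 1) (s0 : s < 0).

Let ww : w^* * w = 1.
Proof. by rewrite mulrC -normCK -normc_normE w1 rmorph1 expr1n. Qed.

(** The terms with [l < j], that is the negative frequencies, vanish; the others add up
    to a polynomial that does not depend on the radius [expR s]. *)
Lemma fejer_mean_poly :
  mean (fun t => fejer n w t * f (cexp s t)) = (fejer_poly n).[(expR s)%:C * w].
Proof.
rewrite fejer_mean => [|j l]; last exact: trig_monomial_integrable.
rewrite /fejer_poly hornerZ; congr (_ * _); rewrite horner_sum; apply: eq_bigr => j _.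
rewrite horner_sum; apply: eq_bigr => l _; rewrite (trig_monomial_mean df fM) //.
case: ifP => jl; last by rewrite mulr0 horner0.
have E : w^* ^+ j * w ^+ l = w ^+ (l - j).
  by rewrite -{1}(subnK jl) exprD mulrCA -exprMn ww expr1n mulr1.
by rewrite hornerZ hornerXn exprMn E rmorphXn /=; ring.
Qed.

Lemma sum_ord_eq (k m : nat) : \sum_(l < m) ((l : nat) == k)%:R = (k < m)%N%:R :> C.
Proof.
elim: m => [|m IH]; first by rewrite big_ord0.
rewrite big_ord_recr /= IH ltnS.
by case: (ltngtP k m) => //= _; rewrite ?addr0 ?add0r.
Qed.

Lemma fejer_mean1 : (0 < n)%N -> mean (fejer n w) = 1.
Proof.
move=> n0; have := @fejer_mean _ n w (fun=> 1).
have E j l : (fun t => trig_monomial j l t * 1) = trig_monomial j l :> (R -> C).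
  by apply/funext => t; rewrite mulr1.
rewrite (_ : (fun t => _ * 1) = fejer n w); last by apply/funext => t; rewrite mulr1.
move=> -> => [|j l]; last by rewrite E; exact: trig_monomial_integrable1.
rewrite (eq_bigr (fun=> 1)) => [|j _].
  by rewrite sumr_const card_ord mulVf // pnatr_eq0 -lt0n.
rewrite (bigD1 j) //= E trig_monomial_orthogonal eqxx mulr1 -exprMn ww expr1n.
rewrite big1 ?addr0 // => l lj; rewrite E trig_monomial_orthogonal.
by rewrite (_ : (j == l :> nat) = false) ?mulr0 //; apply/negbTE; rewrite eq_sym.
Qed.

Let dist2 t : C := (cis t - w) * (cis t - w)^*.

Let dist2E j l t : trig_monomial j l t * dist2 t = 2 * trig_monomial j l t +
  (- w^* * trig_monomial j.+1 l t + - w * trig_monomial j l.+1 t).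
Proof.
have cc : cis t * (cis t)^* = 1 by rewrite cis_conj mulfV // cis_neq0.
transitivity (trig_monomial j l t * (cis t * (cis t)^* + w^* * w) +
    (- w^* * trig_monomial j.+1 l t + - w * trig_monomial j l.+1 t)).
  by rewrite /dist2 rmorphB /trig_monomial !exprS; ring.
by rewrite cc ww mulrC.
Qed.

Let dist2I j l : circle_integrable (fun t => trig_monomial j l t * dist2 t).
Proof.
rewrite (_ : (fun t => _) = fun t => 2 * trig_monomial j l t +
  (- w^* * trig_monomial j.+1 l t + - w * trig_monomial j l.+1 t)).
  by apply: circle_integrableD; [|apply: circle_integrableD];
    apply: circle_integrableZ; exact: trig_monomial_integrable1.
by apply/funext => t; rewrite dist2E.
Qed.

Let mean_dist2 j l : mean (fun t => trig_monomial j l t * dist2 t) =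
  2 * (j == l)%:R - w^* * (l == j.+1)%:R - w * (j == l.+1)%:R.
Proof.
rewrite (_ : (fun t => _) = fun t => 2 * trig_monomial j l t +
  (- w^* * trig_monomial j.+1 l t + - w * trig_monomial j l.+1 t)); last first.
  by apply/funext => t; rewrite dist2E.
have TI := @trig_monomial_integrable1 R.
rewrite meanD; [|exact: circle_integrableZ|apply: circle_integrableD; exact: circle_integrableZ].
rewrite meanD ?meanZ; try exact: circle_integrableZ; try exact: TI.
by rewrite !trig_monomial_orthogonal (eq_sym l) !mulNr addrA.
Qed.

(** The kernel has mean [1], and [1 - 1/n] as its coefficients of index [1] and [-1]. *)
Lemma fejer_mean_dist2 : (0 < n)%N ->
  mean (fun t => fejer n w t * ((cis t - w) * (cis t - w)^*)) = 2 / n%:R.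
Proof.
move=> n0; rewrite (fejer_mean _ _ dist2I).
have S1 : \sum_(j < n) (j.+1 < n)%N%:R = n.-1%:R :> C.
  case: n n0 => // m _; rewrite big_ord_recr /= ltnn addr0.
  by rewrite (eq_bigr (fun=> 1)) ?sumr_const ?card_ord // => j _; rewrite ltnS ltn_ord.
have ->: \sum_(j < n) \sum_(l < n) w^* ^+ j * w ^+ l * mean (fun t => trig_monomial j l t * dist2 t) =
  \sum_(j < n) \sum_(l < n) (2 * ((l : nat) == j)%:R - ((l : nat) == j.+1)%:R - ((j : nat) == l.+1)%:R).
  apply: eq_bigr => j _; apply: eq_bigr => l _; rewrite mean_dist2 !mulrBr; congr (_ - _ - _).
  - rewrite eq_sym; case: eqP => [->|]; last by rewrite !mulr0.
    by rewrite -exprMn ww expr1n mul1r.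
  - case: eqP => [->|]; last by rewrite !mulr0.
    by rewrite !mulr1 mulrAC -exprSr -exprMn ww expr1n.
  - case: eqP => [->|]; last by rewrite !mulr0.
    by rewrite !mulr1 -mulrA -exprSr -exprMn ww expr1n.
under eq_bigr do rewrite !sumrB -mulr_sumr sum_ord_eq sum_ord_eq ltn_ord.
rewrite !sumrB sumr_const card_ord S1.
rewrite exchange_big (eq_bigr (fun l : 'I_n => (l.+1 < n)%N%:R)) /= => [|l _]; last by rewrite sum_ord_eq.
rewrite S1; case: n n0 => // m _ /=.
rewrite -mulr_natr -!natr1 /=; field.
by rewrite natr1 pnatr_eq0.
Qed.

(** Averaging [f(r cis t) - f(r w)] against the kernel: the modulus of continuity is
    majorised by a quadratic function, whose mean is [fejer_mean_dist2]. *)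
Lemma fejer_poly_approx (e K : R) : (0 < n)%N -> 0 <= K ->
  (forall z1 z2, cnorm z1 <= 1 -> cnorm z2 <= 1 ->
     cnorm (f z1 - f z2) <= e + K * cnorm (z1 - z2) ^+ 2) ->
  cnorm ((fejer_poly n).[(expR s)%:C * w] - f ((expR s)%:C * w)) <= 2 * (e + K * (2 / n%:R)).
Proof.
move=> n0 K0 fe; set z := (expR s)%:C * w.
have z1 : cnorm z <= 1.
  by rewrite cnormM w1 mulr1 cnormR ger0_norm ?expR_ge0 // ltW // expR_lt1.
have FI : circle_integrable (fejer n w).
  rewrite (_ : fejer n w = fun t => fejer n w t * 1); last by apply/funext => t; rewrite mulr1.
  apply: fejer_integrable => j l; rewrite (_ : (fun t => _) = trig_monomial j l).
    exact: trig_monomial_integrable1.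
  by apply/funext => t; rewrite mulr1.
have FfI : circle_integrable (fun t => fejer n w t * f (cexp s t)).
  by apply: fejer_integrable => j l; exact: trig_monomial_integrable.
have FdI : circle_integrable (fun t => fejer n w t * dist2 t) := fejer_integrable n w dist2I.
have -> : (fejer_poly n).[z] - f z =
    mean (fun t => fejer n w t * f (cexp s t) + - f z * fejer n w t).
  rewrite meanD //; last exact: circle_integrableZ.
  by rewrite (meanZ _ FI) fejer_mean_poly fejer_mean1 // mulr1.
have := @mean_le _ (fun t => fejer n w t * f (cexp s t) + - f z * fejer n w t)
  (fun t => e%:C * fejer n w t + K%:C * (fejer n w t * dist2 t)).
rewrite [X in complex.Re X]meanD; try exact: circle_integrableZ.
rewrite (meanZ _ FI) (meanZ _ FdI) fejer_mean1 // fejer_mean_dist2 // mulr1.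
rewrite (_ : complex.Re _ = e + K * (2 / n%:R)); last first.
  have -> : 2 / n%:R = (2 / n%:R)%:C :> C by rewrite rmorphM fmorphV !rmorph_nat.
  by rewrite -rmorphM -rmorphD.
apply; [by apply: circle_integrableD => //; exact: circle_integrableZ|
  by apply: circle_integrableD; exact: circle_integrableZ|] => t.
have -> : fejer n w t * f (cexp s t) + - f z * fejer n w t =
  fejer n w t * (f (cexp s t) - f z) by ring.
rewrite normc_normE normrM (ger0_norm (fejer_ge0 _ _ _)) -normc_normE.
rewrite [leRHS](_ : _ = fejer n w t * (e%:C + K%:C * dist2 t)); last by ring.
apply: ler_wpM2l; first exact: fejer_ge0.
have c1 : cnorm (cexp s t) <= 1 by rewrite cnorm_cexp ltW // expR_lt1.
rewrite /dist2 -normCK -normc_normE -rmorphXn -rmorphM -rmorphD lecR.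
apply: le_trans (fe _ _ c1 z1) _; rewrite lerD2l; apply: ler_wpM2l => //.
rewrite ler_pXn2r ?nnegrE ?cnorm_ge0 //.
rewrite /cexp /z -mulrBr cnormM cnormR ger0_norm ?expR_ge0 // ler_piMl ?cnorm_ge0 //.
by rewrite ltW // expR_lt1.
Qed.

End Point.
End FejerEstimate.

Section DiscAlgebraApproximation.
Variable R : realType.
Local Notation C := R[i].
Local Notation "x %:C" := (real_complex R x) : ring_scope.
Variable f : C -> C.
Hypothesis fA : disc_algebra f.

Lemma disc_algebra_derivable z : cnorm z < 1 -> derivable f z 1.
Proof.
move=> z1; apply: (proj2 fA); rewrite /open_disc /mkset -normc_normE.
by have : (cnorm z)%:C < 1%:C by rewrite ltcR.
Qed.

Lemma disc_algebra_continuous z e : 0 < e -> cnorm z <= 1 ->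
  exists2 d, 0 < d & forall w, cnorm w <= 1 -> cnorm (w - z) < d -> cnorm (f w - f z) < e.
Proof.
move=> e0 z1; have /subspace_continuousP := proj1 fA.
have eC0 : 0 < e%:C by rewrite -(rmorph0 (real_complex R)) ltcR.
have discE (w : C) : (closed_disc w) = (cnorm w <= 1) :> Prop.
  rewrite /closed_disc /mkset -normc_normE.
  by have -> : ((cnorm w)%:C <= 1) = ((cnorm w)%:C <= 1%:C); rewrite ?lecR.
move=> /(_ z); rewrite discE => /(_ z1) /cvgrPdist_lt /(_ _ eC0).
rewrite near_withinE => /nbhs_ballP[d /= d0 Hd].
have /complex_realP [d' dE] := gtr0_real d0.
exists d'; first by rewrite -ltcR rmorph0 -dE.
move=> w w1 wd; have := Hd w; rewrite -ball_normE /ball_ /= discE => /(_ _ w1).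
rewrite -!normc_normE dE !ltcR (cnorm_distC z) (cnorm_distC (f z)).
by apply.
Qed.

(** Heine's theorem on the closed disc by [cousin_cells], on the square
    [[-1, 1] x [-1, 1]].  Cells near a point outside the disc do not meet the disc.
    A bound [M] for [f] comes along. *)
Lemma disc_algebra_uniform e : 0 < e -> exists2 d, 0 < d & exists M, forall z w,
  cnorm z <= 1 -> cnorm w <= 1 -> cnorm (w - z) < d ->
  cnorm (f w - f z) <= e /\ cnorm (f z) <= M.
Proof.
move=> e0.
pose cell a c h (z : C) := a <= complex.Re z <= a + 1 * h /\ c <= complex.Im z <= c + 1 * h.
pose P a c h := exists2 d, 0 < d & exists M, forall z w, cell a c h z ->
  cnorm z <= 1 -> cnorm w <= 1 -> cnorm (w - z) < d ->
  cnorm (f w - f z) <= e /\ cnorm (f z) <= M.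
have [d d0 [M HM]] : P (-1) (-1) 2.
  apply: (@cousin_cells R 1 1 ler01 ler01 P) => //.
    move=> a c h h0 [d1 p1 [M1 H1]] [d2 p2 [M2 H2]] [d3 p3 [M3 H3]] [d4 p4 [M4 H4]].
    exists (Num.min (Num.min d1 d2) (Num.min d3 d4)); first by rewrite !lt_min p1 p2 p3 p4.
    exists (Num.max (Num.max M1 M2) (Num.max M3 M4)) => z w [/andP[a1 a2] /andP[c1 c2]] z1 w1.
    rewrite !lt_min => /andP[/andP[w2 w3] /andP[w4 w5]]; rewrite !le_max.
    have hh : h = h / 2 + h / 2 by field.
    rewrite mul1r in a2; rewrite mul1r in c2.
    have [x|/ltW x] := leP (complex.Re z) (a + h / 2);
      have [y|/ltW y] := leP (complex.Im z) (c + h / 2).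
    - have [|-> ->] := H1 z w _ z1 w1 w2; last by [].
      by rewrite /cell; split; apply/andP; split; lra.
    - have [|-> ->] := H3 z w _ z1 w1 w4; last by rewrite !orbT.
      by rewrite /cell; split; apply/andP; split; lra.
    - have [|-> ->] := H2 z w _ z1 w1 w3; last by rewrite !orbT.
      by rewrite /cell; split; apply/andP; split; lra.
    - have [|-> ->] := H4 z w _ z1 w1 w5; last by rewrite !orbT.
      by rewrite /cell; split; apply/andP; split; lra.
  move=> x y _ _; pose z0 : C := (x +i* y)%C.
  have cell_near a c h z : 0 < h -> a <= x <= a + 1 * h -> c <= y <= c + 1 * h ->
      cell a c h z -> cnorm (z - z0) <= 2 * h.
    move=> h0 /andP[a1 a2] /andP[b1 b2] [/andP[a3 a4] /andP[b3 b4]].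
    apply: le_trans (cnorm_ReIm _) _; case: z a3 a4 b3 b4 => p q /= a3 a4 b3 b4.
    rewrite mulr_natl mulr2n; apply: lerD; rewrite ler_norml; apply/andP; split; lra.
  have [z01|z01] := leP (cnorm z0) 1; last first.
    exists ((cnorm z0 - 1) / 2); first by rewrite divr_gt0 // subr_gt0.
    move=> a c h /andP[h0 h1] ax cy _ _ _ _; exists 1 => //; exists 0 => z w zc z1 _ _.
    have := cell_near a c h z h0 ax cy zc; rewrite cnorm_distC => H; exfalso.
    have : cnorm z0 <= cnorm (z0 - z) + cnorm z by rewrite -{1}(subrK z z0) cnormD.
    lra.
  have e20 : 0 < e / 2 by lra.
  have [d d0 Hd] := disc_algebra_continuous e20 z01.
  exists (d / 4); first by rewrite divr_gt0.
  move=> a c h /andP[h0 h1] ax cy _ _ _ _; exists (d / 2); first by rewrite divr_gt0.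
  exists (cnorm (f z0) + e) => z w zc z1 w1 wz.
  have zz0 := cell_near a c h z h0 ax cy zc.
  have fz : cnorm (f z - f z0) < e / 2 by apply: Hd => //; lra.
  have fw : cnorm (f w - f z0) < e / 2.
    apply: Hd => //; rewrite -(subrKA z) (le_lt_trans (cnormD _ _)) //.
    lra.
  split.
    rewrite -(subrKA (f z0)) (le_trans (cnormD _ _)) // (cnorm_distC (f z0)); lra.
  rewrite -{1}(subrK (f z0) (f z)) (le_trans (cnormD _ _)) //; lra.
exists d => //; exists M => z w z1 w1 wz; apply: HM => //.
have := le_trans (Re_le_cnorm z) z1; have := le_trans (Im_le_cnorm z) z1.
rewrite !ler_norml => /andP[a1 a2] /andP[b1 b2].
by split; apply/andP; split => //; lra.
Qed.

Lemma disc_algebra_bounded : exists M, forall z, cnorm z <= 1 -> cnorm (f z) <= M.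
Proof.
have [d d0 [M HM]] := disc_algebra_uniform ltr01; exists M => z z1.
by have [] := HM z z z1 z1; rewrite // subrr Normc.normc0.
Qed.

(** For points at distance less than [d] the difference is at most [e]; otherwise it is
    bounded, and the quadratic term takes over. *)
Lemma disc_algebra_quadratic_modulus e : 0 < e -> exists2 K, 0 <= K & forall z w,
  cnorm z <= 1 -> cnorm w <= 1 -> cnorm (f z - f w) <= e + K * cnorm (z - w) ^+ 2.
Proof.
move=> e0; have [d d0 [M HM]] := disc_algebra_uniform e0.
have fM z : cnorm z <= 1 -> cnorm (f z) <= M.
  by move=> z1; have [] := HM z z z1 z1; rewrite // subrr Normc.normc0.
have M0 : 0 <= M by apply: le_trans (cnorm_ge0 (f 0)) (fM 0 _); rewrite Normc.normc0 ler01.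
have d20 : 0 < d ^+ 2 by rewrite exprn_gt0.
exists (2 * M / d ^+ 2) => [|z w z1 w1]; first by rewrite divr_ge0 ?mulr_ge0 // ltW.
have K0 : 0 <= 2 * M / d ^+ 2 by rewrite divr_ge0 ?mulr_ge0 // ltW.
have [zw|zw] := ltP (cnorm (z - w)) d.
  have [H _] := HM w z w1 z1 zw; apply: le_trans H _.
  by rewrite lerDl mulr_ge0 // exprn_ge0 // cnorm_ge0.
apply: (@le_trans _ _ (2 * M)).
  by apply: le_trans (cnormB _ _) _; have := fM z z1; have := fM w w1; lra.
apply: (@le_trans _ _ (2 * M / d ^+ 2 * d ^+ 2)).
  by rewrite divfK // gt_eqF.
rewrite -[leLHS]add0r; apply: lerD; first exact: ltW.
by apply: ler_wpM2l => //; rewrite ler_pXn2r // nnegrE ?cnorm_ge0 // ltW.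
Qed.

Lemma polynomial_lipschitz_at (p : {poly C}) (z : C) : exists2 L, 0 <= L & forall w,
  cnorm w <= 1 -> cnorm (p.[w] - p.[z]) <= L * cnorm (w - z).
Proof.
have /factor_theorem [q qE] : root (p - p.[z]%:P) z by rewrite rootE !hornerE subrr.
exists (\sum_(k < size q) cnorm q`_k) => [|w w1]; first by apply: sumr_ge0 => k _; exact: cnorm_ge0.
have := congr1 (horner^~ w) qE; rewrite !hornerE => ->.
rewrite cnormM; apply: ler_wpM2r; first exact: cnorm_ge0.
rewrite horner_coef; apply: le_trans (cnorm_sum _ _) _; apply: ler_sum => k _.
by rewrite cnormM cnormX ler_piMr ?cnorm_ge0 // exprn_ile1 ?cnorm_ge0.
Qed.

(** [fejer_poly_approx] covers the punctured open disc, uniformly in the radius; the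
    origin and the unit circle are reached by continuity. *)
Lemma disc_algebra_approx e : 0 < e ->
  exists p : {poly C}, forall z, cnorm z <= 1 -> cnorm (p.[z] - f z) <= e.
Proof.
move=> e0; have e10 : 0 < e / 16 by lra.
have [K K0 HK] := disc_algebra_quadratic_modulus e10.
have [M HM] := disc_algebra_bounded.
have fM z : cnorm z < 1 -> cnorm (f z) <= M by move=> /ltW; exact: HM.
have n0 : (0 < (Num.bound (K * 64 / e)).+1)%N by [].
set n := (Num.bound (K * 64 / e)).+1 in n0.
have nK : K * (2 / n%:R) <= e / 16.
  have : K * 64 / e <= n%:R.
    apply/ltW; apply: lt_le_trans (archi_boundP _) _; last by rewrite ler_nat.
    by rewrite divr_ge0 ?mulr_ge0 // ltW.
  rewrite ler_pdivrMr // => H.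
  rewrite mulrA ler_pdivrMr ?ltr0n //; lra.
pose p := fejer_poly f n; exists p.
have inner z : 0 < cnorm z < 1 -> cnorm (p.[z] - f z) <= e / 4.
  move=> /andP[z0 z1]; pose w := z / (cnorm z)%:C.
  have zn : (cnorm z)%:C != 0.
    by rewrite -(rmorph0 (real_complex R)) (inj_eq (@complexI R)) gt_eqF.
  have w1 : cnorm w = 1.
    by rewrite /w -fmorphV cnormM cnormR ger0_norm ?invr_ge0 ?(ltW z0) // mulfV // gt_eqF.
  have s0 : ln (cnorm z) < 0 by rewrite ln_lt0 // z0.
  have zE : z = (expR (ln (cnorm z)))%:C * w by rewrite lnK ?posrE // /w mulrCA mulfV ?mulr1.
  have := fejer_poly_approx disc_algebra_derivable fM w1 s0 n0 K0 HK.
  rewrite -zE; lra.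
move=> z z1.
have [L L0 HL] := polynomial_lipschitz_at p z.
(* move z by at most t into the punctured open disc *)
pose t := Num.min (1 / 2) (Num.min (e / (16 * (L + 1))) (e / (16 * (K + 1)))).
have t0 : 0 < t by rewrite !lt_min !divr_gt0 //; lra.
have t1 : t <= 1 / 2 by rewrite ge_min lexx.
have t2 : t <= e / (16 * (L + 1)) by rewrite !ge_min lexx !orbT.
have t3 : t <= e / (16 * (K + 1)) by rewrite !ge_min lexx !orbT.
have [z' z'01 zz'] : exists2 z', 0 < cnorm z' < 1 & cnorm (z' - z) <= t.
  have [z0|z0] := eqVneq z 0.
    exists t%:C; rewrite ?z0 ?subr0 cnormR ger0_norm ?(ltW t0) //.
    by rewrite t0 /=; lra.
  have zp : 0 < cnorm z.
    rewrite lt_neqAle cnorm_ge0 andbT eq_sym; apply: contra z0 => /eqP/Normc.eq0_normc ->.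
    by [].
  exists ((1 - t)%:C * z).
    rewrite cnormM cnormR ger0_norm; last by lra.
    by apply/andP; split; nra.
  have -> : (1 - t)%:C * z - z = (- t)%:C * z by rewrite rmorphB rmorphN rmorph1; ring.
  rewrite cnormM cnormR normrN ger0_norm ?(ltW t0) // ler_piMr //; exact: ltW.
have z'1 : cnorm z' <= 1 by case/andP: z'01 => _ /ltW.
have H1 := HL z' z'1; have H2 := HK z' z z'1 z1; have H3 := inner z' z'01.
have H1' : L * cnorm (z' - z) <= e / 16.
  apply: le_trans (ler_wpM2l L0 zz') _; apply: le_trans (ler_wpM2l L0 t2) _.
  by rewrite mulrA ler_pdivrMr; nra.
have H2' : K * cnorm (z' - z) ^+ 2 <= e / 16.
  apply: (@le_trans _ _ (K * t)).
    apply: ler_wpM2l => //; apply: le_trans (_ : cnorm (z' - z) * 1 <= _); last by rewrite mulr1.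
    rewrite expr2; apply: ler_wpM2l; [exact: cnorm_ge0|lra].
  apply: le_trans (ler_wpM2l K0 t3) _.
  by rewrite mulrA ler_pdivrMr; nra.
have -> : p.[z] - f z = - (p.[z'] - p.[z]) + ((p.[z'] - f z') + (f z' - f z)) by ring.
apply: le_trans (cnormD _ _) _; rewrite cnormN.
have := cnormD (p.[z'] - f z') (f z' - f z); lra.
Qed.

End DiscAlgebraApproximation.

(** * The functional calculus of the disc algebra *)

Section Convergence.
Variable R : realType.
Local Notation C := R[i].
Local Notation "x %:C" := (real_complex R x) : ring_scope.

Lemma uniform_disc_cvgP (u : nat -> C -> C) (f : C -> C) :
  {uniform @closed_disc R, u @ \oo --> f} <->
  (forall e : R, 0 < e -> exists N, forall k, (N <= k)%N ->
     forall z, cnorm z <= 1 -> cnorm (u k z - f z) < e).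
Proof.
have discE (w : C) : (closed_disc w) = (cnorm w <= 1) :> Prop.
  rewrite /closed_disc /mkset -normc_normE.
  by have -> : ((cnorm w)%:C <= 1) = ((cnorm w)%:C <= 1%:C); rewrite ?lecR.
split=> H.
  move=> e e0; have eC0 : 0 < e%:C by rewrite -(rmorph0 (real_complex R)) ltcR.
  have : nbhs (f : {uniform` (@closed_disc R) -> C})
      [set h | forall y, closed_disc y -> ball (f y) (e%:C) (h y)].
    apply/uniform_nbhs; exists [set xy | ball xy.1 (e%:C) xy.2]; split => //.
    exact: entourage_ball (PosNum eC0).
  move=> /H [N _ HN]; exists N => k Nk z z1; have := HN k Nk z.
  rewrite discE => /(_ z1); rewrite -ball_normE /ball_ /=.
  by rewrite -normc_normE ltcR cnorm_distC.
move=> P /uniform_nbhs [E [entE EP]].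
move: entE; rewrite -entourage_ballE => -[d /= d0 dE].
have /complex_realP [d' d'E] := gtr0_real d0.
have d'0 : 0 < d' by rewrite -ltcR rmorph0 -d'E.
have [N HN] := H d' d'0; exists N => // k /= Nk; apply: EP => y /=.
rewrite discE => y1; apply: dE => /=; rewrite -ball_normE /ball_ /=.
by rewrite -normc_normE d'E ltcR cnorm_distC; exact: HN.
Qed.

Lemma ereal_cvg0_lt (u : nat -> \bar R) : u @ \oo --> 0%E ->
  forall e : R, 0 < e -> exists N, forall k, (N <= k)%N -> (u k < e%:E)%E.
Proof.
move=> u0 e e0.
have : nbhs (0%E : \bar R) [set x | (x < e%:E)%E].
  by apply: open_nbhs_nbhs; split; [exact: open_ereal_lt_ereal | rewrite /= lte_fin].
by move=> /u0 [N _ HN]; exists N => k Nk; exact: HN.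
Qed.

Lemma ereal_cvg0_le (u : nat -> \bar R) (c : R) : 0 <= c ->
  (forall k, (0 <= u k)%E) -> (forall k, (u k <= (c / k.+1%:R)%:E)%E) -> u @ \oo --> 0%E.
Proof.
move=> c0 u0 uc; apply: (@squeeze_cvge _ _ _ _ (fun=> 0%E) _ (fun k => (c / k.+1%:R)%:E)).
- by apply: nearW => k; rewrite u0 uc.
- exact: cvg_cst.
- apply/fine_cvgP; split; first exact: nearW.
  have := @cvgM _ _ \oo _ _ _ c 0 (cvg_cst c) (@cvg_harmonic R).
  by rewrite mulr0; apply.
Qed.

End Convergence.

Section PolynomialCalculus.
Variables (R : realType) (H : hilbertType R) (T : {linear H -> H}).
Local Notation C := R[i].
Local Notation "x %:C" := (real_complex R x) : ring_scope.
Local Notation ip := (@inner R H).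
Local Notation hnorm := (ipnorm ip).

Lemma hnormE (x : H) : (hnorm x)%:C = `|x|.
Proof.
have h0 : 0 <= (hnorm x)%:C by rewrite ler0c ipnorm_ge0.
apply/eqP; rewrite -(eqrXn2 (n := 2)) //; apply/eqP.
by rewrite -innerE -ipnorm_sqr rmorphXn.
Qed.

Lemma iter_linear k a x y : iter k T (a *: x + y) = a *: iter k T x + iter k T y.
Proof. by elim: k => //= k ->; rewrite linearP. Qed.

Lemma poly_op_linear p a x y : poly_op T p (a *: x + y) = a *: poly_op T p x + poly_op T p y.
Proof.
rewrite /poly_op scaler_sumr -big_split; apply: eq_bigr => k _ /=.
by rewrite iter_linear scalerDr !scalerA (mulrC a).
Qed.

Lemma poly_opB p q x : poly_op T (p - q) x = poly_op T p x - poly_op T q x.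
Proof.
pose d := maxn (size p) (size q).
rewrite !(@poly_op_wide R H T _ d) ?leq_maxl ?leq_maxr //.
  by rewrite -sumrB; apply: eq_bigr => k _; rewrite coefB scalerBl.
by rewrite (leq_trans (size_polyD _ _)) // size_polyN.
Qed.

Lemma poly_op0 x : poly_op T 0 x = 0.
Proof. by rewrite /poly_op size_poly0 big_ord0. Qed.

Hypothesis hw : (numerical_radius ip T <= 1)%E.

(** The [2 x 2] matrix with [p] as its only nonzero entry, off the diagonal, has the
    supremum norm of [p], and its form at the vector [(y, x)] is [<p(T)x, y>]: the bound
    on numerical radii becomes a bound on the norm of [p(T)]. *)
Lemma poly_op_bounded (p : {poly C}) (m : R) : 0 < m ->
  (forall z, cnorm z < 1 -> cnorm p.[z] <= m) ->
  forall x, hnorm (poly_op T p x) <= 5 / 2 * m * hnorm x.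
Proof.
move=> m0 pm x.
pose G : 'M[{poly C}]_2 := \matrix_(a, b) (if (a == 0) && (b == 1) then p else 0).
(* s balances the two terms of the quadratic form at (s X, x) *)
pose s := 2 / (5 * m); have s0 : 0 < s by rewrite divr_gt0 // mulr_gt0.
pose y : {ffun 'I_2 -> H} := [ffun a => if a == 0 then s%:C *: poly_op T p x else x].
have Gm z (v : 'cV[C]_2) : `|z| < 1 -> n2 (evmx z G *m v) <= (m ^+ 2)%:C * n2 v.
  move=> z1; have {}z1 : cnorm z < 1.
    by rewrite -ltcR normc_normE.
  rewrite !n2E; under eq_bigr do rewrite big_ord1.
  under [in leRHS]eq_bigr do rewrite big_ord1.
  rewrite !big_ord_recl !big_ord0 !addr0 !mxE !big_ord_recl !big_ord0 !mxE /=.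
  rewrite /horner_eval !horner0 !mul0r !add0r !addr0 normr0 expr0n addr0 normrM exprMn.
  rewrite mulrDr -[leLHS]add0r; apply: lerD.
    by apply: mulr_ge0; [rewrite ler0c exprn_ge0 // ltW | exact/exprn_ge0/normr_ge0].
  apply: ler_wpM2r; first exact/exprn_ge0/normr_ge0.
  rewrite rmorphXn ler_pXn2r // ?nnegrE ?ler0c ?(ltW m0) //.
  by rewrite -normc_normE lecR pm.
have := @polynomial_calculus_bound R H T 2 hw G m y (ltW m0) Gm.
rewrite /dsum_inner !big_ord_recl !big_ord0 !addr0 !ffunE /=.
rewrite !big_ord_recl !big_ord0 !mxE !ffunE /= !poly_op0 !addr0 !add0r linear0l addr0.
set X := poly_op T p x; rewrite linearZr_LR linearZl_LR linearZr_LR /= -!ipnorm_sqr.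
rewrite linearZl_LR /= -ipnorm_sqr.
have -> : (s%:C)^* = s%:C by apply/CrealP/complex_realP; exists s.
rewrite -!rmorphM -rmorphD -rmorphM -normc_normE lecR cnormR.
have X0 := ipnorm_ge0 ip X; have x0 := ipnorm_ge0 ip x.
rewrite ger0_norm; last by rewrite mulr_ge0 ?sqr_ge0 // ltW.
move: (hnorm X) (hnorm x) X0 x0 => a b a0 b0; rewrite /GRing.scale /= => E.
have sm : s * m = 2 / 5 by rewrite /s; field; rewrite gt_eqF.
have {}E : s / 2 * a ^+ 2 <= 5 / 4 * m * b ^+ 2.
  have F : 5 * (4^-1 * m) * (s * (s * a ^+ 2) + b ^+ 2) =
    5 / 4 * ((s * m) * s * a ^+ 2 + m * b ^+ 2) by field.
  rewrite F sm in E; lra.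
have rhs0 : 0 <= 5 / 2 * m * b by have := mulr_ge0 (ltW m0) b0; lra.
rewrite -(ler_pXn2r (n := 2)) ?nnegrE //.
have := ler_wpM2l (ltW m0) E.
have -> : m * (s / 2 * a ^+ 2) = (s * m) / 2 * a ^+ 2 by field.
by rewrite sm; lra.
Qed.

End PolynomialCalculus.

Section DiscOperator.
Variables (R : realType) (H : hilbertType R) (T : {linear H -> H}).
Local Notation C := R[i].
Local Notation "x %:C" := (real_complex R x) : ring_scope.
Local Notation ip := (@inner R H).
Local Notation hnorm := (ipnorm ip).
Hypothesis hw : (numerical_radius ip T <= 1)%E.

Lemma archimedean_inv (c e : R) : 0 < e -> 0 <= c -> exists N, c / N.+1%:R < e.
Proof.
move=> e0 c0; exists (Num.bound (c / e)).
rewrite ltr_pdivrMr ?ltr0n // mulrC -ltr_pdivrMr //.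
by apply: lt_trans (archi_boundP (divr_ge0 c0 (ltW e0))) _; rewrite ltr_nat.
Qed.

Lemma bounded_opP (S : {linear H -> H}) (c : R) : 0 <= c ->
  (forall x, hnorm (S x) <= c * hnorm x) -> bounded_op S.
Proof.
move=> c0 Sc; apply: le_lt_trans (opnorm_leP c0 Sc) _; exact: ltry.
Qed.

(** For polynomials [p k] that converge uniformly to [f], [poly_op_bounded] makes
    [p k (T) x] a Cauchy sequence with a rate proportional to the norm of [x]; its limit
    is linear in [x], and is the limit in operator norm as well. *)
Lemma disc_op_exists (f : C -> C) : disc_algebra f -> exists S, is_disc_op T f S.
Proof.
move=> fA.
have [p pf] : {p : nat -> {poly C} & forall k z, cnorm z <= 1 ->
    cnorm ((p k).[z] - f z) <= k.+1%:R^-1}.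
  apply: (@choice nat {poly C} (fun k q => forall z, cnorm z <= 1 ->
    cnorm (q.[z] - f z) <= k.+1%:R^-1)) => k.
  by apply: disc_algebra_approx => //; rewrite invr_gt0 ltr0n.
have [M fM] := disc_algebra_bounded fA.
pose u k x := poly_op T (p k) x.
have udist k l x : (k <= l)%N -> hnorm (u l x - u k x) <= 5 / k.+1%:R * hnorm x.
  move=> kl; rewrite /u -poly_opB.
  have k0 : 0 < 2 / k.+1%:R :> R by rewrite divr_gt0 // ltr0n.
  have -> : 5 / k.+1%:R = 5 / 2 * (2 / k.+1%:R) :> R by rewrite mulrA divfK ?pnatr_eq0.
  apply: poly_op_bounded => // z /ltW z1; rewrite hornerD hornerN.
  rewrite (_ : _ - _ = ((p l).[z] - f z) - ((p k).[z] - f z)); last by ring.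
  apply: le_trans (cnormB _ _) _.
  have h1 := pf l z z1; have h2 := pf k z z1.
  have h3 : l.+1%:R^-1 <= k.+1%:R^-1 :> R by rewrite lef_pV2 ?posrE ?ltr0n // ler_nat.
  by rewrite mulr_natl mulr2n; apply: lerD => //; exact: le_trans h3.
have ucvg x : cvg (u k x @[k --> \oo]).
  apply/cauchy_cvgP/cauchyP => e e0.
  have /complex_realP [e' e'E] := gtr0_real e0.
  have e'0 : 0 < e' by rewrite -ltcR rmorph0 -e'E.
  have [|N HN] := @archimedean_inv (5 * hnorm x) e' e'0; first by rewrite mulr_ge0 ?ipnorm_ge0.
  exists (u N x); exists N => // k /= Nk; rewrite -ball_normE /ball_ /=.
  rewrite -hnormE e'E ltcR ipnorm_distC; apply: le_lt_trans (udist N k x Nk) _.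
  by rewrite mulrAC.
pose S x := lim (u k x @[k --> \oo]).
have uS k x : hnorm (u k x - S x) <= 5 / k.+1%:R * hnorm x.
  apply/ler_addgt0Pr => e e0.
  have eC0 : 0 < e%:C by rewrite -(rmorph0 (real_complex R)) ltcR.
  have /cvgrPdist_lt /(_ _ eC0) [N _ HN] : u k x @[k --> \oo] --> S x by exact: ucvg.
  have := HN (maxn N k) (leq_maxl _ _); rewrite -hnormE ltcR => H1.
  have H2 := udist k (maxn N k) x (leq_maxr _ _).
  rewrite -(subrKA (u (maxn N k) x)) (le_trans (ipnormD _ _ _)) //.
  rewrite ipnorm_distC; apply: lerD => //.
  by rewrite ipnorm_distC ltW.
have Slin : linear S.
  move=> a x y; apply/eqP; rewrite -subr_eq0; apply/eqP; apply: (ipnorm_eq0 (ip := ip)).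
  apply/eqP; rewrite eq_le ipnorm_ge0 andbT; apply/ler_addgt0Pr => e e0; rewrite add0r.
  pose c := 5 * hnorm (a *: x + y) + (cnorm a * (5 * hnorm x) + 5 * hnorm y).
  have c0 : 0 <= c by rewrite !addr_ge0 ?mulr_ge0 ?ipnorm_ge0 ?cnorm_ge0.
  have [N HN] := archimedean_inv e0 c0.
  have -> : S (a *: x + y) - (a *: S x + S y) = - (u N (a *: x + y) - S (a *: x + y)) +
      (a *: (u N x - S x) + (u N y - S y)).
    have -> : u N (a *: x + y) = a *: u N x + u N y by exact: poly_op_linear.
    by rewrite scalerBr opprB [X in _ = _ + X]addrACA -opprD subrKA.
  apply: le_trans (ipnormD _ _ _) _; rewrite ipnormN.
  have H1 := ipnormD ip (a *: (u N x - S x)) (u N y - S y).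
  rewrite ipnormZ in H1.
  have H2 := uS N (a *: x + y); have H3 := ler_wpM2l (cnorm_ge0 a) (uS N x).
  have H4 := uS N y; apply: le_trans (ltW HN).
  rewrite /c [leRHS]mulrDl [X in _ <= _ + X]mulrDl.
  have E (w : R) : 5 / N.+1%:R * w = 5 * w / N.+1%:R by rewrite mulrAC.
  rewrite !E in H2 H3 H4; apply: lerD => //.
  apply: le_trans H1 _; apply: lerD => //.
  by rewrite -[leRHS]mulrA.
pose SL : {linear H -> H} := HB.pack S (GRing.isLinear.Build _ _ _ _ S Slin).
have SE : (SL : H -> H) = S by [].
exists SL; split.
  have M0 : 0 <= M by apply: le_trans (cnorm_ge0 (f 0)) (fM 0 _); rewrite Normc.normc0 ler01.
  apply: (@bounded_opP _ (5 / 2 * (M + 1) + 5)) => [|x]; first by lra.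
  have H1 := uS 0%N x; rewrite divr1 in H1.
  have H2 : hnorm (u 0%N x) <= 5 / 2 * (M + 1) * hnorm x.
    apply: poly_op_bounded => //; first lra.
    move=> z /ltW z1; have := pf 0%N z z1; rewrite invr1 => H2.
    rewrite -(subrK (f z) (p 0%N).[z]) (le_trans (cnormD _ _)) //.
    by have := fM z z1; lra.
  rewrite SE -(subrK (u 0%N x) (S x)) (le_trans (ipnormD _ _ _)) //.
  rewrite ipnorm_distC mulrDl addrC; exact: lerD.
exists p; split.
  apply/uniform_disc_cvgP => e e0; have [N HN] := archimedean_inv e0 ler01.
  exists N => k Nk z z1; apply: le_lt_trans (pf k z z1) _; apply: le_lt_trans HN.
  by rewrite div1r lef_pV2 ?posrE ?ltr0n // ler_nat.
apply: (@ereal_cvg0_le _ _ 5) => // [k|k]; first exact: opnorm_ge0.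
apply: opnorm_leP => [|x]; first by rewrite divr_ge0.
exact: uS.
Qed.

Lemma disc_opP (f : C -> C) : disc_algebra f -> is_disc_op T f (disc_op T f).
Proof. by move=> /disc_op_exists [S HS]; rewrite /disc_op; exact: (getPex (ex_intro _ S HS)). Qed.

Lemma disc_op_approx (f : C -> C) (e : R) : disc_algebra f -> 0 < e ->
  exists p : {poly C}, (forall z, cnorm z <= 1 -> cnorm (p.[z] - f z) < e) /\
    (forall x, hnorm (poly_op T p x - disc_op T f x) <= e * hnorm x).
Proof.
move=> fA e0; have [_ [p [pf pS]]] := disc_opP fA.
have [N HN] := (uniform_disc_cvgP _ _).1 pf e e0.
have [N' HN'] := ereal_cvg0_lt pS e0.
exists (p (maxn N N')); split; first by apply: HN; rewrite leq_maxl.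
move=> x; have /ltW := HN' (maxn N N') (leq_maxr _ _).
move=> /(@opnorm_le _ _ _ (fun x => poly_op T (p (maxn N N')) x - disc_op T f x)); apply.
move=> a y.
have := poly_op_linear T (p (maxn N N')) a y 0.
have -> : poly_op T (p (maxn N N')) 0 = 0.
  by have := poly_op_linear T (p (maxn N N')) (-1) 0 0; rewrite !scaleN1r oppr0 addr0 addNr.
by rewrite !addr0 linearZ scalerBr => ->.
Qed.

End DiscOperator.

(** * The bound 5/4 for the disc algebra *)

Lemma euclidean_norm_sqr (R : realType) n (v : 'cV[R[i]]_n) :
  real_complex R (ipnorm (@cdot R n) v ^+ 2) = n2 v.
Proof. by rewrite ipnorm_sqr; exact: cdotE. Qed.

Lemma entrywise_small_mulmx (R : realType) n (D : 'M[R[i]]_n) (d : R) (v : 'cV[R[i]]_n) :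
  (forall i j, cnorm (D i j) <= d) ->
  ipnorm (@cdot R n) (D *m v) <= (n * n)%N%:R * d * ipnorm (@cdot R n) v.
Proof.
move=> Dd.
have vj j : cnorm (v j 0) <= ipnorm (@cdot R n) v.
  rewrite -(ler_pXn2r (n := 2)) ?nnegrE ?cnorm_ge0 ?ipnorm_ge0 // -lecR euclidean_norm_sqr.
  rewrite n2E (bigD1 j) //= big_ord1 rmorphXn /= normc_normE lerDl.
  by apply: sumr_ge0 => i _; rewrite big_ord1; exact/exprn_ge0/normr_ge0.
have ei (i : 'I_n) : ipnorm (@cdot R n) (delta_mx i 0) = 1.
  apply: ipnorm_eq1; rewrite [LHS]cdotE n2E (bigD1 i) //= big_ord1 mxE !eqxx normr1 expr1n.
  rewrite big1 ?addr0 // => k ki; rewrite big_ord1 mxE (negPf ki) normr0 expr0n //.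
have -> : D *m v = \sum_i \sum_j (D i j * v j 0) *: delta_mx i 0.
  apply/matrixP => k l; rewrite ord1 mxE summxE [RHS](bigD1 k) //= [X in _ = _ + X]big1 ?addr0.
    by rewrite summxE; apply: eq_bigr => j _; rewrite !mxE !eqxx mulr1.
  by move=> i ik; rewrite summxE big1 // => j _; rewrite !mxE eq_sym (negPf ik) mulr0.
apply: le_trans (ipnorm_sum _ _ _) _.
apply: (@le_trans _ _ (\sum_(i < n) \sum_(j < n) d * ipnorm (@cdot R n) v)).
  apply: ler_sum => i _; apply: le_trans (ipnorm_sum _ _ _) _; apply: ler_sum => j _.
  by rewrite ipnormZ ei mulr1 cnormM; apply: ler_pM => //; exact: cnorm_ge0.
rewrite (eq_bigr (fun=> d * ipnorm (@cdot R n) v *+ n)); last first.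
  by move=> i _; rewrite sumr_const card_ord.
by rewrite sumr_const card_ord -mulrnA -mulrA mulr_natl.
Qed.

(** Replace each entry of [F] by a polynomial that is [d]-close to it on the disc and
    whose operator is [d]-close to that of the entry, apply the bound for polynomials,
    and let [d] tend to zero. *)
Theorem disc_algebra_case (R : realType) (H : hilbertType R) (T : {linear H -> H})
    (n : nat) (hw : (numerical_radius (@inner R H) T <= 1)%E)
    (F : R[i] -> 'M[R[i]]_n) (FA : forall i j, disc_algebra (fun z => F z i j)) :
  (numerical_radius (@dsum_inner R H n)
       (mxop (fun i j => disc_op T (fun z => F z i j)))
     <= (5 / 4)%:E * mx_supnorm F)%E.
Proof.
have := mx_supnorm_ge0 F.
case E : (mx_supnorm F) => [m| |] //; last first.
  by move=> _; rewrite gt0_muley ?leey // lte_fin; lra.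
rewrite lee_fin => m0; rewrite -EFinM; apply: numerical_radius_leP => x x1.
rewrite -normc_normE lecR; apply/ler_addgt0Pr => e e0.
pose K : R := (n * n)%N%:R; have K0 : 0 <= K by rewrite ler0n.
(* 3 bounds 5/4 + 1: the errors on the symbol and on the operator *)
pose d := e / (3 * K + 1); have d0 : 0 < d by rewrite divr_gt0 //; lra.
have {}E : (mx_supnorm F <= m%:E)%E by rewrite E.
have [G HG] : {G : 'I_n -> 'I_n -> {poly R[i]} & forall i j,
    (forall z, cnorm z <= 1 -> cnorm ((G i j).[z] - F z i j) < d) /\
    (forall y, ipnorm (@inner R H) (poly_op T (G i j) y - disc_op T (fun z => F z i j) y)
        <= d * ipnorm (@inner R H) y)}.
  have [g Hg] := @choice ('I_n * 'I_n)%type {poly R[i]} (fun ij q =>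
    (forall z, cnorm z <= 1 -> cnorm (q.[z] - F z ij.1 ij.2) < d) /\
    (forall y, ipnorm (@inner R H) (poly_op T q y - disc_op T (fun z => F z ij.1 ij.2) y)
        <= d * ipnorm (@inner R H) y)) (fun ij => disc_op_approx hw (FA ij.1 ij.2) d0).
  by exists (fun i j => g (i, j)) => i j; exact: (Hg (i, j)).
pose Gm : 'M[{poly R[i]}]_n := \matrix_(i, j) G i j.
have mK : 0 <= m + K * d by rewrite addr_ge0 // mulr_ge0 // ltW.
have Gb z (v : 'cV[R[i]]_n) : `|z| < 1 ->
    n2 (evmx z Gm *m v) <= real_complex R ((m + K * d) ^+ 2) * n2 v.
  move=> z1; have z1' : cnorm z <= 1 by rewrite ltW // -ltcR normc_normE.
  have Fb := mx_supnorm_le m0 E v z1.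
  have {}Fb : ipnorm (@cdot R n) (F z *m v) <= m * ipnorm (@cdot R n) v.
    rewrite -(ler_pXn2r (n := 2)) ?nnegrE ?mulr_ge0 ?ipnorm_ge0 //.
    by rewrite exprMn -lecR; move: Fb; rewrite -!euclidean_norm_sqr -rmorphM.
  have Db := @entrywise_small_mulmx R n (evmx z Gm - F z) d v.
  have {}Db : ipnorm (@cdot R n) ((evmx z Gm - F z) *m v) <= K * d * ipnorm (@cdot R n) v.
    apply: Db => i j; rewrite !mxE /horner_eval ltW //.
    by have [H1 _] := HG i j; exact: H1.
  have Sb : ipnorm (@cdot R n) (evmx z Gm *m v) <= (m + K * d) * ipnorm (@cdot R n) v.
    rewrite -(subrK (F z) (evmx z Gm)) mulmxDl (le_trans (ipnormD _ _ _)) //.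
    by rewrite mulrDl addrC; apply: lerD.
  rewrite -!euclidean_norm_sqr -rmorphM lecR -exprMn ler_pXn2r // nnegrE ?ipnorm_ge0 //.
  by rewrite mulr_ge0 ?ipnorm_ge0.
have := @polynomial_calculus_bound R H T n hw Gm (m + K * d) x mK Gb.
rewrite x1 mulr1 -normc_normE lecR => B1.
have xi i : ipnorm (@inner R H) (x i) <= 1.
  rewrite -(ler_pXn2r (n := 2)) ?nnegrE ?ipnorm_ge0 // expr1n -lecR ipnorm_sqr.
  have -> : real_complex R 1 = dsum_inner x x by rewrite x1 rmorph1.
  rewrite /dsum_inner (bigD1 i) //= lerDl.
  by apply: sumr_ge0 => j _; exact: dnorm_ge0.
set A := mxop _ x; set B := mxop _ x in B1.
have B2 : cnorm (dsum_inner A x - dsum_inner B x) <= K * d.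
  rewrite /dsum_inner -sumrB.
  apply: le_trans (cnorm_sum _ _) _.
  apply: (@le_trans _ _ (\sum_(i < n) \sum_(j < n) d)); last first.
    rewrite (eq_bigr (fun=> d *+ n)) => [|i _]; last by rewrite sumr_const card_ord.
    by rewrite sumr_const card_ord -mulrnA mulr_natl.
  apply: ler_sum => i _; rewrite -linearBl /=.
  apply: le_trans (cnorm_ip_le _ _ _) _.
  apply: le_trans (ler_wpM2l (ipnorm_ge0 _ _) (xi i)) _; rewrite mulr1.
  rewrite /A /B !ffunE -sumrB; apply: le_trans (ipnorm_sum _ _ _) _.
  apply: ler_sum => j _; rewrite mxE ipnorm_distC.
  have [_ H2] := HG i j; apply: le_trans (H2 _) _.
  by rewrite -[leRHS]mulr1; apply: ler_wpM2l => //; exact: ltW.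
suff : cnorm (dsum_inner A x) <= 5 / 4 * m + e by [].
rewrite -(subrK (dsum_inner B x) (dsum_inner A x)) (le_trans (cnormD _ _)) //.
have dE : d * (3 * K + 1) = e by rewrite /d divfK // gt_eqF //; lra.
have Kd : 0 <= K * d by rewrite mulr_ge0 // ltW.
lra.
Qed.

Theorem corollary3p3 (R : realType) (H : hilbertType R) (T : {linear H -> H})
    (n : nat) (hT : bounded_op T)
    (hw : (numerical_radius (@inner R H) T <= 1)%E) (hn : (1 <= n)%N) :
  (forall F : 'M[{poly R[i]}]_n,
    (numerical_radius (@dsum_inner R H n) (mxop (fun i j => poly_op T (F i j)))
     <= (5 / 4)%:E * mx_supnorm (horner_mx_fun F))%E) /\
  (forall F : R[i] -> 'M[R[i]]_n,
    (forall i j, disc_algebra (fun z => F z i j)) ->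
    (numerical_radius (@dsum_inner R H n)
       (mxop (fun i j => disc_op T (fun z => F z i j)))
     <= (5 / 4)%:E * mx_supnorm F)%E).
Proof.
by split=> F; [exact: polynomial_case | exact: disc_algebra_case].
Qed.
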